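(* For each integer $h\ge 1$ the scalar Allen-Cahn equation $$\Delta u=u^3-u,\qquad x\in\mathbb{R}^2,$$ has a classical solution $U:\mathbb{R}^2\to\mathbb{R}$ which satisfies the equivariance relation $$U(\omega^{1/h}x)=-U(x),\quad x\in\mathbb{R}^2,\qquad \omega^{1/h}=\begin{pmatrix}\cos\frac{\pi}{h}&-\sin\frac{\pi}{h}\\ \sin\frac{\pi}{h}&\cos\frac{\pi}{h}\end{pmatrix}.$$ Moreover there are positive constants $\mathring{C}$, $k$, $K$ and $\mathring{r}\ge\frac{(2\mathring{C}h)^2}{\pi^2}$ such that $$|U(x)+1|\le K e^{-k\,d(x,\partial Q)},\qquad x\in Q,$$ where $$Q=\Big\{x=x(r,\theta):\ r>\mathring{r},\ \frac{\mathring{C}}{\sqrt{r}}<\theta<\frac{\pi}{h}-\frac{\mathring{C}}{\sqrt{r}}\Big\}.$$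
   Context: $(r,\theta)$ are the polar coordinates of $x=x(r,\theta)=(r\cos\theta,r\sin\theta)\in\mathbb{R}^2$, and $d(x,\partial Q)$ is the Euclidean distance from $x$ to $\partial Q$. *)

(* Defs.v *)
From Stdlib Require Import Reals.
From Coquelicot Require Import Coquelicot.
Local Open Scope R_scope.

(* Subsets of the plane are curried predicates, matching Coquelicot's
   two-variable calculus on functions R -> R -> R. *)

Definition boundary2 (A : R -> R -> Prop) (x y : R) : Prop :=
  forall eps : R, 0 < eps ->
    (exists a b : R, A a b /\ dist_euc x y a b < eps) /\
    (exists a b : R, ~ A a b /\ dist_euc x y a b < eps).

(* [real] sends the infinite value obtained for the empty set to 0. *)
Definition dist_to_set (x y : R) (A : R -> R -> Prop) : R :=
  real (Glb_Rbar (fun d => exists a b : R, A a b /\ d = dist_euc x y a b)).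

Definition laplacian (u : R -> R -> R) (x y : R) : R :=
  partial_derive 2 0 u x y + partial_derive 0 2 u x y.

(* [ex_diff_n u 2] at every point says that u is of class C^2; it is needed
   because [partial_derive] is total. *)
Definition classical_allen_cahn (u : R -> R -> R) : Prop :=
  (forall x y : R, ex_diff_n u 2 x y) /\
  (forall x y : R, laplacian u x y = u x y ^ 3 - u x y).

Definition rotation_equivariant (h : nat) (u : R -> R -> R) : Prop :=
  let a := PI / INR h in
  forall x y : R,
    u (cos a * x - sin a * y) (sin a * x + cos a * y) = - u x y.

Definition sectorQ (h : nat) (C r0 : R) (x y : R) : Prop :=
  exists r theta : R,
    x = r * cos theta /\ y = r * sin theta /\
    r0 < r /\
    C / sqrt r < theta < PI / INR h - C / sqrt r.

(* Main.v *)
Require Import Defs.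
From Stdlib Require Import Reals.
From Coquelicot Require Import Coquelicot.
From Stdlib Require Import Lra Lia Psatz Factorial ClassicalEpsilon.
Local Open Scope R_scope.

(** The solution is the limit of a monotone iteration of linear problems.
    Write the equation as [4 u - Delta u = 5 u - u ^ 3]; the right-hand side is
    an increasing function of [u] on [-1, 1].  Let S be the closed sector
    [0 <= theta <= PI / h], and consider the functions that change sign under
    [y -> - y] and under the rotation by [PI / h].  They vanish on the sides of
    S and are determined by their values in S.  The inverse of [4 - Delta] on
    the whole plane commutes with these symmetries, so by the maximum principle
    in S (max_principle_sector) it preserves the order in S of functions of
    this class (resolvent_compare).  Starting from an explicit subsolution, the
    iterates increase in S and stay in [0, 1] (admissible_step, iterate_mono);
    their limit is an equivariant solution, smooth across the sides and at the
    origin because it solves a convolution equation on the whole plane.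

    The inverse of [4 - Delta] is the convolution with a radial function N,
    taken in polar coordinates centred at the point of evaluation.  Only the
    weights [r N(r)] and [- r N'(r)] enter, and both are continuous at [r = 0],
    so that no singular integral occurs.  N is obtained from the regular radial
    solution I by reduction of order, [N(r) = I(r) * int_r^oo ds / (s I(s)^2)];
    the bound [C / (1 + r)^2] for the two weights is all that is used at
    infinity.  On bounded functions the operators are bounded, linear and
    translation invariant; applied to
    [|f(x + s) - f(x) - s f'(x)| <= M s^2] this gives their derivatives.  The
    differential equation itself comes from one integration by parts along
    circles and one along rays (kernel_ibp, resolvent_eqn).  The constants M
    are uniform along the iteration, so the same inequality passes to the
    pointwise limit, which is therefore differentiable (sol_C11), and
    one more application of the operator makes it of class C^2.

    The subsolution equals 1/2 at distance at least 18 from both sides of S.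
    There the limit u is at least 1/2, so [w = 1 - u] satisfies
    [Delta w = u (1 + u) w >= (3/4) w], and comparison with a sum of hyperbolic cosines
    on a square shows that w decays exponentially with the distance to the
    sides (sol_decay).  Finally the sides of S lie outside Q and every
    segment that leaves Q meets the boundary of Q, so the distance to the
    boundary is at most the distance to the sides (dist_boundary_le).  The
    theorem holds for [U = - u], with any constant C; here [C = 1]. *)

(** * Integrals over the half line and limits of equi-Lipschitz functions *)

Lemma is_derive_eq {f : R -> R} {x l l' : R} : is_derive f x l -> l = l' -> is_derive f x l'.
Proof. intros H <-. exact H. Qed.

Ltac unfold_alg := unfold minus, plus, opp, mult; simpl; unfold mult; simpl.

(** Derivatives of integrals and of limits are obtained below from quadratic
    remainders: unlike differentiability, such bounds pass to pointwise limits and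
    through bounded linear operators. *)
Lemma is_derive_quad (f : R -> R) (x l M : R) :
  (forall h, Rabs (f (x + h) - f x - h * l) <= M * h ^ 2) -> is_derive f x l.
Proof.
intros H. apply is_derive_Reals. intros eps He.
assert (HM : 0 <= Rabs M) by apply Rabs_pos.
assert (Hd : 0 < eps / (Rabs M + 1)) by (apply Rdiv_lt_0_compat; lra).
exists (mkposreal _ Hd). intros h Hh Hlt. simpl in Hlt.
replace ((f (x + h) - f x) / h - l) with ((f (x + h) - f x - h * l) / h) by (field; exact Hh).
unfold Rdiv at 1. rewrite Rabs_mult, Rabs_inv.
assert (Hp : 0 < Rabs h) by (apply Rabs_pos_lt; exact Hh).
apply Rmult_lt_reg_r with (Rabs h); [exact Hp|].
rewrite Rmult_assoc, Rinv_l, Rmult_1_r by lra.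
specialize (H h).
assert (E : h ^ 2 = Rabs h ^ 2) by (rewrite pow2_abs; reflexivity).
rewrite E in H.
assert (Rabs h * (Rabs M + 1) < eps).
{ apply Rmult_lt_compat_r with (r := Rabs M + 1) in Hlt; [|lra].
  unfold Rdiv in Hlt. rewrite Rmult_assoc, Rinv_l in Hlt by lra. lra. }
assert (M <= Rabs M) by apply Rle_abs.
nra.
Qed.

Lemma taylor_lip (f f' : R -> R) (M : R) :
  (forall t, is_derive f t (f' t)) ->
  (forall s t, Rabs (f' s - f' t) <= M * Rabs (s - t)) ->
  forall x h, Rabs (f (x + h) - f x - h * f' x) <= M * h ^ 2.
Proof.
intros Hd HL x h.
assert (HM : 0 <= M).
{ specialize (HL 1 0). replace (1 - 0) with 1 in HL by ring. rewrite Rabs_R1 in HL.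
  pose proof (Rabs_pos (f' 1 - f' 0)). lra. }
destruct (MVT_gen f x (x + h) f') as [c [Hc Ec]].
- intros t _. apply Hd.
- intros t _. apply continuity_pt_filterlim.
  apply (ex_derive_continuous f t). exists (f' t). apply Hd.
- rewrite Ec. replace (f' c * (x + h - x) - h * f' x) with (h * (f' c - f' x)) by ring.
  rewrite Rabs_mult. specialize (HL c x).
  assert (Rabs (c - x) <= Rabs h).
  { unfold Rmin, Rmax in Hc; destruct (Rle_dec x (x + h)) in Hc; unfold Rabs;
    repeat destruct (Rcase_abs _); lra. }
  replace (h ^ 2) with (Rabs h * Rabs h) by (rewrite <- (pow2_abs h); ring).
  pose proof (Rabs_pos h). pose proof (Rabs_pos (c - x)).
  assert (Rabs (f' c - f' x) <= M * Rabs h) by nra. nra.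
Qed.

Lemma continuous_lip (f : R -> R) (M x : R) :
  (forall s t, Rabs (f s - f t) <= M * Rabs (s - t)) -> continuous f x.
Proof.
intros HL. apply continuity_pt_filterlim. intros eps He.
exists (eps / (Rabs M + 1)). pose proof (Rabs_pos M) as HM.
split; [apply Rdiv_lt_0_compat; lra|].
intros t [_ Ht]. unfold dist in *; simpl in *; unfold Rdist in *.
apply Rle_lt_trans with (1 := HL t x).
apply Rmult_lt_compat_r with (r := Rabs M + 1) in Ht; [|lra].
unfold Rdiv in Ht. rewrite Rmult_assoc, Rinv_l in Ht by lra.
pose proof (Rle_abs M). pose proof (Rabs_pos (t - x)). nra.
Qed.

Lemma ex_RInt_cont (f : R -> R) (a b : R) :
  (forall z, continuous f z) -> ex_RInt f a b.
Proof. intros H. apply (ex_RInt_continuous (V := R_CompleteNormedModule)). intros z _. apply H. Qed.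

Lemma continuous_lin (F G : R -> R) c z : continuous F z -> continuous G z ->
  continuous (fun r => F r + c * G r) z.
Proof.
intros HF HG. apply (continuous_plus F (fun r => c * G r)); [exact HF|]. apply (continuous_scal_r c G), HG.
Qed.

Lemma RInt_lin (F G : R -> R) c a b : (forall z, continuous F z) -> (forall z, continuous G z) ->
  RInt (fun r => F r + c * G r) a b = RInt F a b + c * RInt G a b.
Proof.
intros HF HG.
assert (H1 : is_RInt (fun r => F r + c * G r) a b (RInt F a b + c * RInt G a b)).
{ apply (is_RInt_plus (V := R_NormedModule) F (fun r => c * G r)).
  - apply (RInt_correct F), ex_RInt_cont, HF.
  - apply (is_RInt_scal (V := R_NormedModule) G). apply (RInt_correct G), ex_RInt_cont, HG. }
apply (is_RInt_unique (V := R_CompleteNormedModule)). exact H1.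
Qed.

(** The constant comes first: [bdd m f] and [lip L f] are read as bounds of norms.  The
    Lipschitz condition refers to the l^1 distance of the plane. *)
Definition bdd (m : R) (f : R -> R -> R) := forall x y, Rabs (f x y) <= m.
Definition lip (L : R) (f : R -> R -> R) := forall x y x' y',
  Rabs (f x y - f x' y') <= L * (Rabs (x - x') + Rabs (y - y')).

Lemma bdd_pos m f : bdd m f -> 0 <= m.
Proof. intros H. specialize (H 0 0). pose proof (Rabs_pos (f 0 0)). lra. Qed.

Lemma lip_pos L f : lip L f -> 0 <= L.
Proof.
intros H. specialize (H 1 0 0 0). pose proof (Rabs_pos (f 1 0 - f 0 0)).
rewrite !Rminus_0_r, Rabs_R1, Rabs_R0 in H. lra. Qed.

Lemma lip_continuous_pair L f x y : lip L f ->
  continuous (fun z : R * R => f (fst z) (snd z)) (x, y).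
Proof.
intros HL. pose proof (lip_pos _ _ HL) as HL0.
intros P [eps HP].
assert (Hd : 0 < eps / (2 * L + 1)) by (apply Rdiv_lt_0_compat; [apply cond_pos|lra]).
exists (mkposreal _ Hd). intros [u v] [Hu Hv]. simpl in *.
apply HP. unfold ball, AbsRing_ball, abs, minus, plus, opp in *; simpl in *.
unfold AbsRing_ball, abs, minus, plus, opp in *; simpl in *.
apply Rle_lt_trans with (1 := HL u v x y).
assert (E : (2 * L + 1) * (eps / (2 * L + 1)) = eps) by (field; lra).
change (Rabs (u - x) < eps / (2 * L + 1)) in Hu.
change (Rabs (v - y) < eps / (2 * L + 1)) in Hv.
nra.
Qed.

Lemma continuous_lip2 L f (p q : R -> R) t : lip L f ->
  continuous p t -> continuous q t -> continuous (fun s => f (p s) (q s)) t.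
Proof.
intros HL Hp Hq. apply (continuous_comp_2 p q f t Hp Hq).
apply lip_continuous_pair with L. exact HL.
Qed.

Lemma lip_continuity_2d L f x y : lip L f -> continuity_2d_pt f x y.
Proof.
intros HL. pose proof (lip_pos _ _ HL) as HL0. intros eps.
assert (Hd : 0 < eps / (2 * L + 1)) by (apply Rdiv_lt_0_compat; [apply cond_pos|lra]).
exists (mkposreal _ Hd). simpl. intros u v Hu Hv.
apply Rle_lt_trans with (1 := HL u v x y).
assert (E : (2 * L + 1) * (eps / (2 * L + 1)) = eps) by (field; lra).
nra.
Qed.

Lemma lim_abs_le {u : nat -> R} {l M : R} : is_lim_seq u l -> (forall n, Rabs (u n) <= M) -> Rabs l <= M.
Proof.
intros H Hu. apply (is_lim_seq_le _ (fun _ => M) _ _) with (2 := is_lim_seq_abs _ _ H) (3 := is_lim_seq_const M).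
exact Hu.
Qed.

(** The limit is taken along the integers, which suffices because the integrands
    satisfy [decay]. *)
Definition half_int (F : R -> R) : R := real (Lim_seq (fun n => RInt F 0 (INR n))).

(** The rate [(1 + r)^(-2)] has the elementary primitive [- 1 / (1 + r)], which turns
    all tail estimates into explicit numbers. *)
Definition decay (M : R) (F : R -> R) :=
  (forall z, continuous F z) /\ forall r, 0 <= r -> Rabs (F r) <= M / (1 + r) ^ 2.

Lemma decay_pos M F : decay M F -> 0 <= M.
Proof.
intros [_ H]. specialize (H 0 (Rle_refl 0)). pose proof (Rabs_pos (F 0)).
replace (M / (1 + 0) ^ 2) with M in H by field. lra.
Qed.

Lemma RInt_inv_sq M a b : 0 <= a <= b ->
  is_RInt (fun r => M / (1 + r) ^ 2) a b (M / (1 + a) - M / (1 + b)).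
Proof.
intros Hab.
replace (M / (1 + a) - M / (1 + b)) with (- M / (1 + b) - (- M / (1 + a))) by (field; lra).
apply (is_RInt_derive (V := R_CompleteNormedModule) (fun r => - M / (1 + r)) (fun r => M / (1 + r) ^ 2)).
- intros r Hr. rewrite Rmin_left, Rmax_right in Hr by lra.
  auto_derive; [lra|field; lra].
- intros r Hr. rewrite Rmin_left, Rmax_right in Hr by lra.
  apply (ex_derive_continuous (fun r => M / (1 + r) ^ 2)). auto_derive. nra.
Qed.

Lemma decay_RInt_bound M F a b : decay M F -> 0 <= a <= b ->
  Rabs (RInt F a b) <= M / (1 + a) - M / (1 + b).
Proof.
intros [Hc Hb] Hab.
apply (norm_RInt_le (V := R_NormedModule) F (fun r => M / (1 + r) ^ 2) a b).
- lra.
- intros r Hr. apply Hb. lra.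
- apply (RInt_correct F). apply ex_RInt_cont. exact Hc.
- apply RInt_inv_sq. lra.
Qed.

Lemma decay_RInt_diff M F a b : decay M F -> 0 <= a <= b ->
  Rabs (RInt F 0 b - RInt F 0 a) <= M / (1 + a).
Proof.
intros HF Hab. pose proof HF as [Hc Hb].
assert (E : RInt F 0 b = RInt F 0 a + RInt F a b).
{ symmetry. apply (RInt_Chasles F 0 a b); apply ex_RInt_cont; exact Hc. }
rewrite E, Rplus_minus_l.
apply Rle_trans with (1 := decay_RInt_bound M F a b HF Hab).
pose proof (decay_pos _ _ HF).
assert (0 <= M / (1 + b)) by (apply Rle_div_r; lra). lra.
Qed.

Lemma lim_over_INR M : is_lim_seq (fun n => M / (1 + INR n)) 0.
Proof.
replace (Finite 0) with (Rbar_mult M 0) by (simpl; f_equal; ring).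
apply (is_lim_seq_scal_l (fun n => / (1 + INR n)) M 0).
apply is_lim_seq_ext with (fun n => / INR (S n)).
- intros n. rewrite S_INR. f_equal. ring.
- apply (is_lim_seq_incr_1 (fun n => / INR n)).
  replace (Finite 0) with (Rbar_inv p_infty) by reflexivity.
  apply is_lim_seq_inv; [apply is_lim_seq_INR|discriminate].
Qed.

Lemma half_int_lim M F : decay M F -> is_lim_seq (fun n => RInt F 0 (INR n)) (half_int F).
Proof.
intros HF. unfold half_int. apply Lim_seq_correct'.
apply ex_lim_seq_cauchy_corr. intros eps.
assert (Hl := lim_over_INR M). apply is_lim_seq_spec in Hl.
destruct (Hl eps) as [N HN]. exists N.
assert (W : forall n m, (N <= n)%nat -> (n <= m)%nat ->
  Rabs (RInt F 0 (INR m) - RInt F 0 (INR n)) < eps).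
{ intros n m Hn Hm. apply Rle_lt_trans with (M / (1 + INR n)).
  - apply decay_RInt_diff; [exact HF|]. split; [apply pos_INR|apply le_INR; exact Hm].
  - specialize (HN n Hn). rewrite Rminus_0_r in HN. apply Rle_lt_trans with (2 := HN), Rle_abs. }
intros n m Hn Hm. destruct (Nat.le_ge_cases n m) as [H|H].
- rewrite Rabs_minus_sym. apply W; assumption.
- apply W; assumption.
Qed.

Lemma half_int_bound M F : decay M F -> Rabs (half_int F) <= M.
Proof.
intros HF.
apply (lim_abs_le (half_int_lim M F HF)).
intros n. apply Rle_trans with (1 := decay_RInt_bound M F 0 (INR n) HF (conj (Rle_refl 0) (pos_INR n))).
pose proof (decay_pos _ _ HF). pose proof (pos_INR n).
assert (0 <= M / (1 + INR n)) by (apply Rle_div_r; lra). lra.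
Qed.

Lemma half_int_tail M F N : decay M F -> Rabs (half_int F - RInt F 0 (INR N)) <= M / (1 + INR N).
Proof.
intros HF.
assert (H := is_lim_seq_abs _ _ (is_lim_seq_minus' _ _ _ _ (half_int_lim M F HF) (is_lim_seq_const (RInt F 0 (INR N))))).
apply (is_lim_seq_le_loc _ (fun _ => M / (1 + INR N)) _ _) with (2 := H) (3 := is_lim_seq_const _).
exists N. intros n Hn. apply decay_RInt_diff; [exact HF|].
split; [apply pos_INR|apply le_INR; exact Hn].
Qed.

Lemma decay_lin M M' F G c : decay M F -> decay M' G -> decay (M + Rabs c * M') (fun r => F r + c * G r).
Proof.
intros [CF BF] [CG BG]. split.
- intros z. apply continuous_lin; [apply CF|apply CG].
- intros r Hr. eapply Rle_trans; [apply Rabs_triang|]. rewrite (Rabs_mult c).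
  specialize (BF r Hr). specialize (BG r Hr). unfold Rdiv in *. rewrite Rmult_plus_distr_r.
  apply Rplus_le_compat; [exact BF|]. rewrite Rmult_assoc. apply Rmult_le_compat_l; [apply Rabs_pos|exact BG].
Qed.

Lemma half_int_lin M M' F G c : decay M F -> decay M' G ->
  half_int (fun r => F r + c * G r) = half_int F + c * half_int G.
Proof.
intros HF HG. unfold half_int at 1.
assert (H : is_lim_seq (fun n => RInt (fun r => F r + c * G r) 0 (INR n)) (half_int F + c * half_int G)).
{ apply is_lim_seq_ext with (fun n => RInt F 0 (INR n) + c * RInt G 0 (INR n)).
  - intros n. destruct HF as [HF _], HG as [HG _]. symmetry. apply RInt_lin; assumption.
  - apply is_lim_seq_plus'; [apply (half_int_lim M); exact HF|].
    apply (is_lim_seq_scal_l _ c (half_int G)). apply (half_int_lim M'); exact HG. }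
rewrite (is_lim_seq_unique _ _ H). reflexivity.
Qed.

Lemma half_int_ext F G : (forall r, 0 <= r -> F r = G r) -> half_int F = half_int G.
Proof.
intros H. unfold half_int. f_equal. apply Lim_seq_ext. intros n.
apply RInt_ext. intros r Hr. rewrite Rmin_left in Hr by apply pos_INR. apply H. lra.
Qed.

(** The tail bound is uniform in [n], so that convergence on bounded intervals
    is enough. *)
Lemma half_int_conv M (Fn : nat -> R -> R) F : (forall n, decay M (Fn n)) -> decay M F ->
  (forall N, is_lim_seq (fun n => RInt (Fn n) 0 (INR N)) (RInt F 0 (INR N))) ->
  is_lim_seq (fun n => half_int (Fn n)) (half_int F).
Proof.
intros Hn HF Hl. apply is_lim_seq_spec. intros eps.
assert (Hl0 := lim_over_INR M). apply is_lim_seq_spec in Hl0.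
assert (He3 : 0 < eps / 3) by (pose proof (cond_pos eps); lra).
destruct (Hl0 (mkposreal _ He3)) as [N HN]. specialize (HN N (Nat.le_refl N)).
simpl in HN. rewrite Rminus_0_r in HN.
assert (Hl1 := Hl N). apply is_lim_seq_spec in Hl1.
destruct (Hl1 (mkposreal _ He3)) as [N1 HN1]. exists N1. intros n Hn1.
specialize (HN1 n Hn1). simpl in HN1.
pose proof (half_int_tail M (Fn n) N (Hn n)) as T1.
pose proof (half_int_tail M F N HF) as T2.
pose proof (Rle_abs (M / (1 + INR N))).
replace (half_int (Fn n) - half_int F) with ((half_int (Fn n) - RInt (Fn n) 0 (INR N)) +
  ((RInt (Fn n) 0 (INR N) - RInt F 0 (INR N)) - (half_int F - RInt F 0 (INR N)))) by ring.
eapply Rle_lt_trans; [apply Rabs_triang|].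
eapply Rle_lt_trans; [apply Rplus_le_compat_l; unfold Rminus at 1; apply Rabs_triang|].
rewrite Rabs_Ropp. lra.
Qed.

Lemma lim_lip (Fn : nat -> R -> R) (F : R -> R) L :
  (forall n s t, Rabs (Fn n s - Fn n t) <= L * Rabs (s - t)) ->
  (forall t, is_lim_seq (fun n => Fn n t) (F t)) ->
  forall s t, Rabs (F s - F t) <= L * Rabs (s - t).
Proof.
intros HL Hl s t.
apply (lim_abs_le (is_lim_seq_minus' _ _ _ _ (Hl s) (Hl t))).
intros n. apply HL.
Qed.

(** On a step of length about [eps / L] all functions vary by less than [eps];
    pointwise convergence at the finitely many nodes then controls the interval. *)
Lemma equilip_unif (Fn : nat -> R -> R) (F : R -> R) L a b :
  (forall n s t, Rabs (Fn n s - Fn n t) <= L * Rabs (s - t)) ->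
  (forall t, is_lim_seq (fun n => Fn n t) (F t)) ->
  forall eps, 0 < eps -> exists N, forall n t, (N <= n)%nat -> a <= t <= b ->
  Rabs (Fn n t - F t) <= eps.
Proof.
intros HL Hl eps He.
pose proof (lim_lip Fn F L HL Hl) as HLF.
assert (HL0 : 0 <= L).
{ specialize (HLF 1 0). replace (1 - 0) with 1 in HLF by ring. rewrite Rabs_R1 in HLF.
  pose proof (Rabs_pos (F 1 - F 0)). lra. }
(* small enough for 2 L d < eps / 2, also when L = 0 *)
set (d := eps / (4 * L + 1)).
assert (Hd : 0 < d) by (apply Rdiv_lt_0_compat; lra).
assert (Ed : (4 * L + 1) * d = eps) by (unfold d; field; lra).
assert (Hm : forall m, exists N, forall n t, (N <= n)%nat -> a <= t <= a + INR m * d ->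
  Rabs (Fn n t - F t) <= eps).
{ assert (Hstep : forall c, exists N, forall n t, (N <= n)%nat -> c <= t <= c + d ->
    Rabs (Fn n t - F t) <= eps).
  { intros c. assert (Hc := Hl c). apply is_lim_seq_spec in Hc.
    assert (He2 : 0 < eps / 2) by lra.
    destruct (Hc (mkposreal _ He2)) as [N HN]. exists N. intros n t Hn Ht.
    specialize (HN n Hn). simpl in HN.
    pose proof (HL n t c) as A1. pose proof (HLF c t) as A2.
    rewrite (Rabs_minus_sym c t) in A2.
    rewrite (Rabs_right (t - c)) in A1, A2 by lra.
    replace (Fn n t - F t) with ((Fn n t - Fn n c) + ((Fn n c - F c) + (F c - F t))) by ring.
    eapply Rle_trans; [apply Rabs_triang|].
    eapply Rle_trans; [apply Rplus_le_compat_l, Rabs_triang|].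
    assert (L * (t - c) <= L * d) by (apply Rmult_le_compat_l; lra).
    lra. }
  induction m as [|m [N HN]].
  - destruct (Hstep a) as [N HN]. exists N. intros n t Hn Ht. simpl in Ht.
    apply HN; [exact Hn|]. lra.
  - destruct (Hstep (a + INR m * d)) as [N' HN']. exists (max N N').
    intros n t Hn Ht. rewrite S_INR in Ht.
    destruct (Rle_dec t (a + INR m * d)) as [H|H].
    + apply HN; [lia|lra].
    + apply HN'; [lia|lra]. }
destruct (INR_unbounded ((b - a) / d)) as [m Hmm].
destruct (Hm m) as [N HN]. exists N. intros n t Hn Ht. apply HN; [exact Hn|].
assert (b - a < INR m * d).
{ apply Rmult_lt_compat_r with (r := d) in Hmm; [|exact Hd].
  replace ((b - a) / d * d) with (b - a) in Hmm by (field; lra). lra. }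
lra.
Qed.

(** The substitute for dominated convergence: the weight [w] is merely
    continuous, only the other factor has to be equi-Lipschitz. *)
Lemma RInt_equilip_lim (w : R -> R) W (Fn : nat -> R -> R) (F : R -> R) L a b : a <= b ->
  (forall t, continuous w t) -> (forall t, a <= t <= b -> Rabs (w t) <= W) ->
  (forall n s t, Rabs (Fn n s - Fn n t) <= L * Rabs (s - t)) ->
  (forall t, is_lim_seq (fun n => Fn n t) (F t)) ->
  is_lim_seq (fun n => RInt (fun t => w t * Fn n t) a b) (RInt (fun t => w t * F t) a b).
Proof.
intros Hab Hw HW HL Hl. pose proof (lim_lip Fn F L HL Hl) as HLF.
assert (HW0 : 0 <= W) by (apply Rle_trans with (2 := HW a (conj (Rle_refl a) Hab)), Rabs_pos).
apply is_lim_seq_spec. intros eps.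
assert (Hden : 0 < (b - a) * W + 1) by nra.
destruct (equilip_unif Fn F L a b HL Hl (eps / ((b - a) * W + 1))) as [N HN].
{ apply Rdiv_lt_0_compat; [apply cond_pos|exact Hden]. }
exists N. intros n Hn.
assert (C1 : forall z, continuous (fun t => w t * Fn n t) z).
{ intros z. apply (continuous_mult w (Fn n)); [apply Hw|]. apply continuous_lip with L, HL. }
assert (C2 : forall z, continuous (fun t => w t * F t) z).
{ intros z. apply (continuous_mult w F); [apply Hw|]. apply continuous_lip with L, HLF. }
set (e := eps / ((b - a) * W + 1)) in *.
assert (He : 0 < e) by (apply Rdiv_lt_0_compat; [apply cond_pos|exact Hden]).
assert (Ee : ((b - a) * W + 1) * e = eps) by (unfold e; field; lra).
replace (RInt (fun t => w t * Fn n t) a b - RInt (fun t => w t * F t) a b)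
  with (RInt (fun t => w t * Fn n t - w t * F t) a b).
2:{ apply (RInt_minus (V := R_CompleteNormedModule)); apply ex_RInt_cont; assumption. }
apply Rle_lt_trans with ((b - a) * (W * e)).
2:{ nra. }
apply abs_RInt_le_const; [exact Hab| |].
- apply ex_RInt_cont. intros z. apply (continuous_minus (fun t => w t * Fn n t) (fun t => w t * F t)); auto.
- intros t Ht. replace (w t * Fn n t - w t * F t) with (w t * (Fn n t - F t)) by ring.
  rewrite Rabs_mult. specialize (HN n t Hn Ht). specialize (HW t Ht).
  apply Rmult_le_compat; auto using Rabs_pos.
Qed.

Lemma RInt_ext_R (F G : R -> R) a b : (forall t, F t = G t) -> RInt F a b = RInt G a b.
Proof. intros H. apply RInt_ext. intros t _. apply H. Qed.

(** * Functions with Lipschitz gradient and convolution with radial kernels *)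

(** The partial derivatives are data, so that they can be identified with other
    expressions; one constant serves for all bounds, since only its independence of
    the functions of a sequence matters. *)
Record C11 (M : R) (f f1 f2 : R -> R -> R) : Prop := {
  C11_bdd : bdd M f;
  C11_bdd1 : bdd M f1;
  C11_bdd2 : bdd M f2;
  C11_lip1 : lip M f1;
  C11_lip2 : lip M f2;
  C11_der1 : forall x y, is_derive (fun t => f t y) x (f1 x y);
  C11_der2 : forall x y, is_derive (fun t => f x t) y (f2 x y) }.
Arguments C11_bdd {M f f1 f2}.
Arguments C11_bdd1 {M f f1 f2}.
Arguments C11_bdd2 {M f f1 f2}.
Arguments C11_lip1 {M f f1 f2}.
Arguments C11_lip2 {M f f1 f2}.
Arguments C11_der1 {M f f1 f2}.
Arguments C11_der2 {M f f1 f2}.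

Lemma lip_1d_deriv (f f' : R -> R) M : (forall t, is_derive f t (f' t)) ->
  (forall t, Rabs (f' t) <= M) -> forall s t, Rabs (f s - f t) <= M * Rabs (s - t).
Proof.
intros Hd Hb s t.
destruct (MVT_gen f t s f') as [c [_ E]].
- intros; apply Hd.
- intros u _. apply continuity_pt_filterlim.
  apply (ex_derive_continuous f u). exists (f' u). apply Hd.
- rewrite E, Rabs_mult. apply Rmult_le_compat_r; [apply Rabs_pos|apply Hb].
Qed.

Lemma lip_of_partials f f1 f2 M : bdd M f1 -> bdd M f2 ->
  (forall x y, is_derive (fun t => f t y) x (f1 x y)) ->
  (forall x y, is_derive (fun t => f x t) y (f2 x y)) -> lip M f.
Proof.
intros H1 H2 D1 D2 x y x' y'.
replace (f x y - f x' y') with ((f x y - f x' y) + (f x' y - f x' y')) by ring.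
eapply Rle_trans; [apply Rabs_triang|]. rewrite Rmult_plus_distr_l.
apply Rplus_le_compat.
- apply (lip_1d_deriv (fun t => f t y) (fun t => f1 t y)); [intros; apply D1|intros; apply H1].
- apply (lip_1d_deriv (fun t => f x' t) (fun t => f2 x' t)); [intros; apply D2|intros; apply H2].
Qed.

Lemma C11_lip {M f f1 f2} : C11 M f f1 f2 -> lip M f.
Proof. intros H. apply (lip_of_partials f f1 f2); apply H. Qed.

Lemma lip_x L f y : lip L f -> forall s t, Rabs (f s y - f t y) <= L * Rabs (s - t).
Proof. intros H s t. specialize (H s y t y). rewrite Rminus_diag, Rabs_R0, Rplus_0_r in H. exact H. Qed.

Lemma lip_y L f x : lip L f -> forall s t, Rabs (f x s - f x t) <= L * Rabs (s - t).
Proof. intros H s t. specialize (H x s x t). rewrite Rminus_diag, Rabs_R0, Rplus_0_l in H. exact H. Qed.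

(** Move first in [x], then in [y]; the Lipschitz bound of [f2] corrects for the
    derivative being taken at the displaced point. *)
Lemma C11_taylor {M f f1 f2} : C11 M f f1 f2 -> forall x y a b,
  Rabs (f (x + a) (y + b) - f x y - (f1 x y * a + f2 x y * b)) <= 2 * M * (a ^ 2 + b ^ 2).
Proof.
intros H x y a b.
pose proof (taylor_lip (fun t => f t y) (fun t => f1 t y) M (fun t => C11_der1 H t y)
  (lip_x _ _ y (C11_lip1 H)) x a) as A1.
pose proof (taylor_lip (fun t => f (x + a) t) (fun t => f2 (x + a) t) M (fun t => C11_der2 H _ t)
  (lip_y _ _ (x + a) (C11_lip2 H)) y b) as A2.
pose proof (lip_x _ _ y (C11_lip2 H) (x + a) x) as A3.
replace (x + a - x) with a in A3 by ring.
pose proof (bdd_pos _ _ (C11_bdd H)) as HM.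
simpl in A1, A2.
replace (f (x + a) (y + b) - f x y - (f1 x y * a + f2 x y * b)) with
 ((f (x + a) (y + b) - f (x + a) y - b * f2 (x + a) y) + ((f (x + a) y - f x y - a * f1 x y)
  + b * (f2 (x + a) y - f2 x y))) by ring.
eapply Rle_trans; [apply Rabs_triang|].
eapply Rle_trans; [apply Rplus_le_compat_l, Rabs_triang|].
rewrite (Rabs_mult b).
assert (Rabs b * Rabs (f2 (x + a) y - f2 x y) <= Rabs b * (M * Rabs a))
  by (apply Rmult_le_compat_l; [apply Rabs_pos|exact A3]).
assert (E1 : a ^ 2 = Rabs a ^ 2) by (symmetry; apply pow2_abs).
assert (E2 : b ^ 2 = Rabs b ^ 2) by (symmetry; apply pow2_abs).
simpl in E1, E2.
assert (0 <= M * (Rabs a - Rabs b) ^ 2) by (apply Rmult_le_pos; [exact HM|apply pow2_ge_0]).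
nra.
Qed.

Lemma C11_taylor_x {M f f1 f2} : C11 M f f1 f2 -> forall h x y,
  Rabs (f (x + h) y - f x y - h * f1 x y) <= M * h ^ 2.
Proof.
intros H h x y. apply (taylor_lip (fun t => f t y) (fun t => f1 t y) M (fun t => C11_der1 H t y)
  (lip_x _ _ y (C11_lip1 H)) x h). Qed.

Lemma C11_taylor_y {M f f1 f2} : C11 M f f1 f2 -> forall h x y,
  Rabs (f x (y + h) - f x y - h * f2 x y) <= M * h ^ 2.
Proof.
intros H h x y. apply (taylor_lip (fun t => f x t) (fun t => f2 x t) M (fun t => C11_der2 H x t)
  (lip_y _ _ x (C11_lip2 H)) y h). Qed.

Lemma C11_chain {M f f1 f2} {p q : R -> R} t {p' q'} : C11 M f f1 f2 ->
  is_derive p t p' -> is_derive q t q' ->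
  is_derive (fun s => f (p s) (q s)) t (f1 (p t) (q t) * p' + f2 (p t) (q t) * q').
Proof.
intros H Hp Hq. apply is_derive_Reals. apply is_derive_Reals in Hp. apply is_derive_Reals in Hq.
apply derivable_pt_lim_comp_2d; [|exact Hp|exact Hq].
pose proof (bdd_pos _ _ (C11_bdd H)) as HM.
intros eps.
assert (Hd : 0 < eps / (4 * M + 1)) by (apply Rdiv_lt_0_compat; [apply cond_pos|lra]).
exists (mkposreal _ Hd). simpl. intros u v Hu Hv.
assert (Ed : (4 * M + 1) * (eps / (4 * M + 1)) = eps) by (field; lra).
pose proof (C11_taylor H (p t) (q t) (u - p t) (v - q t)) as A.
replace (p t + (u - p t)) with u in A by ring. replace (q t + (v - q t)) with v in A by ring.
apply Rle_trans with (1 := A).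
set (m := Rmax (Rabs (u - p t)) (Rabs (v - q t))).
assert (Hm1 : Rabs (u - p t) <= m) by apply Rmax_l.
assert (Hm2 : Rabs (v - q t) <= m) by apply Rmax_r.
assert (Hm : m < eps / (4 * M + 1)) by (apply Rmax_lub_lt; assumption).
rewrite <- (pow2_abs (u - p t)), <- (pow2_abs (v - q t)).
pose proof (Rabs_pos (u - p t)). pose proof (Rabs_pos (v - q t)).
assert (Rabs (u - p t) ^ 2 <= m * m) by nra.
assert (Rabs (v - q t) ^ 2 <= m * m) by nra.
assert (4 * M * m <= eps) by nra.
nra.
Qed.

(** The angular factors 1, cos, sin and their products. *)
Definition weight (a : R -> R) := (forall z, continuous a z) /\ forall z, Rabs (a z) <= 1.

Lemma weight_1 : weight (fun _ => 1).
Proof. split; [intros; apply continuous_const|intros; rewrite Rabs_R1; lra]. Qed.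

Lemma weight_cos : weight cos.
Proof. split; [intros; apply continuous_cos|]. intros z. apply Rabs_le, COS_bound. Qed.

Lemma weight_sin : weight sin.
Proof. split; [intros; apply continuous_sin|]. intros z. apply Rabs_le, SIN_bound. Qed.

Lemma weight_mult a b : weight a -> weight b -> weight (fun z => a z * b z).
Proof.
intros [Ca Ha] [Cb Hb]. split.
- intros z. apply (continuous_mult a b); auto.
- intros z. rewrite Rabs_mult. specialize (Ha z). specialize (Hb z).
  pose proof (Rabs_pos (a z)). pose proof (Rabs_pos (b z)). nra.
Qed.

Definition circ (a : R -> R) (f : R -> R -> R) (x y r : R) : R :=
  RInt (fun p => a p * f (x + r * cos p) (y + r * sin p)) 0 (2 * PI).

(** Convolution with the kernel [k(r) a(phi) / r] written in polar coordinates: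
    the Jacobian is absorbed in [k]. *)
Definition conv (k a : R -> R) (f : R -> R -> R) (x y : R) : R :=
  half_int (fun r => k r * circ a f x y r).

Lemma circ_cont a f L x y r : weight a -> lip L f ->
  forall z, continuous (fun p => a p * f (x + r * cos p) (y + r * sin p)) z.
Proof.
intros [Ca _] HL z. apply (continuous_mult a (fun p => f (x + r * cos p) (y + r * sin p))); [apply Ca|].
apply (continuous_lip2 L f (fun p => x + r * cos p) (fun p => y + r * sin p)); [exact HL| |].
- apply (ex_derive_continuous (fun p => x + r * cos p)). auto_derive. exact I.
- apply (ex_derive_continuous (fun p => y + r * sin p)). auto_derive. exact I.
Qed.

Lemma two_PI_pos : 0 <= 2 * PI.
Proof. pose proof PI_RGT_0. lra. Qed.

Lemma circ_bound a f L m x y r : weight a -> lip L f -> bdd m f ->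
  Rabs (circ a f x y r) <= 2 * PI * m.
Proof.
intros Wa HL Hm. unfold circ.
replace (2 * PI * m) with ((2 * PI - 0) * m) by ring.
apply abs_RInt_le_const; [apply two_PI_pos|apply ex_RInt_cont, circ_cont with L; assumption|].
intros t _. rewrite Rabs_mult. destruct Wa as [_ Wa]. specialize (Wa t).
specialize (Hm (x + r * cos t) (y + r * sin t)).
pose proof (Rabs_pos (a t)). pose proof (Rabs_pos (f (x + r * cos t) (y + r * sin t))). nra.
Qed.

Lemma circ_lin a f g L L' c x y r : weight a -> lip L f -> lip L' g ->
  circ a (fun u v => f u v + c * g u v) x y r = circ a f x y r + c * circ a g x y r.
Proof.
intros Wa Hf Hg. unfold circ.
rewrite <- RInt_lin by (apply circ_cont with (L := L) + apply circ_cont with (L := L'); assumption).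
apply RInt_ext_R. intros p. ring.
Qed.

Lemma lip_weaken L L' f : lip L f -> L <= L' -> lip L' f.
Proof.
intros H HL x y x' y'. apply Rle_trans with (1 := H x y x' y').
apply Rmult_le_compat_r; [|exact HL]. pose proof (Rabs_pos (x - x')). pose proof (Rabs_pos (y - y')). lra.
Qed.

Lemma bdd_weaken m m' f : bdd m f -> m <= m' -> bdd m' f.
Proof. intros H Hm x y. apply Rle_trans with (1 := H x y), Hm. Qed.

Lemma lip_lin L L' f g c : lip L f -> lip L' g -> lip (L + Rabs c * L') (fun u v => f u v + c * g u v).
Proof.
intros Hf Hg x y x' y'.
replace (f x y + c * g x y - (f x' y' + c * g x' y')) with ((f x y - f x' y') + c * (g x y - g x' y')) by ring.
eapply Rle_trans; [apply Rabs_triang|]. rewrite Rabs_mult, Rmult_plus_distr_r.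
apply Rplus_le_compat; [apply Hf|]. rewrite Rmult_assoc. apply Rmult_le_compat_l; [apply Rabs_pos|apply Hg].
Qed.

Lemma bdd_lin m m' f g c : bdd m f -> bdd m' g -> bdd (m + Rabs c * m') (fun x y => f x y + c * g x y).
Proof.
intros Hf Hg x y. eapply Rle_trans; [apply Rabs_triang|]. rewrite Rabs_mult.
apply Rplus_le_compat; [apply Hf|]. apply Rmult_le_compat_l; [apply Rabs_pos|apply Hg].
Qed.

Lemma lip_shift L f a b : lip L f -> lip L (fun u v => f (u + a) (v + b)).
Proof.
intros H x y x' y'. eapply Rle_trans; [apply H|].
replace (x + a - (x' + a)) with (x - x') by ring. replace (y + b - (y' + b)) with (y - y') by ring.
apply Rle_refl.
Qed.

Lemma circ_shift a f x y r h h' : circ a f (x + h) (y + h') r = circ a (fun u v => f (u + h) (v + h')) x y r.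
Proof. unfold circ. apply RInt_ext_R. intros p. f_equal. f_equal; ring. Qed.

Lemma circ_lip_r a f L x y : weight a -> lip L f ->
  forall r s, Rabs (circ a f x y r - circ a f x y s) <= 2 * PI * (2 * L) * Rabs (r - s).
Proof.
intros Wa HL r s. unfold circ.
assert (E : RInt (fun p => a p * f (x + r * cos p) (y + r * sin p) + (-1) * (a p * f (x + s * cos p) (y + s * sin p))) 0 (2 * PI)
  = circ a f x y r - circ a f x y s).
{ rewrite RInt_lin by (apply circ_cont with L; assumption). unfold circ, Rminus. f_equal. ring. }
unfold circ in E. rewrite <- E.
replace (2 * PI * (2 * L) * Rabs (r - s)) with ((2 * PI - 0) * (2 * L * Rabs (r - s))) by ring.
apply abs_RInt_le_const; [apply two_PI_pos| |].
- apply ex_RInt_cont. intros z. apply (continuous_lin (fun p => a p * f (x + r * cos p) (y + r * sin p))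
     (fun p => a p * f (x + s * cos p) (y + s * sin p))); apply circ_cont with L; assumption.
- intros p _.
  replace (a p * f (x + r * cos p) (y + r * sin p) + -1 * (a p * f (x + s * cos p) (y + s * sin p)))
   with (a p * (f (x + r * cos p) (y + r * sin p) - f (x + s * cos p) (y + s * sin p))) by ring.
  rewrite Rabs_mult. destruct Wa as [_ Wa]. specialize (Wa p).
  pose proof (HL (x + r * cos p) (y + r * sin p) (x + s * cos p) (y + s * sin p)) as A.
  replace (x + r * cos p - (x + s * cos p)) with ((r - s) * cos p) in A by ring.
  replace (y + r * sin p - (y + s * sin p)) with ((r - s) * sin p) in A by ring.
  rewrite !Rabs_mult in A.
  pose proof (proj2 weight_cos p) as C1. pose proof (proj2 weight_sin p) as C2.
  pose proof (lip_pos _ _ HL). pose proof (Rabs_pos (r - s)).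
  assert (Rabs (r - s) * Rabs (cos p) + Rabs (r - s) * Rabs (sin p) <= 2 * Rabs (r - s)) by nra.
  assert (Rabs (f (x + r * cos p) (y + r * sin p) - f (x + s * cos p) (y + s * sin p)) <= 2 * L * Rabs (r - s)) by nra.
  pose proof (Rabs_pos (a p)).
  pose proof (Rabs_pos (f (x + r * cos p) (y + r * sin p) - f (x + s * cos p) (y + s * sin p))). nra.
Qed.

Lemma circ_decay B k a f L m x y : decay B k -> weight a -> lip L f -> bdd m f ->
  decay (2 * PI * B * m) (fun r => k r * circ a f x y r).
Proof.
intros [Ck Hk] Wa HL Hm. split.
- intros z. apply (continuous_mult k (circ a f x y)); [apply Ck|].
  apply continuous_lip with (2 * PI * (2 * L)). apply circ_lip_r; assumption.
- intros r Hr. rewrite Rabs_mult. specialize (Hk r Hr).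
  pose proof (circ_bound a f L m x y r Wa HL Hm).
  replace (2 * PI * B * m / (1 + r) ^ 2) with (B / (1 + r) ^ 2 * (2 * PI * m)) by (field; lra).
  apply Rmult_le_compat; auto using Rabs_pos.
Qed.

Lemma conv_bound B k a f L m : decay B k -> weight a -> lip L f -> bdd m f ->
  bdd (2 * PI * B * m) (conv k a f).
Proof. intros Hk Wa HL Hm x y. apply half_int_bound. apply circ_decay with L; assumption. Qed.

Lemma conv_lin B k a f g L L' m m' c x y : decay B k -> weight a -> lip L f -> bdd m f -> lip L' g -> bdd m' g ->
  conv k a (fun u v => f u v + c * g u v) x y = conv k a f x y + c * conv k a g x y.
Proof.
intros Hk Wa Lf Bf Lg Bg. unfold conv.
rewrite <- (half_int_lin (2 * PI * B * m) (2 * PI * B * m')) by (apply circ_decay with (L := L) + apply circ_decay with (L := L'); assumption).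
apply half_int_ext. intros r _. rewrite circ_lin with (L := L) (L' := L') by assumption. ring.
Qed.

Lemma conv_shift k a f x y h h' : conv k a f (x + h) (y + h') = conv k a (fun u v => f (u + h) (v + h')) x y.
Proof. unfold conv. apply half_int_ext. intros r _. rewrite circ_shift. reflexivity. Qed.

(** The operator commutes with translations, so that a difference of values is
    the operator applied to a difference of translates. *)
Lemma conv_lip B k a f L m : decay B k -> weight a -> lip L f -> bdd m f ->
  lip (2 * PI * B * L) (conv k a f).
Proof.
intros Hk Wa HL Hm x y x' y'.
pose proof (conv_shift k a f x' y' (x - x') (y - y')) as E.
replace (x' + (x - x')) with x in E by ring. replace (y' + (y - y')) with y in E by ring.
assert (HL' : lip L (fun u v => f (u + (x - x')) (v + (y - y')))) by (apply lip_shift; exact HL).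
assert (Hm' : bdd m (fun u v => f (u + (x - x')) (v + (y - y')))) by (intros u v; apply Hm).
replace (conv k a f x y - conv k a f x' y') with (conv k a f x y + (-1) * conv k a f x' y') by ring.
rewrite E, <- (conv_lin B k a _ f L L m m) by assumption.
rewrite Rmult_assoc.
assert (Hb : bdd (L * (Rabs (x - x') + Rabs (y - y'))) (fun u v => f (u + (x - x')) (v + (y - y')) + (-1) * f u v)).
{ intros u v. replace (f (u + (x - x')) (v + (y - y')) + (-1) * f u v) with (f (u + (x - x')) (v + (y - y')) - f u v) by ring.
  eapply Rle_trans; [apply HL|].
  replace (u + (x - x') - u) with (x - x') by ring. replace (v + (y - y') - v) with (y - y') by ring. apply Rle_refl. }
exact (conv_bound B k a _ _ _ Hk Wa (lip_lin L L _ _ (-1) HL' HL) Hb x' y').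
Qed.

(** A Taylor remainder of the convolution is the convolution of the Taylor
    remainder, hence bounded by its supremum. *)
Lemma conv_taylor B k a L m C s1 s2 h f g : decay B k -> weight a -> lip L f -> bdd m f -> lip L g -> bdd m g ->
  (forall u v, Rabs (f (u + s1) (v + s2) - f u v - h * g u v) <= C) ->
  forall x y, Rabs (conv k a f (x + s1) (y + s2) - conv k a f x y - h * conv k a g x y) <= 2 * PI * B * C.
Proof.
intros Hk Wa Lf Bf Lg Bg HC x y.
assert (Ls : lip L (fun u v => f (u + s1) (v + s2))) by (apply lip_shift; exact Lf).
assert (Bs : bdd m (fun u v => f (u + s1) (v + s2))) by (intros u v; apply Bf).
rewrite conv_shift.
replace (conv k a (fun u v => f (u + s1) (v + s2)) x y - conv k a f x y - h * conv k a g x y) with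
  (conv k a (fun u v => f (u + s1) (v + s2)) x y + (-1) * (conv k a f x y + h * conv k a g x y)) by ring.
rewrite <- (conv_lin B k a f g L L m m) by assumption.
pose proof (lip_lin L L f g h Lf Lg) as L2. pose proof (bdd_lin m m f g h Bf Bg) as B2.
rewrite <- (conv_lin B k a _ _ L _ m _ (-1) x y Hk Wa Ls Bs L2 B2).
refine (conv_bound B k a _ _ _ Hk Wa (lip_lin _ _ _ _ (-1) Ls L2) _ x y).
intros u v. replace (f (u + s1) (v + s2) + -1 * (f u v + h * g u v)) with
  (f (u + s1) (v + s2) - f u v - h * g u v) by ring.
apply HC.
Qed.

Lemma conv_der1 B k a M f f1 f2 x y : decay B k -> weight a -> C11 M f f1 f2 ->
  is_derive (fun t => conv k a f t y) x (conv k a f1 x y).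
Proof.
intros Hk Wa H. apply (is_derive_quad (fun t => conv k a f t y) _ _ (2 * PI * B * M)). intros h.
rewrite <- (Rplus_0_r y) at 1. rewrite Rmult_assoc.
apply (conv_taylor B k a M M _ h 0 h); try apply H; try assumption; [apply (C11_lip H)|].
intros u v. rewrite Rplus_0_r. apply (C11_taylor_x H).
Qed.

Lemma conv_der2 B k a M f f1 f2 x y : decay B k -> weight a -> C11 M f f1 f2 ->
  is_derive (fun t => conv k a f x t) y (conv k a f2 x y).
Proof.
intros Hk Wa H. apply (is_derive_quad (fun t => conv k a f x t) _ _ (2 * PI * B * M)). intros h.
rewrite <- (Rplus_0_r x) at 1. rewrite Rmult_assoc.
apply (conv_taylor B k a M M _ 0 h h); try apply H; try assumption; [apply (C11_lip H)|].
intros u v. rewrite Rplus_0_r. apply (C11_taylor_y H).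
Qed.

(** The equi-Lipschitz limit is applied twice: on the circle of radius [r], then in
    [r], where the circle integrals are equi-Lipschitz as well. *)
Lemma conv_lim B k a (fn : nat -> R -> R -> R) (f : R -> R -> R) L m x y : decay B k -> weight a ->
  (forall n, lip L (fn n)) -> (forall n, bdd m (fn n)) ->
  (forall u v, is_lim_seq (fun n => fn n u v) (f u v)) ->
  is_lim_seq (fun n => conv k a (fn n) x y) (conv k a f x y).
Proof.
intros Hk Wa HL Hm Hl.
assert (Lf : lip L f).
{ intros u v u' v'.
  apply (lim_abs_le (is_lim_seq_minus' _ _ _ _ (Hl u v) (Hl u' v'))).
  intros n. apply HL. }
assert (Bf : bdd m f).
{ intros u v. apply (lim_abs_le (Hl u v)).
  intros n. apply Hm. }
unfold conv. apply half_int_conv with (2 * PI * B * m).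
- intros n. apply circ_decay with L; auto.
- apply circ_decay with L; auto.
- intros N. destruct Hk as [Ck Hk].
  pose proof (fun r Hr => Hk r Hr) as Hk'.
  apply RInt_equilip_lim with (W := B) (L := 2 * PI * (2 * L)).
  + apply pos_INR.
  + exact Ck.
  + intros t [Ht _]. apply Rle_trans with (1 := Hk t Ht).
    pose proof (decay_pos B k (conj Ck Hk)).
    apply Rle_div_l; [nra|]. nra.
  + intros n. apply circ_lip_r; auto.
  + intros r. unfold circ.
    apply RInt_equilip_lim with (W := 1) (L := L * (2 * Rabs r)).
    * apply two_PI_pos.
    * apply Wa.
    * intros; apply Wa.
    * intros n s t. eapply Rle_trans; [apply HL|].
      replace (x + r * cos s - (x + r * cos t)) with (r * (cos s - cos t)) by ring.
      replace (y + r * sin s - (y + r * sin t)) with (r * (sin s - sin t)) by ring.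
      rewrite !Rabs_mult.
      assert (A1 : Rabs (cos s - cos t) <= 1 * Rabs (s - t)).
      { apply (lip_1d_deriv cos (fun u => - sin u)).
        - intros u. auto_derive; [exact I|ring].
        - intros u. rewrite Rabs_Ropp. apply weight_sin. }
      assert (A2 : Rabs (sin s - sin t) <= 1 * Rabs (s - t)).
      { apply (lip_1d_deriv sin cos).
        - intros u. auto_derive; [exact I|ring].
        - intros u. apply weight_cos. }
      rewrite Rmult_assoc. apply Rmult_le_compat_l; [apply (lip_pos L (fn n)); auto|].
      pose proof (Rabs_pos r). nra.
    * intros p. apply Hl.
Qed.

(** Differentiation under the integral sign, through the remainder of second
    order of [f], uniform in the angle. *)
Lemma circ_der_r a M f f1 f2 x y r : weight a -> C11 M f f1 f2 ->
  is_derive (circ a f x y) r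
    (circ (fun p => a p * cos p) f1 x y r + circ (fun p => a p * sin p) f2 x y r).
Proof.
intros Wa H. apply (is_derive_quad _ _ _ (2 * PI * (2 * M))). intros h.
pose proof (C11_lip H) as Lf. pose proof H as [Bf B1 B2 L1 L2 _ _].
pose proof (weight_mult _ _ Wa weight_cos) as Wc. pose proof (weight_mult _ _ Wa weight_sin) as Ws.
pose proof (circ_cont a f M x y (r + h) Wa Lf) as K0.
pose proof (circ_cont a f M x y r Wa Lf) as K1.
pose proof (circ_cont _ f1 M x y r Wc L1) as K2.
pose proof (circ_cont _ f2 M x y r Ws L2) as K3.
pose proof (fun z => continuous_lin _ _ 1 z (K2 z) (K3 z)) as K23.
pose proof (fun z => continuous_lin _ _ h z (K1 z) (K23 z)) as K123.
pose proof (fun z => continuous_lin _ _ (-1) z (K0 z) (K123 z)) as K4. cbv beta in K23, K123, K4.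
assert (E : circ a f x y (r + h) - circ a f x y r - h * (circ (fun p => a p * cos p) f1 x y r + circ (fun p => a p * sin p) f2 x y r)
  = RInt (fun p => a p * f (x + (r + h) * cos p) (y + (r + h) * sin p) + (-1) *
     (a p * f (x + r * cos p) (y + r * sin p) + h *
     (a p * cos p * f1 (x + r * cos p) (y + r * sin p) + 1 * (a p * sin p * f2 (x + r * cos p) (y + r * sin p))))) 0 (2 * PI)).
{ rewrite RInt_lin by assumption. rewrite RInt_lin by assumption. rewrite RInt_lin by assumption.
  unfold circ. ring. }
rewrite E.
replace (2 * PI * (2 * M) * h ^ 2) with ((2 * PI - 0) * (2 * M * h ^ 2)) by ring.
apply abs_RInt_le_const; [apply two_PI_pos|apply ex_RInt_cont; exact K4|].
intros p _.
pose proof (C11_taylor H (x + r * cos p) (y + r * sin p) (h * cos p) (h * sin p)) as A.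
replace (x + r * cos p + h * cos p) with (x + (r + h) * cos p) in A by ring.
replace (y + r * sin p + h * sin p) with (y + (r + h) * sin p) in A by ring.
replace ((h * cos p) ^ 2 + (h * sin p) ^ 2) with (h ^ 2) in A.
2:{ pose proof (sin2_cos2 p) as S. unfold Rsqr in S. replace (h ^ 2) with (h ^ 2 * (sin p * sin p + cos p * cos p)) by (rewrite S; ring). ring. }
match goal with |- Rabs ?X <= _ => replace X with (a p * (f (x + (r + h) * cos p) (y + (r + h) * sin p) - f (x + r * cos p) (y + r * sin p) -
    (f1 (x + r * cos p) (y + r * sin p) * (h * cos p) + f2 (x + r * cos p) (y + r * sin p) * (h * sin p)))) by ring end.
rewrite Rabs_mult. pose proof (proj2 Wa p). pose proof (Rabs_pos (a p)).
match goal with |- _ * ?X <= _ => pose proof (Rabs_pos (f (x + (r + h) * cos p) (y + (r + h) * sin p) - f (x + r * cos p) (y + r * sin p) -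
    (f1 (x + r * cos p) (y + r * sin p) * (h * cos p) + f2 (x + r * cos p) (y + r * sin p) * (h * sin p)))) end.
nra.
Qed.

(** * The radial Green function of 4 - Delta *)

Lemma inv_le1 x : 1 <= x -> 0 < / x <= 1.
Proof.
intros H. split; [apply Rinv_0_lt_compat; lra|]. rewrite <- Rinv_1. apply Rinv_le_contravar; lra.
Qed.

(** [bessel t] is the modified Bessel function I_0 at [2 sqrt t]; in this variable it
    is entire and the radial equation becomes [(t J')' = J]. *)
Definition bessel_coef (n : nat) : R := / (INR (fact n)) ^ 2.
Definition bessel (t : R) : R := PSeries bessel_coef t.
Definition bessel_d1 (t : R) : R := PSeries (PS_derive bessel_coef) t.

Lemma bessel_coef_pos n : 0 < bessel_coef n.
Proof. apply Rinv_0_lt_compat, pow_lt, INR_fact_lt_0. Qed.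

Lemma bessel_coef_S n : INR (S n) ^ 2 * bessel_coef (S n) = bessel_coef n.
Proof.
unfold bessel_coef. rewrite fact_simpl, mult_INR.
pose proof (INR_fact_lt_0 n). pose proof (lt_0_INR (S n) (Nat.lt_0_succ n)).
field. lra.
Qed.

Lemma bessel_radius : CV_radius bessel_coef = p_infty.
Proof.
apply CV_radius_infinite_DAlembert.
- intros n. apply Rgt_not_eq, bessel_coef_pos.
- apply is_lim_seq_le_le with (u := fun _ => 0) (w := fun n => 1 / (1 + INR n)).
  + intros n. assert (E : bessel_coef (S n) / bessel_coef n = / INR (S n) ^ 2).
    { rewrite <- (bessel_coef_S n). pose proof (bessel_coef_pos (S n)).
      pose proof (lt_0_INR (S n) (Nat.lt_0_succ n)). field. lra. }
    rewrite E, S_INR. pose proof (pos_INR n).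
    assert (0 < (INR n + 1) ^ 2) by nra.
    rewrite Rabs_right.
    2:{ apply Rle_ge. left. apply Rinv_0_lt_compat. assumption. }
    split; [left; apply Rinv_0_lt_compat; assumption|].
    unfold Rdiv. rewrite Rmult_1_l. apply Rinv_le_contravar; nra.
  + apply is_lim_seq_const.
  + apply lim_over_INR.
Qed.

Lemma bessel_inside t : Rbar_lt (Rabs t) (CV_radius bessel_coef).
Proof. rewrite bessel_radius. exact I. Qed.

Lemma bessel_d1_inside t : Rbar_lt (Rabs t) (CV_radius (PS_derive bessel_coef)).
Proof. rewrite CV_radius_derive. apply bessel_inside. Qed.

Lemma bessel_der t : is_derive bessel t (bessel_d1 t).
Proof. apply is_derive_PSeries, bessel_inside. Qed.

(** The recursion [(n + 1)^2 a_(n+1) = a_n] of the coefficients is this equation. *)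
Lemma bessel_mul_d1_der t : is_derive (fun s => s * bessel_d1 s) t (bessel t).
Proof.
apply is_derive_ext with (PSeries (PS_incr_1 (PS_derive bessel_coef))).
- intros s. apply PSeries_incr_1.
- replace (bessel t) with (PSeries (PS_derive (PS_incr_1 (PS_derive bessel_coef))) t).
  + apply is_derive_PSeries.
    replace (CV_radius (PS_incr_1 (PS_derive bessel_coef))) with p_infty; [exact I|].
    rewrite <- bessel_radius, <- CV_radius_derive. symmetry. apply CV_radius_incr_1.
  + apply PSeries_ext. intros n. unfold PS_derive, PS_incr_1.
    rewrite <- (bessel_coef_S n). ring.
Qed.

Lemma PSeries_nonneg a t : 0 <= t -> (forall n, 0 <= a n) -> ex_pseries a t -> 0 <= PSeries a t.
Proof.
intros Ht Ha He.
apply Rle_trans with (Series (fun n => 0 * 0)).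
- rewrite Series_scal_l. lra.
- apply Series_le.
  + intros n. split; [lra|]. rewrite Rmult_0_l. apply Rmult_le_pos; [apply Ha|apply pow_le; exact Ht].
  + apply ex_pseries_R. exact He.
Qed.

Lemma bessel_d1_nonneg t : 0 <= t -> 0 <= bessel_d1 t.
Proof.
intros Ht. apply PSeries_nonneg; [exact Ht| |apply CV_radius_inside, bessel_d1_inside].
intros n. apply Rmult_le_pos; [apply pos_INR|left; apply bessel_coef_pos].
Qed.

Lemma bessel_d1_le t : 0 <= t -> bessel_d1 t <= bessel t.
Proof.
intros Ht. apply Series_le.
- intros n. assert (0 <= t ^ n) by (apply pow_le; exact Ht).
  unfold PS_derive. pose proof (bessel_coef_pos (S n)). pose proof (pos_INR n).
  split.
  + apply Rmult_le_pos; [|assumption]. apply Rmult_le_pos; [apply pos_INR|lra].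
  + apply Rmult_le_compat_r; [assumption|]. rewrite <- (bessel_coef_S n).
    apply Rmult_le_compat_r; [lra|]. rewrite S_INR. nra.
- apply ex_pseries_R. apply CV_radius_inside, bessel_inside.
Qed.

Lemma bessel_lower t : 0 <= t -> 1 <= bessel t /\ t ^ 2 / 4 <= bessel t.
Proof.
intros Ht.
assert (E0 : forall n, CV_radius (fun m => bessel_coef (n + m)%nat) = p_infty).
{ induction n as [|n IH]; [exact bessel_radius|].
  transitivity (CV_radius (PS_decr_1 (fun m => bessel_coef (n + m)%nat))).
  - apply CV_radius_ext. intros m. unfold PS_decr_1. f_equal. lia.
  - rewrite CV_radius_decr_1. exact IH. }
assert (Ex : forall n, ex_pseries (fun m => bessel_coef (n + m)%nat) t).
{ intros n. apply CV_radius_inside. rewrite E0. exact I. }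
assert (S1 : forall n, PSeries (fun m => bessel_coef (n + m)%nat) t =
   bessel_coef n + t * PSeries (fun m => bessel_coef (S n + m)%nat) t).
{ intros n. rewrite PSeries_decr_1 by apply Ex. rewrite Nat.add_0_r. f_equal. f_equal.
  apply PSeries_ext. intros m. unfold PS_decr_1. f_equal. lia. }
assert (P : forall n, 0 <= PSeries (fun m => bessel_coef (n + m)%nat) t).
{ intros n. apply PSeries_nonneg; [exact Ht| |apply Ex]. intros m. left. apply bessel_coef_pos. }
assert (E : bessel t = 1 + t * (1 + t * (1 / 4 + t * PSeries (fun m => bessel_coef (3 + m)%nat) t))).
{ transitivity (PSeries (fun m => bessel_coef (0 + m)%nat) t); [reflexivity|].
  rewrite (S1 0%nat), (S1 1%nat), (S1 2%nat). unfold bessel_coef at 1 2 3. simpl.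
  f_equal; [field|]. f_equal. f_equal; [field|]. f_equal. f_equal. field. }
rewrite E. pose proof (P 3%nat) as P3.
assert (0 <= t * PSeries (fun m => bessel_coef (3 + m)%nat) t) by (apply Rmult_le_pos; assumption).
set (X := t * PSeries (fun m => bessel_coef (3 + m)%nat) t) in *.
assert (0 <= t * X) by nra. assert (0 <= t * (t * X)) by nra. split; nra.
Qed.

Lemma bessel_mono s t : 0 <= s <= t -> bessel s <= bessel t.
Proof.
intros H. destruct (MVT_gen bessel s t bessel_d1) as [c [Hc E]].
- intros; apply bessel_der.
- intros u _. apply continuity_pt_filterlim.
  apply (ex_derive_continuous bessel u). exists (bessel_d1 u). apply bessel_der.
- rewrite Rmin_left, Rmax_right in Hc by lra.
  pose proof (bessel_d1_nonneg c ltac:(lra)). nra.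
Qed.

Lemma bessel_0 : bessel 0 = 1.
Proof. unfold bessel. rewrite PSeries_0. unfold bessel_coef. simpl. field. Qed.

Lemma bessel_near0 t : 0 <= t <= 1 -> bessel t - 1 <= bessel 1 * t.
Proof.
intros H. destruct (MVT_gen bessel 0 t bessel_d1) as [c [Hc E]].
- intros; apply bessel_der.
- intros u _. apply continuity_pt_filterlim.
  apply (ex_derive_continuous bessel u). exists (bessel_d1 u). apply bessel_der.
- rewrite Rmin_left, Rmax_right in Hc by lra. rewrite bessel_0 in E. rewrite E, Rminus_0_r.
  apply Rmult_le_compat_r; [lra|]. apply Rle_trans with (bessel c); [apply bessel_d1_le; lra|].
  apply bessel_mono. lra.
Qed.

Definition radial (r : R) : R := bessel (r ^ 2).
Definition radial_d1 (r : R) : R := 2 * r * bessel_d1 (r ^ 2).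

Lemma radial_der r : is_derive radial r (radial_d1 r).
Proof.
unfold radial, radial_d1. pose proof (bessel_der (r ^ 2)) as H.
assert (H2 : is_derive (fun s => s ^ 2) r (2 * r)) by (auto_derive; [exact I|ring]).
exact (is_derive_comp bessel (fun s => s ^ 2) r _ _ H H2).
Qed.

(** The radial equation [(r I')' = 4 r I], that is [Delta I = 4 I] in the plane. *)
Lemma radial_mul_d1_der r : is_derive (fun s => s * radial_d1 s) r (4 * r * radial r).
Proof.
unfold radial_d1, radial.
apply is_derive_ext with (fun s => 2 * ((s ^ 2) * bessel_d1 (s ^ 2))).
{ intros t. simpl. ring. }
replace (4 * r * bessel (r ^ 2)) with (2 * (2 * r * bessel (r ^ 2))) by ring.
apply (is_derive_scal (fun s => (s ^ 2) * bessel_d1 (s ^ 2))).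
assert (H2 : is_derive (fun s => s ^ 2) r (2 * r)) by (auto_derive; [exact I|ring]).
exact (is_derive_comp (fun t => t * bessel_d1 t) (fun s => s ^ 2) r _ _ (bessel_mul_d1_der (r ^ 2)) H2).
Qed.

Lemma radial_cont r : continuous radial r.
Proof. apply (ex_derive_continuous radial). exists (radial_d1 r). apply radial_der. Qed.

Lemma radial_ge1 r : 1 <= radial r.
Proof. apply bessel_lower, pow2_ge_0. Qed.

Lemma radial_ge4 r : r ^ 4 / 4 <= radial r.
Proof. replace (r ^ 4) with ((r ^ 2) ^ 2) by ring. apply bessel_lower, pow2_ge_0. Qed.

Lemma radial_mono a b : 0 <= a <= b -> radial a <= radial b.
Proof. intros H. apply bessel_mono. split; [apply pow2_ge_0|]. apply pow_incr. lra. Qed.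

Lemma radial_d1_bound r : 0 <= r -> 0 <= radial_d1 r <= 2 * r * radial r.
Proof.
intros Hr. pose proof (bessel_d1_nonneg _ (pow2_ge_0 r)). pose proof (bessel_d1_le _ (pow2_ge_0 r)).
unfold radial_d1, radial. nra.
Qed.

(** Reduction of order: the Wronskian of two radial solutions is a multiple of [1 / r],
    so the quotient of a second solution by I is a primitive of a multiple of
    [1 / (r I^2)]. *)
Definition tail_density (s : R) : R := / (s * radial s ^ 2).
Lemma tail_density_cont s : 0 < s -> continuous tail_density s.
Proof.
intros Hs. apply continuity_pt_filterlim. unfold tail_density. apply continuity_pt_inv.
- apply continuity_pt_mult; [apply continuity_pt_id|].
  apply (continuity_pt_comp radial (fun x => x ^ 2)).
  + apply continuity_pt_filterlim, radial_cont.
  + apply derivable_continuous_pt, derivable_pt_pow.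
- pose proof (radial_ge1 s). apply Rgt_not_eq. apply Rmult_lt_0_compat; [exact Hs|]. nra.
Qed.

Lemma tail_density_ex a b : 0 < a -> 0 < b -> ex_RInt tail_density a b.
Proof.
intros Ha Hb. apply (ex_RInt_continuous (V := R_CompleteNormedModule)). intros z Hz. apply tail_density_cont.
unfold Rmin in Hz. destruct (Rle_dec a b); lra.
Qed.

Lemma tail_density_pos s : 0 < s -> 0 < tail_density s.
Proof. intros Hs. apply Rinv_0_lt_compat, Rmult_lt_0_compat; [exact Hs|]. pose proof (radial_ge1 s). nra. Qed.

Lemma tail_density_RInt_nonneg a b : 0 < a <= b -> 0 <= RInt tail_density a b.
Proof.
intros H. apply RInt_ge_0; [lra|apply tail_density_ex; lra|]. intros x Hx. left. apply tail_density_pos. lra.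
Qed.

(** One factor I(s) is bounded below by I(a), the other one by [s^4 / 4]. *)
Lemma tail_density_RInt_bound a b : 0 < a <= b -> RInt tail_density a b <= / radial a * (/ a ^ 4 - / b ^ 4).
Proof.
intros H.
assert (HI : is_RInt (fun s => / radial a * (4 / s ^ 5)) a b (/ radial a * (- / b ^ 4) - / radial a * (- / a ^ 4))).
{ apply (is_RInt_derive (V := R_CompleteNormedModule) (fun s => / radial a * (- / s ^ 4)) (fun s => / radial a * (4 / s ^ 5))).
  - intros s Hs. rewrite Rmin_left, Rmax_right in Hs by lra.
    auto_derive; [apply (pow_nonzero s 4); lra|]. field.
    pose proof (radial_ge1 a). lra.
  - intros s Hs. rewrite Rmin_left, Rmax_right in Hs by lra.
    apply (ex_derive_continuous (fun s => / radial a * (4 / s ^ 5))). auto_derive.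
    apply (pow_nonzero s 5); lra. }
replace (/ radial a * (/ a ^ 4 - / b ^ 4)) with (/ radial a * (- / b ^ 4) - / radial a * (- / a ^ 4)) by ring.
rewrite <- (is_RInt_unique _ _ _ _ HI).
apply RInt_le; [lra|apply tail_density_ex; lra|exists (/ radial a * (- / b ^ 4) - / radial a * (- / a ^ 4)); exact HI|].
intros s Hs. unfold tail_density.
pose proof (radial_ge1 a). pose proof (radial_mono a s ltac:(lra)). pose proof (radial_ge4 s).
assert (0 < s ^ 4) by (apply pow_lt; lra).
assert (0 < s ^ 5) by (apply pow_lt; lra).
replace (/ radial a * (4 / s ^ 5)) with (/ (s * (radial a * (s ^ 4 / 4)))) by (field; lra).
apply Rinv_le_contravar.
- apply Rmult_lt_0_compat; [lra|]. apply Rmult_lt_0_compat; lra.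
- apply Rmult_le_compat_l; [lra|]. simpl (radial s ^ 2). rewrite Rmult_1_r.
  apply Rmult_le_compat; lra.
Qed.

Definition tail_total : R := real (Lim_seq (fun n => RInt tail_density 1 (INR n + 1))).

(** The integral of the density over [[r, oo)], written with the base point 1 so that
    it is visibly a primitive. *)
Definition tail (r : R) : R := tail_total - RInt tail_density 1 r.

Lemma tail_density_Chasles a b c : 0 < a -> 0 < b -> 0 < c -> RInt tail_density a c = RInt tail_density a b + RInt tail_density b c.
Proof. intros Ha Hb Hc. symmetry. apply (RInt_Chasles tail_density a b c); apply tail_density_ex; assumption. Qed.

Lemma tail_lim r : 0 < r -> is_lim_seq (fun n => RInt tail_density r (INR n + 1)) (tail r).
Proof.
intros Hr.
assert (H1 : is_lim_seq (fun n => RInt tail_density 1 (INR n + 1)) tail_total).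
{ unfold tail_total. apply Lim_seq_correct'. apply ex_finite_lim_seq_incr with 1.
  - intros n. pose proof (pos_INR n) as Hn. pose proof (S_INR n) as Sn.
    assert (Hq : 0 <= RInt tail_density (INR n + 1) (INR (S n) + 1)) by (apply tail_density_RInt_nonneg; lra).
    rewrite (tail_density_Chasles 1 (INR n + 1) (INR (S n) + 1)) by lra.
    apply Rle_trans with (RInt tail_density 1 (INR n + 1) + 0); [right; symmetry; apply Rplus_0_r|].
    apply Rplus_le_compat_l. exact Hq.
  - intros n. pose proof (pos_INR n).
    apply Rle_trans with (1 := tail_density_RInt_bound 1 (INR n + 1) ltac:(lra)).
    assert (0 < / (INR n + 1) ^ 4) by (apply Rinv_0_lt_compat, pow_lt; lra).
    pose proof (radial_ge1 1). assert (0 < / radial 1 <= 1).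
    { apply inv_le1; lra. }
    replace (/ 1 ^ 4) with 1 by field. nra. }
unfold tail.
apply is_lim_seq_ext with (fun n => RInt tail_density 1 (INR n + 1) - RInt tail_density 1 r).
- intros n. pose proof (pos_INR n). rewrite (tail_density_Chasles 1 r (INR n + 1)) by lra. apply Rplus_minus_l.
- apply is_lim_seq_minus'; [exact H1|apply is_lim_seq_const].
Qed.

Lemma tail_bound r : 0 < r -> 0 <= tail r <= / radial r * / r ^ 4.
Proof.
intros Hr. destruct (INR_unbounded r) as [N HN].
assert (Hn : forall n, (N <= n)%nat -> r <= INR n + 1).
{ intros n H. apply le_INR in H. lra. }
pose proof (radial_ge1 r). assert (0 < / radial r) by (apply Rinv_0_lt_compat; lra).
split.
- apply (is_lim_seq_le_loc (fun _ => 0) _ (Finite 0) (Finite (tail r))) with (2 := is_lim_seq_const 0) (3 := tail_lim r Hr).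
  exists N. intros n H2. apply tail_density_RInt_nonneg. specialize (Hn n H2). lra.
- apply (is_lim_seq_le_loc _ (fun _ => / radial r * / r ^ 4) (Finite (tail r)) (Finite _)) with (2 := tail_lim r Hr) (3 := is_lim_seq_const _).
  exists N. intros n H2. specialize (Hn n H2).
  apply Rle_trans with (1 := tail_density_RInt_bound r (INR n + 1) ltac:(lra)).
  assert (0 < / (INR n + 1) ^ 4) by (apply Rinv_0_lt_compat, pow_lt; lra). nra.
Qed.

Lemma tail_der r : 0 < r -> is_derive tail r (- tail_density r).
Proof.
intros Hr. unfold tail.
replace (- tail_density r) with (0 - tail_density r) by ring.
apply (is_derive_minus (fun _ => tail_total) (RInt tail_density 1)); [apply (is_derive_const (V := R_NormedModule) tail_total)|].
apply (is_derive_RInt tail_density (RInt tail_density 1) 1 r).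
- exists (mkposreal r Hr). intros y Hy. apply (RInt_correct tail_density). apply tail_density_ex; [lra|].
  unfold ball in Hy; simpl in Hy; unfold AbsRing_ball, abs, minus, plus, opp in Hy; simpl in Hy.
  change (Rabs (y - r) < r) in Hy. apply Rabs_def2 in Hy. lra.
- apply tail_density_cont, Hr.
Qed.

(** The density is at most [1 / s] and [- ln r <= 2 / sqrt r]: the singularity of the
    Green function is weaker than [r^(-1/2)]. *)
Lemma tail_near0 r : 0 < r <= 1 -> tail r <= tail_total + 2 * / sqrt r.
Proof.
intros Hr. unfold tail.
assert (E : - RInt tail_density 1 r = RInt tail_density r 1).
{ rewrite <- (opp_RInt_swap tail_density) by (apply tail_density_ex; lra). simpl. apply Ropp_involutive. }
assert (HI : is_RInt (fun s => / s) r 1 (ln 1 - ln r)).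
{ apply (is_RInt_derive (V := R_CompleteNormedModule) ln Rinv).
  - intros s Hs. rewrite Rmin_left, Rmax_right in Hs by lra. apply is_derive_ln. lra.
  - intros s Hs. rewrite Rmin_left, Rmax_right in Hs by lra.
    apply continuity_pt_filterlim. apply (continuity_pt_inv (fun x => x)); [apply continuity_pt_id|lra]. }
assert (L : RInt tail_density r 1 <= ln 1 - ln r).
{ rewrite <- (is_RInt_unique _ _ _ _ HI). apply RInt_le; [lra|apply tail_density_ex; lra|eexists; exact HI|].
  intros s Hs. unfold tail_density. apply Rinv_le_contravar; [lra|]. pose proof (radial_ge1 s).
  assert (1 <= radial s ^ 2) by nra. nra. }
rewrite ln_1 in L.
assert (L2 : - ln r <= 2 * / sqrt r).
{ assert (Hs : 0 < sqrt r) by (apply sqrt_lt_R0; lra).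
  replace (ln r) with (ln (sqrt r * sqrt r)) by (rewrite sqrt_sqrt; [reflexivity|lra]).
  rewrite ln_mult by lra. pose proof (exp_ineq1_le (- ln (sqrt r))) as X.
  rewrite exp_Ropp, exp_ln in X by lra. lra. }
unfold Rminus. rewrite E. lra.
Qed.

Lemma tail_total_nonneg : 0 <= tail_total.
Proof.
pose proof (tail_bound 1 ltac:(lra)) as [H _]. unfold tail in H.
rewrite RInt_point in H. change (0 <= tail_total - 0) in H. lra.
Qed.

(** With [N = radial * tail] these are [r N] and [- r N']. *)
Definition ker0_pos (r : R) : R := r * radial r * tail r.
Definition ker1_pos (r : R) : R := / radial r - r * radial_d1 r * tail r.

(** Constant continuation to the negative axis makes the kernels continuous on the
    line; [ker1] is even differentiable at 0. *)
Definition ker0 (r : R) : R := if Rle_dec r 0 then 0 else ker0_pos r.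
Definition ker1 (r : R) : R := if Rle_dec r 0 then 1 else ker1_pos r.

Lemma ker1_pos_der r : 0 < r -> is_derive ker1_pos r (-4 * ker0_pos r).
Proof.
intros Hr. unfold ker1_pos. pose proof (radial_ge1 r) as HI.
pose proof (is_derive_inv radial r _ (radial_der r) ltac:(lra)) as D1.
pose proof (is_derive_mult _ _ r _ _ (radial_mul_d1_der r) (tail_der r Hr) Rmult_comm) as D2.
pose proof (is_derive_minus _ _ r _ _ D1 D2) as D3.
apply (is_derive_eq D3).
unfold ker0_pos, tail_density. unfold_alg. field. lra.
Qed.

Lemma ker0_pos_der r : 0 < r -> is_derive ker0_pos r (ker0_pos r / r - ker1_pos r).
Proof.
intros Hr. unfold ker0_pos at 1. pose proof (radial_ge1 r) as HI.
pose proof (is_derive_mult (fun s : R => s) radial r 1 _ (is_derive_id r) (radial_der r) Rmult_comm) as D1.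
pose proof (is_derive_mult _ _ r _ _ D1 (tail_der r Hr) Rmult_comm) as D2.
apply (is_derive_eq D2).
unfold ker0_pos, ker1_pos, tail_density. unfold_alg. field. lra.
Qed.

Lemma glue_pos (c : R) (g : R -> R) r l : 0 < r -> is_derive g r l ->
  is_derive (fun s => if Rle_dec s 0 then c else g s) r l.
Proof.
intros Hr H. apply is_derive_ext_loc with (2 := H).
exists (mkposreal r Hr). intros y Hy.
unfold ball in Hy; simpl in Hy; unfold AbsRing_ball, abs, minus, plus, opp in Hy; simpl in Hy.
change (Rabs (y - r) < r) in Hy. apply Rabs_def2 in Hy.
destruct (Rle_dec y 0); [lra|reflexivity].
Qed.

Lemma glue_neg (c : R) (g : R -> R) r : r < 0 -> continuous (fun s => if Rle_dec s 0 then c else g s) r.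
Proof.
intros Hr. apply (continuous_ext_loc (T := R_UniformSpace) (U := R_UniformSpace) _ (fun _ => c) r); [|apply continuous_const].
assert (Hr' : 0 < - r) by lra.
exists (mkposreal _ Hr'). intros y Hy.
unfold ball in Hy; simpl in Hy; unfold AbsRing_ball, abs, minus, plus, opp in Hy; simpl in Hy.
change (Rabs (y - r) < - r) in Hy. apply Rabs_def2 in Hy.
destruct (Rle_dec y 0); [reflexivity|lra].
Qed.

Lemma glue_0_cont (c : R) (g : R -> R) :
  (forall eps, 0 < eps -> exists d, 0 < d /\ forall r, 0 < r < d -> Rabs (g r - c) < eps) ->
  continuous (fun s => if Rle_dec s 0 then c else g s) 0.
Proof.
intros H. apply continuity_pt_filterlim. intros eps He. destruct (H eps He) as [d [Hd Hg]].
exists d. split; [exact Hd|]. intros x [_ Hx]. unfold dist in *; simpl in *; unfold Rdist in *.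
rewrite Rminus_0_r in Hx. apply Rabs_def2 in Hx.
destruct (Rle_dec 0 0) as [_|]; [|lra].
destruct (Rle_dec x 0); [rewrite Rminus_diag, Rabs_R0; exact He|apply Hg; lra].
Qed.

Lemma glue_0_der (c : R) (g : R -> R) :
  (forall eps, 0 < eps -> exists d, 0 < d /\ forall r, 0 < r < d -> Rabs (g r - c) <= eps * r) ->
  is_derive (fun s => if Rle_dec s 0 then c else g s) 0 0.
Proof.
intros H. apply is_derive_Reals. intros eps He.
destruct (H (eps / 2) ltac:(lra)) as [d [Hd Hg]].
exists (mkposreal d Hd). intros h Hh Hlt. simpl in Hlt. rewrite Rplus_0_l.
destruct (Rle_dec 0 0) as [_|]; [|lra]. apply Rabs_def2 in Hlt.
destruct (Rle_dec h 0) as [Hn|Hp].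
- replace ((c - c) / h - 0) with 0 by (field; exact Hh). rewrite Rabs_R0. exact He.
- assert (0 < h) by lra. specialize (Hg h ltac:(lra)).
  replace ((g h - c) / h - 0) with ((g h - c) / h) by (field; exact Hh).
  unfold Rdiv. rewrite Rabs_mult, Rabs_inv, (Rabs_right h) by lra.
  apply Rmult_lt_reg_r with h; [lra|]. rewrite Rmult_assoc, Rinv_l, Rmult_1_r by lra. nra.
Qed.

Lemma ker0_pos_near0 r : 0 < r <= 1 -> 0 <= ker0_pos r <= radial 1 * (tail_total + 2) * sqrt r.
Proof.
intros Hr. pose proof (tail_near0 r Hr) as H. pose proof (tail_bound r ltac:(lra)) as [H0 _].
pose proof (radial_ge1 r). pose proof (radial_mono r 1 ltac:(lra)). pose proof tail_total_nonneg as HQ.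
assert (Hs : 0 < sqrt r) by (apply sqrt_lt_R0; lra).
assert (Es : sqrt r * sqrt r = r) by (apply sqrt_sqrt; lra).
assert (Hs1 : sqrt r <= 1) by (rewrite <- sqrt_1; apply sqrt_le_1; lra).
unfold ker0_pos. split; [apply Rmult_le_pos; [nra|exact H0]|].
assert (A : r * tail r <= (tail_total + 2) * sqrt r).
{ apply Rle_trans with (r * (tail_total + 2 * / sqrt r)); [apply Rmult_le_compat_l; lra|].
  rewrite <- Es at 1. replace (sqrt r * sqrt r * (tail_total + 2 * / sqrt r)) with (sqrt r * (sqrt r * tail_total + 2)) by (field; lra).
  rewrite Rmult_comm. apply Rmult_le_compat_r; [lra|].
  assert (sqrt r * tail_total <= 1 * tail_total) by (apply Rmult_le_compat_r; lra). lra. }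
assert (0 <= r * tail r) by (apply Rmult_le_pos; lra).
replace (r * radial r * tail r) with (radial r * (r * tail r)) by ring.
rewrite Rmult_assoc. apply Rmult_le_compat; lra.
Qed.

Lemma ker1_pos_bound r : 0 < r -> 0 <= r * radial_d1 r * tail r <= 2 * r * ker0_pos r.
Proof.
intros Hr. pose proof (radial_d1_bound r ltac:(lra)) as [A1 A2]. pose proof (tail_bound r Hr) as [B1 _].
unfold ker0_pos. split.
- apply Rmult_le_pos; [apply Rmult_le_pos; lra|exact B1].
- replace (2 * r * (r * radial r * tail r)) with (r * (2 * r * radial r) * tail r) by ring.
  apply Rmult_le_compat_r; [exact B1|]. apply Rmult_le_compat_l; lra.
Qed.

Lemma ker0_pos_small eps : 0 < eps -> exists d, 0 < d <= 1 /\ forall r, 0 < r < d -> 0 <= ker0_pos r <= eps.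
Proof.
intros He. set (C := radial 1 * (tail_total + 2)).
assert (HC : 0 < C) by (pose proof (radial_ge1 1); pose proof tail_total_nonneg; unfold C; nra).
set (d0 := eps / C). assert (Hd0 : 0 < d0) by (apply Rdiv_lt_0_compat; assumption).
exists (Rmin 1 (d0 * d0)).
assert (0 < d0 * d0) by (apply Rmult_lt_0_compat; assumption).
split; [split; [apply Rmin_glb_lt; lra|apply Rmin_l]|].
intros r [Hr1 Hr2]. pose proof (Rmin_l 1 (d0 * d0)). pose proof (Rmin_r 1 (d0 * d0)).
pose proof (ker0_pos_near0 r ltac:(lra)) as [K1 K2]. split; [exact K1|].
apply Rle_trans with (1 := K2). fold C.
assert (sqrt r <= d0).
{ rewrite <- (sqrt_square d0) by lra. apply sqrt_le_1; lra. }
replace eps with (C * d0) by (unfold d0; field; lra). apply Rmult_le_compat_l; lra.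
Qed.

Lemma ker0_0 : ker0 0 = 0.
Proof. unfold ker0. destruct (Rle_dec 0 0); lra. Qed.

Lemma ker1_0 : ker1 0 = 1.
Proof. unfold ker1. destruct (Rle_dec 0 0); lra. Qed.

Lemma ker0_eq r : 0 < r -> ker0 r = ker0_pos r.
Proof. intros H. unfold ker0. destruct (Rle_dec r 0); [lra|reflexivity]. Qed.

Lemma ker1_eq r : 0 < r -> ker1 r = ker1_pos r.
Proof. intros H. unfold ker1. destruct (Rle_dec r 0); [lra|reflexivity]. Qed.

(** Equivalent to [N' = - ker1 / r] for [N = ker0 / r]. *)
Lemma ker0_der r : 0 < r -> is_derive ker0 r (ker0 r / r - ker1 r).
Proof. intros Hr. rewrite ker0_eq, ker1_eq by exact Hr. apply (glue_pos 0 ker0_pos); [exact Hr|apply ker0_pos_der, Hr]. Qed.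

(** The radial equation [(r N')' = 4 r N].  At 0 it holds because [1 - 1 / I] is
    quadratic and [r I' tail <= 2 r ker0] with [ker0 -> 0]. *)
Lemma ker1_der r : 0 <= r -> is_derive ker1 r (-4 * ker0 r).
Proof.
intros [Hr|<-].
- rewrite ker0_eq by exact Hr. apply (glue_pos 1 ker1_pos); [exact Hr|apply ker1_pos_der, Hr].
- rewrite ker0_0. replace (-4 * 0) with 0 by ring. apply (glue_0_der 1 ker1_pos). intros eps He.
  destruct (ker0_pos_small (eps / 4) ltac:(lra)) as [d [Hd Hk]].
  set (C := radial 1). assert (HC : 1 <= C) by apply radial_ge1.
  exists (Rmin d (eps / (2 * C))).
  assert (0 < eps / (2 * C)) by (apply Rdiv_lt_0_compat; lra).
  split; [apply Rmin_glb_lt; lra|]. intros r [Hr1 Hr2].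
  pose proof (Rmin_l d (eps / (2 * C))). pose proof (Rmin_r d (eps / (2 * C))).
  specialize (Hk r ltac:(lra)). pose proof (ker1_pos_bound r Hr1) as Hb.
  assert (Hr' : r * (2 * C) <= eps).
  { apply Rle_trans with (eps / (2 * C) * (2 * C)); [apply Rmult_le_compat_r; lra|]. right; field; lra. }
  pose proof (radial_ge1 r) as HI.
  assert (HJ : radial r - 1 <= C * r ^ 2).
  { replace C with (bessel 1) by (unfold C, radial; f_equal; ring). apply bessel_near0. split; [apply pow2_ge_0|]. nra. }
  assert (0 <= 1 - / radial r <= radial r - 1).
  { split.
    - assert (/ radial r <= 1) by (apply inv_le1; lra). lra.
    - replace (1 - / radial r) with ((radial r - 1) * / radial r) by (field; lra).
      assert (/ radial r <= 1) by (apply inv_le1; lra).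
      assert (0 < / radial r) by (apply Rinv_0_lt_compat; lra). nra. }
  unfold ker1_pos. apply Rabs_le.
  assert (r * ker0_pos r <= r * (eps / 4)) by (apply Rmult_le_compat_l; lra).
  simpl in HJ. nra.
Qed.

Lemma ker0_cont r : continuous ker0 r.
Proof.
destruct (Rtotal_order r 0) as [H|[->|H]].
- apply glue_neg, H.
- apply (glue_0_cont 0 ker0_pos). intros eps He. destruct (ker0_pos_small (eps / 2) ltac:(lra)) as [d [Hd Hk]].
  exists d. split; [lra|]. intros r Hr. specialize (Hk r Hr). rewrite Rminus_0_r, Rabs_right; lra.
- apply (ex_derive_continuous ker0). eexists. apply ker0_der, H.
Qed.

Lemma ker1_cont r : continuous ker1 r.
Proof.
destruct (Rlt_le_dec r 0) as [H|H].
- apply glue_neg, H.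
- apply (ex_derive_continuous ker1). eexists. apply ker1_der, H.
Qed.

Lemma ker0_far r : 1 <= r -> 0 <= ker0 r <= / r ^ 3.
Proof.
intros Hr. rewrite ker0_eq by lra. unfold ker0_pos. pose proof (tail_bound r ltac:(lra)) as [B1 B2].
pose proof (radial_ge1 r). split; [apply Rmult_le_pos; [nra|exact B1]|].
replace (/ r ^ 3) with (r * radial r * (/ radial r * / r ^ 4)) by (field; lra).
apply Rmult_le_compat_l; [nra|exact B2].
Qed.

(** Near infinity [I * tail <= r^(-4)], which gains more than enough powers. *)
Lemma kernels_decay : exists B, decay B ker0 /\ decay B ker1.
Proof.
set (C := radial 1 * (tail_total + 2)).
assert (HC : 0 < C) by (pose proof (radial_ge1 1); pose proof tail_total_nonneg; unfold C; nra).
(* on [0, 1] the weights are at most 1 + 2 C and beyond 1 at most 6 / r^2; the factor 4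
   bounds (1 + r)^2 on [0, 1] and ((1 + r) / r)^2 beyond 1 *)
set (B := 4 * (6 + 2 * C)). exists B.
assert (Hnear : forall r, 0 <= r <= 1 -> Rabs (ker0 r) <= C /\ Rabs (ker1 r) <= 1 + 2 * C).
{ intros r [[Hr|<-] Hr1].
  - rewrite ker0_eq, ker1_eq by exact Hr.
    pose proof (ker0_pos_near0 r ltac:(lra)) as K. fold C in K. pose proof (ker1_pos_bound r Hr) as K1.
    assert (Hs1 : sqrt r <= 1) by (rewrite <- sqrt_1; apply sqrt_le_1; lra).
    assert (ker0_pos r <= C) by nra. pose proof (radial_ge1 r).
    assert (/ radial r <= 1) by (apply inv_le1; lra).
    assert (0 < / radial r) by (apply Rinv_0_lt_compat; lra).
    split; [rewrite Rabs_right; lra|]. unfold ker1_pos. apply Rabs_le. nra.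
  - rewrite ker0_0, ker1_0, Rabs_R0, Rabs_R1. lra. }
assert (Hfar : forall r, 1 <= r -> Rabs (ker0 r) <= / r ^ 2 /\ Rabs (ker1 r) <= 6 * / r ^ 2).
{ intros r Hr. pose proof (ker0_far r Hr) as K. rewrite ker1_eq by lra.
  pose proof (ker1_pos_bound r ltac:(lra)) as K1. rewrite <- ker0_eq in K1 by lra.
  assert (H2 : 0 < / r ^ 2) by (apply Rinv_0_lt_compat, pow_lt; lra).
  assert (E3 : / r ^ 3 = / r ^ 2 * / r) by (field; lra).
  assert (Hir : 0 < / r <= 1).
  { apply inv_le1; lra. }
  split; [rewrite Rabs_right by lra; rewrite E3 in K; nra|].
  assert (HI : 0 < / radial r <= 4 * / r ^ 2).
  { pose proof (radial_ge1 r). pose proof (radial_ge4 r). split; [apply Rinv_0_lt_compat; lra|].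
    replace (4 * / r ^ 2) with (/ (r ^ 2 / 4)) by (field; lra).
    apply Rinv_le_contravar; nra. }
  assert (r * ker0 r <= / r ^ 2).
  { replace (/ r ^ 2) with (r * / r ^ 3) by (field; lra). apply Rmult_le_compat_l; lra. }
  unfold ker1_pos. apply Rabs_le. lra. }
assert (Hall : forall r, 0 <= r -> Rabs (ker0 r) <= B / (1 + r) ^ 2 /\ Rabs (ker1 r) <= B / (1 + r) ^ 2).
{ intros r Hr. destruct (Rle_dec r 1) as [H1|H1].
  - pose proof (Hnear r ltac:(lra)) as [A1 A2].
    assert (1 + 2 * C <= B / (1 + r) ^ 2).
    { apply Rle_div_r; [apply pow_lt; lra|]. assert ((1 + r) ^ 2 <= 4) by nra. unfold B.
      assert (0 < 1 + 2 * C) by lra. nra. }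
    lra.
  - apply Rnot_le_lt in H1. pose proof (Hfar r ltac:(lra)) as [A1 A2].
    assert (6 * / r ^ 2 <= B / (1 + r) ^ 2).
    { apply (proj1 (Rle_div_r (6 * / r ^ 2) B ((1 + r) ^ 2) ltac:(apply pow_lt; lra))).
      assert ((1 + r) ^ 2 <= 4 * r ^ 2) by (replace (4 * r ^ 2) with ((2 * r) ^ 2) by ring; apply pow_incr; lra).
      assert (H2 : 0 < / r ^ 2) by (apply Rinv_0_lt_compat, pow_lt; lra).
      apply Rle_trans with (6 * / r ^ 2 * (4 * r ^ 2)); [apply Rmult_le_compat_l; lra|].
      replace (6 * / r ^ 2 * (4 * r ^ 2)) with 24 by (field; lra). unfold B. lra. }
    assert (H2 : 0 < / r ^ 2) by (apply Rinv_0_lt_compat, pow_lt; lra). lra. }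
split; (split; [intros z; first [apply ker0_cont|apply ker1_cont]|intros r Hr; apply Hall, Hr]).
Qed.

(** * The inverse of 4 - Delta *)

Lemma half_int_derive M (h F : R -> R) : decay M F -> (forall r, 0 <= r -> is_derive h r (F r)) ->
  is_lim_seq (fun n => h (INR n)) 0 -> half_int F = - h 0.
Proof.
intros HF Hd Hl.
assert (H : is_lim_seq (fun n => RInt F 0 (INR n)) (0 - h 0)).
{ apply is_lim_seq_ext with (fun n => h (INR n) - h 0).
  - intros n. symmetry. apply (is_RInt_unique (V := R_CompleteNormedModule)).
    apply (is_RInt_derive (V := R_CompleteNormedModule) h F).
    + intros r Hr. rewrite Rmin_left in Hr by apply pos_INR. apply Hd. lra.
    + intros r _. apply HF.
  - apply is_lim_seq_minus'; [exact Hl|apply is_lim_seq_const]. }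
unfold half_int. rewrite (is_lim_seq_unique _ _ H). simpl. ring.
Qed.

Lemma decay_bounded_lim B k (g : R -> R) m : decay B k -> (forall r, Rabs (g r) <= m) ->
  is_lim_seq (fun n => k (INR n) * g (INR n)) 0.
Proof.
intros Hk Hg. pose proof (decay_pos _ _ Hk) as HB. destruct Hk as [_ Hk].
assert (Hm : 0 <= m) by (apply Rle_trans with (2 := Hg 0), Rabs_pos).
apply is_lim_seq_abs_0.
apply is_lim_seq_le_le with (u := fun _ => 0) (w := fun n => (B * m) / (1 + INR n)).
- intros n. split; [apply Rabs_pos|]. rewrite Rabs_mult. pose proof (pos_INR n) as Hn.
  specialize (Hk (INR n) Hn). specialize (Hg (INR n)).
  apply Rle_trans with (B / (1 + INR n) ^ 2 * m).
  + apply Rmult_le_compat; auto using Rabs_pos.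
  + replace (B / (1 + INR n) ^ 2 * m) with (B * m * / (1 + INR n) ^ 2) by (field; lra).
    apply Rmult_le_compat_l; [apply Rmult_le_pos; assumption|]. apply Rinv_le_contravar; nra.
- apply is_lim_seq_const.
- apply lim_over_INR.
Qed.

(** Integration by parts in the angle; there is no boundary term since [b f] is
    periodic. *)
Lemma circ_ibp a b M f f1 f2 x y r : C11 M f f1 f2 -> weight a -> weight b ->
  (forall p, is_derive b p (a p)) -> b (2 * PI) = b 0 ->
  circ a f x y r = r * (circ (fun p => b p * sin p) f1 x y r - circ (fun p => b p * cos p) f2 x y r).
Proof.
intros H Wa Wb Db Hb.
pose proof (C11_lip H) as Lf. pose proof H as [Bf B1 B2 L1 L2 _ _].
pose proof (weight_mult _ _ Wb weight_cos) as Wc. pose proof (weight_mult _ _ Wb weight_sin) as Ws.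
pose proof (circ_cont a f M x y r Wa Lf) as K1.
pose proof (circ_cont _ f1 M x y r Ws L1) as K2.
pose proof (circ_cont _ f2 M x y r Wc L2) as K3.
pose proof (fun z => continuous_lin _ _ (- r) z (K1 z) (K2 z)) as K12.
pose proof (fun z => continuous_lin _ _ r z (K12 z) (K3 z)) as K123. cbv beta in K12, K123.
assert (E : RInt (fun p => a p * f (x + r * cos p) (y + r * sin p) +
   (- r) * (b p * sin p * f1 (x + r * cos p) (y + r * sin p)) + r * (b p * cos p * f2 (x + r * cos p) (y + r * sin p))) 0 (2 * PI) = 0).
{ apply (is_RInt_unique (V := R_CompleteNormedModule)).
  replace 0 with (b (2 * PI) * f (x + r * cos (2 * PI)) (y + r * sin (2 * PI)) - b 0 * f (x + r * cos 0) (y + r * sin 0)) at 2.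
  2:{ rewrite Hb, cos_2PI, sin_2PI, cos_0, sin_0. ring. }
  apply (is_RInt_derive (V := R_CompleteNormedModule) (fun p => b p * f (x + r * cos p) (y + r * sin p))).
  - intros p _.
    assert (D1 : is_derive (fun p => x + r * cos p) p (- r * sin p)) by (auto_derive; [exact I|ring]).
    assert (D2 : is_derive (fun p => y + r * sin p) p (r * cos p)) by (auto_derive; [exact I|ring]).
    pose proof (C11_chain p H D1 D2) as D3.
    pose proof (is_derive_mult _ _ p _ _ (Db p) D3 Rmult_comm) as D4.
    apply (is_derive_eq D4).
    unfold_alg. ring.
  - intros p _. apply K123. }
rewrite RInt_lin in E by assumption. rewrite RInt_lin in E by assumption.
unfold circ. lra.
Qed.

(** Here F is a partial derivative of [f], and [a] is the corresponding component cos
    or sin of the unit vector.  With C the circle integral of [a f], integration by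
    parts in the angle turns the tangential part of F into [C / r], and the radial
    part is [C'].  Hence the circle integral of F is [(r C)' / r], and a single
    integration by parts in [r] moves the derivative from C to the kernel. *)
Lemma kernel_ibp a b M f f1 f2 F x y : C11 M f f1 f2 -> weight a -> weight b ->
  (forall p, is_derive b p (a p)) -> b (2 * PI) = b 0 -> lip M F -> bdd M F ->
  (forall p u v, a p * cos p * f1 u v + a p * sin p * f2 u v + (b p * sin p * f1 u v - b p * cos p * f2 u v) = F u v) ->
  conv ker0 (fun _ => 1) F x y = conv ker1 a f x y.
Proof.
intros H Wa Wb Db Hb LF BF HF. destruct kernels_decay as [B [Hk0 Hk1]].
pose proof (C11_lip H) as Lf. pose proof H as [Bf B1 B2 L1 L2 _ _].
pose proof (weight_mult _ _ Wb weight_cos) as Wbc. pose proof (weight_mult _ _ Wb weight_sin) as Wbs.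
pose proof (weight_mult _ _ Wa weight_cos) as Wac. pose proof (weight_mult _ _ Wa weight_sin) as Was.
pose proof (bdd_pos _ _ Bf) as HM.
set (C := circ a f x y).
assert (EF : forall r, circ (fun _ => 1) F x y r =
   (circ (fun p => a p * cos p) f1 x y r + circ (fun p => a p * sin p) f2 x y r) +
   (circ (fun p => b p * sin p) f1 x y r - circ (fun p => b p * cos p) f2 x y r)).
{ intros r. pose proof (circ_cont _ f1 M x y r Wac L1) as K1. pose proof (circ_cont _ f2 M x y r Was L2) as K2.
  pose proof (circ_cont _ f1 M x y r Wbs L1) as K3. pose proof (circ_cont _ f2 M x y r Wbc L2) as K4.
  pose proof (fun z => continuous_lin _ _ 1 z (K1 z) (K2 z)) as K12.
  pose proof (fun z => continuous_lin _ _ 1 z (K12 z) (K3 z)) as K123. cbv beta in K12, K123.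
  transitivity (circ (fun p => a p * cos p) f1 x y r + 1 * circ (fun p => a p * sin p) f2 x y r +
   1 * circ (fun p => b p * sin p) f1 x y r + (-1) * circ (fun p => b p * cos p) f2 x y r); [|ring].
  unfold circ. rewrite <- RInt_lin by assumption. rewrite <- RInt_lin by assumption. rewrite <- RInt_lin by assumption.
  apply RInt_ext_R. intros p. rewrite <- (HF p). ring. }
assert (HC0 : forall r, C r = r * (circ (fun p => b p * sin p) f1 x y r - circ (fun p => b p * cos p) f2 x y r)).
{ intros r. apply (circ_ibp a b M); assumption. }
assert (HCl : forall r, 0 < r -> Rabs (C r) <= 4 * PI * M * r).
{ intros r Hr. pose proof (circ_lip_r a f M x y Wa Lf r 0) as A. fold C in A.
  rewrite (HC0 0), Rmult_0_l, !Rminus_0_r, (Rabs_right r) in A by lra. lra. }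
assert (D : forall r, 0 <= r -> is_derive (fun s => ker0 s * C s) r (ker0 r * circ (fun _ => 1) F x y r + (-1) * (ker1 r * C r))).
{ intros r [Hr|<-].
  - pose proof (is_derive_mult _ _ r _ _ (ker0_der r Hr) (circ_der_r a M f f1 f2 x y r Wa H) Rmult_comm) as D1.
    apply (is_derive_eq D1).
    rewrite EF. fold C. pose proof (HC0 r) as E.
    unfold_alg. fold C.
    replace ((ker0 r / r - ker1 r) * C r) with (ker0 r * (C r / r) - ker1 r * C r) by (field; lra).
    replace (C r / r) with (circ (fun p => b p * sin p) f1 x y r - circ (fun p => b p * cos p) f2 x y r).
    2:{ rewrite E. field. lra. }
    ring.
  - rewrite ker0_0, (HC0 0). replace (0 * circ (fun _ => 1) F x y 0 +
      -1 * (ker1 0 * (0 * (circ (fun p => b p * sin p) f1 x y 0 - circ (fun p => b p * cos p) f2 x y 0)))) with 0 by ring.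
    apply is_derive_ext with (fun s => if Rle_dec s 0 then 0 else ker0_pos s * C s).
    { intros s. unfold ker0. destruct (Rle_dec s 0); [symmetry; apply Rmult_0_l|reflexivity]. }
    apply (glue_0_der 0 (fun s => ker0_pos s * C s)). intros eps He.
    pose proof PI_RGT_0 as HP.
    assert (Hden : 0 < 4 * PI * M + 1) by nra.
    destruct (ker0_pos_small (eps / (4 * PI * M + 1))) as [d [Hd Hk]]; [apply Rdiv_lt_0_compat; assumption|].
    exists d. split; [lra|]. intros r Hr. specialize (Hk r Hr). specialize (HCl r ltac:(lra)).
    rewrite Rminus_0_r, Rabs_mult, (Rabs_right (ker0_pos r)) by lra.
    apply Rle_trans with (eps / (4 * PI * M + 1) * (4 * PI * M * r)).
    + apply Rmult_le_compat; [lra|apply Rabs_pos|lra|lra].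
    + replace (eps / (4 * PI * M + 1) * (4 * PI * M * r)) with (eps * r * (4 * PI * M / (4 * PI * M + 1))) by (field; lra).
      rewrite <- (Rmult_1_r (eps * r)) at 2. apply Rmult_le_compat_l; [nra|].
      apply Rle_div_l; lra. }
pose proof (circ_decay B ker0 (fun _ => 1) F M M x y Hk0 weight_1 LF BF) as Dc0.
pose proof (circ_decay B ker1 a f M M x y Hk1 Wa Lf Bf) as Dc1.
pose proof (decay_lin _ _ _ _ (-1) Dc0 Dc1) as Dc. cbv beta in Dc.
pose proof (half_int_derive _ _ _ Dc D) as E.
rewrite (half_int_lin (2 * PI * B * M) (2 * PI * B * M)) in E by assumption.
fold C in E. unfold conv. fold C.
rewrite ker0_0 in E.
enough (half_int (fun r => ker0 r * circ (fun _ => 1) F x y r) + -1 * half_int (fun r => ker1 r * C r) = - (0 * C 0)) by lra.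
apply E. apply (decay_bounded_lim B ker0 C (2 * PI * M) Hk0). intros r. apply circ_bound with M; assumption.
Qed.

(** The factor [1 / (2 PI)] makes the resolvent below an exact inverse of
    [4 - Delta]. *)
Definition nconv (k a : R -> R) (f : R -> R -> R) (x y : R) := / (2 * PI) * conv k a f x y.

(** The inverse of [4 - Delta], see resolvent_eqn; [resolvent_d1] and [resolvent_d2] yield the
    partial derivatives of its values. *)
Definition resolvent := nconv ker0 (fun _ => 1).
Definition resolvent_d1 := nconv ker1 cos.
Definition resolvent_d2 := nconv ker1 sin.

Lemma resolvent_partial1 M f f1 f2 x y : C11 M f f1 f2 -> resolvent f1 x y = resolvent_d1 f x y.
Proof.
intros H. unfold resolvent, resolvent_d1, nconv. f_equal. apply (kernel_ibp cos sin M f f1 f2 f1); try apply H.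
- apply weight_cos.
- apply weight_sin.
- intros p. auto_derive; [exact I|ring].
- rewrite sin_2PI, sin_0. reflexivity.
- intros p u v. pose proof (sin2_cos2 p) as S. unfold Rsqr in S.
  transitivity ((sin p * sin p + cos p * cos p) * f1 u v); [ring|rewrite S; ring].
Qed.

Lemma resolvent_partial2 M f f1 f2 x y : C11 M f f1 f2 -> resolvent f2 x y = resolvent_d2 f x y.
Proof.
intros H. unfold resolvent, resolvent_d2, nconv. f_equal. apply (kernel_ibp sin (fun p => - cos p) M f f1 f2 f2); try apply H.
- apply weight_sin.
- split; [intros z; apply (continuous_opp cos), continuous_cos|].
  intros z. rewrite Rabs_Ropp. apply weight_cos.
- intros p. auto_derive; [exact I|ring].
- rewrite cos_2PI, cos_0. reflexivity.
- intros p u v. pose proof (sin2_cos2 p) as S. unfold Rsqr in S.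
  transitivity ((sin p * sin p + cos p * cos p) * f2 u v); [ring|rewrite S; ring].
Qed.

(** The radial derivative of the circle means of [f] is the flux of its gradient, so
    that the left side is [int ker1 A'] with A the circle integral of [f];
    integrating by parts, [ker1 0 = 1] produces the value of [f] at the centre and
    [ker1' = - 4 ker0] the multiple of the resolvent. *)
Lemma resolvent_eqn M f f1 f2 x y : C11 M f f1 f2 -> resolvent_d1 f1 x y + resolvent_d2 f2 x y = 4 * resolvent f x y - f x y.
Proof.
intros H. destruct kernels_decay as [B [Hk0 Hk1]].
pose proof (C11_lip H) as Lf. pose proof H as [Bf B1 B2 L1 L2 _ _].
pose proof (circ_decay B ker0 (fun _ => 1) f M M x y Hk0 weight_1 Lf Bf) as D0.
pose proof (circ_decay B ker1 cos f1 M M x y Hk1 weight_cos L1 B1) as D1.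
pose proof (circ_decay B ker1 sin f2 M M x y Hk1 weight_sin L2 B2) as D2.
pose proof (decay_lin _ _ _ _ 1 D1 D2) as D12. cbv beta in D12.
pose proof (decay_lin _ _ _ _ (-4) D12 D0) as D120. cbv beta in D120.
pose proof (half_int_derive _ (fun r => ker1 r * circ (fun _ => 1) f x y r) _ D120) as E.
rewrite (half_int_lin _ _ _ _ (-4) D12 D0), (half_int_lin _ _ _ _ 1 D1 D2) in E.
fold (conv ker1 cos f1 x y) (conv ker1 sin f2 x y) (conv ker0 (fun _ => 1) f x y) in E.
rewrite ker1_0 in E.
assert (E0 : circ (fun _ => 1) f x y 0 = 2 * PI * f x y).
{ unfold circ. transitivity (RInt (fun _ : R => f x y) 0 (2 * PI)).
  - apply RInt_ext_R. intros t. rewrite !Rmult_0_l, !Rplus_0_r, Rmult_1_l. reflexivity.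
  - rewrite RInt_const. change (scal (2 * PI - 0) (f x y)) with ((2 * PI - 0) * f x y). ring. }
rewrite E0 in E. unfold resolvent_d1, resolvent_d2, resolvent, nconv. pose proof PI_RGT_0.
assert (E' : conv ker1 cos f1 x y + 1 * conv ker1 sin f2 x y + -4 * conv ker0 (fun _ => 1) f x y = - (1 * (2 * PI * f x y))).
{ apply E.
  - intros r Hr.
    pose proof (is_derive_mult _ _ r _ _ (ker1_der r Hr) (circ_der_r _ M f f1 f2 x y r weight_1 H) Rmult_comm) as Dr.
    apply (is_derive_eq Dr).
    assert (Ec : circ (fun p => 1 * cos p) f1 x y r = circ cos f1 x y r).
    { unfold circ. apply RInt_ext_R. intros p. ring. }
    assert (Es : circ (fun p => 1 * sin p) f2 x y r = circ sin f2 x y r).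
    { unfold circ. apply RInt_ext_R. intros p. ring. }
    rewrite Ec, Es.
    unfold_alg. ring.
  - apply (decay_bounded_lim B ker1 _ (2 * PI * M) Hk1). intros r. apply circ_bound with M; [apply weight_1|assumption|assumption]. }
replace (/ (2 * PI) * conv ker1 cos f1 x y + / (2 * PI) * conv ker1 sin f2 x y) with
  (/ (2 * PI) * (conv ker1 cos f1 x y + 1 * conv ker1 sin f2 x y)) by ring.
replace (conv ker1 cos f1 x y + 1 * conv ker1 sin f2 x y) with (4 * conv ker0 (fun _ => 1) f x y - 2 * PI * f x y) by lra.
field. lra.
Qed.

Definition kbound : R := proj1_sig (constructive_indefinite_description _ kernels_decay).
Lemma kbound_spec : decay kbound ker0 /\ decay kbound ker1.
Proof. exact (proj2_sig (constructive_indefinite_description _ kernels_decay)). Qed.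

Lemma kbound_pos : 0 <= kbound.
Proof. apply (decay_pos _ _ (proj1 kbound_spec)). Qed.

Lemma nconv_bdd k a f L m : decay kbound k -> weight a -> lip L f -> bdd m f -> bdd (kbound * m) (nconv k a f).
Proof.
intros Hk Wa Lf Bf x y. pose proof PI_RGT_0 as HP. pose proof (conv_bound kbound k a f L m Hk Wa Lf Bf x y) as H.
unfold nconv. rewrite Rabs_mult, Rabs_inv, (Rabs_right (2 * PI)) by lra.
apply Rmult_le_reg_l with (2 * PI); [lra|]. rewrite <- Rmult_assoc, Rinv_r, Rmult_1_l by lra. lra.
Qed.

Lemma nconv_lip k a f L m : decay kbound k -> weight a -> lip L f -> bdd m f -> lip (kbound * L) (nconv k a f).
Proof.
intros Hk Wa Lf Bf x y x' y'. pose proof PI_RGT_0 as HP.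
pose proof (conv_lip kbound k a f L m Hk Wa Lf Bf x y x' y') as H.
unfold nconv. rewrite <- Rmult_minus_distr_l, Rabs_mult, Rabs_inv, (Rabs_right (2 * PI)) by lra.
apply Rmult_le_reg_l with (2 * PI); [lra|]. rewrite <- Rmult_assoc, Rinv_r, Rmult_1_l by lra. lra.
Qed.

Lemma nconv_der1 k a M f f1 f2 x y : decay kbound k -> weight a -> C11 M f f1 f2 ->
  is_derive (fun t => nconv k a f t y) x (nconv k a f1 x y).
Proof. intros Hk Wa H. apply (is_derive_scal (fun t => conv k a f t y)), (conv_der1 kbound k a M f f1 f2); assumption. Qed.

Lemma nconv_der2 k a M f f1 f2 x y : decay kbound k -> weight a -> C11 M f f1 f2 ->
  is_derive (fun t => nconv k a f x t) y (nconv k a f2 x y).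
Proof. intros Hk Wa H. apply (is_derive_scal (fun t => conv k a f x t)), (conv_der2 kbound k a M f f1 f2); assumption. Qed.

Lemma resolvent_bdd f L m : lip L f -> bdd m f -> bdd (kbound * m) (resolvent f).
Proof. exact (nconv_bdd _ _ f L m (proj1 kbound_spec) weight_1). Qed.

Lemma resolvent_d1_bdd f L m : lip L f -> bdd m f -> bdd (kbound * m) (resolvent_d1 f).
Proof. exact (nconv_bdd _ _ f L m (proj2 kbound_spec) weight_cos). Qed.

Lemma resolvent_d2_bdd f L m : lip L f -> bdd m f -> bdd (kbound * m) (resolvent_d2 f).
Proof. exact (nconv_bdd _ _ f L m (proj2 kbound_spec) weight_sin). Qed.

Lemma resolvent_d1_lip f L m : lip L f -> bdd m f -> lip (kbound * L) (resolvent_d1 f).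
Proof. exact (nconv_lip _ _ f L m (proj2 kbound_spec) weight_cos). Qed.

Lemma resolvent_d2_lip f L m : lip L f -> bdd m f -> lip (kbound * L) (resolvent_d2 f).
Proof. exact (nconv_lip _ _ f L m (proj2 kbound_spec) weight_sin). Qed.

Lemma resolvent_d1_der1 M f f1 f2 x y : C11 M f f1 f2 -> is_derive (fun t => resolvent_d1 f t y) x (resolvent_d1 f1 x y).
Proof. exact (nconv_der1 _ _ M f f1 f2 x y (proj2 kbound_spec) weight_cos). Qed.

Lemma resolvent_d1_der2 M f f1 f2 x y : C11 M f f1 f2 -> is_derive (fun t => resolvent_d1 f x t) y (resolvent_d1 f2 x y).
Proof. exact (nconv_der2 _ _ M f f1 f2 x y (proj2 kbound_spec) weight_cos). Qed.

Lemma resolvent_d2_der1 M f f1 f2 x y : C11 M f f1 f2 -> is_derive (fun t => resolvent_d2 f t y) x (resolvent_d2 f1 x y).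
Proof. exact (nconv_der1 _ _ M f f1 f2 x y (proj2 kbound_spec) weight_sin). Qed.

Lemma resolvent_d2_der2 M f f1 f2 x y : C11 M f f1 f2 -> is_derive (fun t => resolvent_d2 f x t) y (resolvent_d2 f2 x y).
Proof. exact (nconv_der2 _ _ M f f1 f2 x y (proj2 kbound_spec) weight_sin). Qed.

Lemma resolvent_der1 M f f1 f2 x y : C11 M f f1 f2 -> is_derive (fun t => resolvent f t y) x (resolvent_d1 f x y).
Proof.
intros H. rewrite <- (resolvent_partial1 M f f1 f2 x y H). exact (nconv_der1 _ _ M f f1 f2 x y (proj1 kbound_spec) weight_1 H).
Qed.

Lemma resolvent_der2 M f f1 f2 x y : C11 M f f1 f2 -> is_derive (fun t => resolvent f x t) y (resolvent_d2 f x y).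
Proof.
intros H. rewrite <- (resolvent_partial2 M f f1 f2 x y H). exact (nconv_der2 _ _ M f f1 f2 x y (proj1 kbound_spec) weight_1 H).
Qed.

Lemma RInt_periodic_shift (G : R -> R) c : (forall z, continuous G z) -> (forall p, G (p + 2 * PI) = G p) ->
  RInt (fun p => G (p + c)) 0 (2 * PI) = RInt G 0 (2 * PI).
Proof.
intros HC HP.
pose proof (ex_RInt_cont G) as Hex.
assert (HS : forall u a b, RInt (fun p => G (p + u)) a b = RInt G (a + u) (b + u)).
{ intros u a b. pose proof (RInt_comp_lin (V := R_CompleteNormedModule) G 1 u a b (Hex _ _ HC)) as E.
  rewrite !Rmult_1_l in E. rewrite <- E. apply RInt_ext_R. intros t.
  change (G (t + u) = 1 * G (1 * t + u)). rewrite !Rmult_1_l. reflexivity. }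
rewrite HS, Rplus_0_l.
assert (E1 : RInt G 0 (2 * PI + c) = RInt G 0 c + RInt G c (2 * PI + c)).
{ symmetry. apply (RInt_Chasles G); apply Hex, HC. }
assert (E2 : RInt G 0 (2 * PI + c) = RInt G 0 (2 * PI) + RInt G (2 * PI) (2 * PI + c)).
{ symmetry. apply (RInt_Chasles G); apply Hex, HC. }
assert (E3 : RInt G (2 * PI) (2 * PI + c) = RInt G 0 c).
{ rewrite <- (RInt_ext_R (fun p => G (p + 2 * PI)) G 0 c HP), HS, Rplus_0_l, (Rplus_comm c). reflexivity. }
rewrite E3 in E2. rewrite E1 in E2. apply (Rplus_eq_reg_l (RInt G 0 c)).
rewrite E2. apply Rplus_comm.
Qed.

Lemma RInt_periodic_reflect (G : R -> R) : (forall z, continuous G z) -> (forall p, G (p + 2 * PI) = G p) ->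
  RInt (fun p => G (- p)) 0 (2 * PI) = RInt G 0 (2 * PI).
Proof.
intros HC HP.
pose proof (RInt_comp_lin (V := R_CompleteNormedModule) G (-1) (2 * PI) 0 (2 * PI) (ex_RInt_cont _ _ _ HC)) as E.
replace (-1 * 0 + 2 * PI) with (2 * PI) in E by ring. replace (-1 * (2 * PI) + 2 * PI) with 0 in E by ring.
assert (E2 : RInt G (2 * PI) 0 = - RInt G 0 (2 * PI)).
{ symmetry. apply (opp_RInt_swap G). apply ex_RInt_cont, HC. }
assert (E3 : RInt (fun y => scal (-1) (G (-1 * y + 2 * PI))) 0 (2 * PI) = - RInt (fun p => G (- p)) 0 (2 * PI)).
{ transitivity (RInt (fun p => opp (G (- p))) 0 (2 * PI)).
  - apply RInt_ext_R. intros t. change (-1 * G (-1 * t + 2 * PI) = - G (- t)). rewrite HP.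
    replace (-1 * t) with (- t) by ring. ring.
  - apply (RInt_opp (V := R_CompleteNormedModule) (fun p => G (- p))). apply ex_RInt_cont. intros z.
    apply (continuous_comp Ropp G); [apply (continuous_opp (fun x : R => x)), continuous_id|apply HC]. }
assert (E4 : - RInt (fun p => G (- p)) 0 (2 * PI) = - RInt G 0 (2 * PI)).
{ rewrite <- E3, <- E2. exact E. }
apply Ropp_eq_compat in E4. rewrite !Ropp_involutive in E4. exact E4.
Qed.

Lemma circ1_cont f L x y r : lip L f -> forall z, continuous (fun p => f (x + r * cos p) (y + r * sin p)) z.
Proof.
intros HL z. apply (continuous_ext (fun p => 1 * f (x + r * cos p) (y + r * sin p))).
- intros p. apply Rmult_1_l.
- apply (circ_cont (fun _ => 1) f L); [apply weight_1|exact HL].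
Qed.

Lemma circ1_opp f L (p q : R -> R) : lip L f -> (forall z, continuous p z) -> (forall z, continuous q z) ->
  RInt (fun t => - f (p t) (q t)) 0 (2 * PI) = - RInt (fun t => f (p t) (q t)) 0 (2 * PI).
Proof.
intros HL Hp Hq. apply (RInt_opp (V := R_CompleteNormedModule) (fun t => f (p t) (q t))).
apply ex_RInt_cont. intros z. apply continuous_lip2 with L; auto.
Qed.

Definition odd_y (f : R -> R -> R) := forall x y, f x (- y) = - f x y.
Definition rot_odd (a : R) (f : R -> R -> R) := forall x y,
  f (cos a * x - sin a * y) (sin a * x + cos a * y) = - f x y.

Lemma period_cs p : cos (p + 2 * PI) = cos p /\ sin (p + 2 * PI) = sin p.
Proof. rewrite cos_plus, sin_plus, cos_2PI, sin_2PI. split; ring. Qed.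

Lemma resolvent_opp f L m x y x' y' : lip L f -> bdd m f ->
  (forall r, circ (fun _ => 1) f x' y' r = - circ (fun _ => 1) f x y r) -> resolvent f x' y' = - resolvent f x y.
Proof.
intros HL Hm E. unfold resolvent, nconv. rewrite Ropp_mult_distr_r. f_equal. unfold conv.
pose proof (circ_decay kbound ker0 (fun _ => 1) f L m x y (proj1 kbound_spec) weight_1 HL Hm) as D.
pose proof (half_int_lin _ _ _ _ (-2) D D) as E2.
(* - F is written F - 2 F, to fit the linearity lemma *)
rewrite (half_int_ext _ (fun r => ker0 r * circ (fun _ => 1) f x y r + -2 * (ker0 r * circ (fun _ => 1) f x y r))).
- rewrite E2. ring.
- intros r _. rewrite E. ring.
Qed.

Lemma resolvent_odd f L m : lip L f -> bdd m f -> odd_y f -> odd_y (resolvent f).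
Proof.
intros HL Hm Ho x y. apply (resolvent_opp f L m); [exact HL|exact Hm|].
intros r. unfold circ.
transitivity (RInt (fun t => - f (x + r * cos (- t)) (y + r * sin (- t))) 0 (2 * PI)).
- apply RInt_ext_R. intros p. rewrite Rmult_1_l, <- Ho, cos_neg, sin_neg. f_equal. ring.
- rewrite (circ1_opp f L (fun t => x + r * cos (- t)) (fun t => y + r * sin (- t)) HL).
  + f_equal. rewrite (RInt_periodic_reflect (fun t => f (x + r * cos t) (y + r * sin t))).
    * apply RInt_ext_R. intros p. ring.
    * apply circ1_cont with L, HL.
    * intros p. destruct (period_cs p) as [-> ->]. reflexivity.
  + intros z. apply (ex_derive_continuous (fun t => x + r * cos (- t))). auto_derive. exact I.
  + intros z. apply (ex_derive_continuous (fun t => y + r * sin (- t))). auto_derive. exact I.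
Qed.

Lemma resolvent_rot a f L m : lip L f -> bdd m f -> rot_odd a f -> rot_odd a (resolvent f).
Proof.
intros HL Hm Ho x y. apply (resolvent_opp f L m); [exact HL|exact Hm|].
intros r. unfold circ.
transitivity (RInt (fun t => - f (x + r * cos (t + - a)) (y + r * sin (t + - a))) 0 (2 * PI)).
- apply RInt_ext_R. intros p. rewrite Rmult_1_l, <- Ho.
  assert (E1 : cos p = cos a * cos (p + - a) - sin a * sin (p + - a)).
  { rewrite <- cos_plus. f_equal. ring. }
  assert (E2 : sin p = sin a * cos (p + - a) + cos a * sin (p + - a)).
  { rewrite <- sin_plus. f_equal. ring. }
  f_equal; [rewrite E1 at 1|rewrite E2 at 1]; ring.
- rewrite (circ1_opp f L (fun t => x + r * cos (t + - a)) (fun t => y + r * sin (t + - a)) HL).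
  + f_equal. rewrite (RInt_periodic_shift (fun t => f (x + r * cos t) (y + r * sin t))).
    * apply RInt_ext_R. intros p. ring.
    * apply circ1_cont with L, HL.
    * intros p. destruct (period_cs p) as [-> ->]. reflexivity.
  + intros z. apply (ex_derive_continuous (fun t => x + r * cos (t + - a))). auto_derive. exact I.
  + intros z. apply (ex_derive_continuous (fun t => y + r * sin (t + - a))). auto_derive. exact I.
Qed.

(** * The second derivative test and maximum principles *)

(** A pointwise second derivative: the first derivative is required only nearby.
    This is what the second derivative test needs, and it is additive. *)
Definition second_derive (f : R -> R) (x a : R) := exists p : R -> R,
  locally x (fun t => is_derive f t (p t)) /\ is_derive p x a.
Definition lap_at (w : R -> R -> R) (x y l : R) := exists a b,
  second_derive (fun t => w t y) x a /\ second_derive (fun t => w x t) y b /\ l = a + b.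

Lemma second_derive_lin f g x a b c : second_derive f x a -> second_derive g x b ->
  second_derive (fun t => f t + c * g t) x (a + c * b).
Proof.
intros [p [Hp Dp]] [q [Hq Dq]]. exists (fun t => p t + c * q t). split.
- apply filter_imp with (2 := filter_and _ _ Hp Hq). intros t [H1 H2].
  apply (is_derive_plus f (fun t => c * g t)); [exact H1|]. apply (is_derive_scal g). exact H2.
- apply (is_derive_plus p (fun t => c * q t)); [exact Dp|]. apply (is_derive_scal q). exact Dq.
Qed.

Lemma lap_lin w v x y l l' c : lap_at w x y l -> lap_at v x y l' ->
  lap_at (fun s t => w s t + c * v s t) x y (l + c * l').
Proof.
intros [a [b [H1 [H2 ->]]]] [a' [b' [H1' [H2' ->]]]].
exists (a + c * a'), (b + c * b'). split; [|split].
- apply (second_derive_lin (fun t => w t y) (fun t => v t y)); assumption.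
- apply (second_derive_lin (fun t => w x t) (fun t => v x t)); assumption.
- ring.
Qed.

(** If the second derivative were negative, the first one would be negative just to
    the right of the minimum. *)
Lemma min_second f x a : second_derive f x a -> locally x (fun t => f x <= f t) -> 0 <= a.
Proof.
intros [p [[e1 Hp] Dp]] [e2 Hm].
assert (B : forall (e : posreal) t, Rabs (t - x) < e -> ball x e t) by (intros e t H; exact H).
destruct (Rle_dec 0 a) as [|Hn]; [assumption|exfalso]. apply Rnot_le_lt in Hn.
assert (Hpx : is_derive f x (p x)).
{ apply Hp, B. rewrite Rminus_diag, Rabs_R0. apply cond_pos. }
assert (E0 : p x = 0).
{ set (e := Rmin e1 e2). assert (He : 0 < e) by (apply Rmin_glb_lt; apply cond_pos).
  apply is_derive_Reals in Hpx.
  pose proof (deriv_minimum f (x - e) (x + e) x (exist _ (p x) Hpx)) as H. simpl in H.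
  apply H; try lra. intros t H1 H2. apply Hm, B.
  apply Rabs_def1; pose proof (Rmin_r e1 e2); unfold e in *; lra. }
apply is_derive_Reals in Dp. destruct (Dp (- a / 2) ltac:(lra)) as [d Hd].
set (e := Rmin d (Rmin e1 e2)). assert (He : 0 < e) by (repeat apply Rmin_glb_lt; apply cond_pos).
assert (Hed : e <= d) by apply Rmin_l.
assert (Hee : e <= e1 /\ e <= e2).
{ pose proof (Rmin_r d (Rmin e1 e2)). pose proof (Rmin_l e1 e2). pose proof (Rmin_r e1 e2). unfold e; lra. }
set (t := x + e / 2).
destruct (MVT_cor2 f p x t) as [c [Ec Hc]].
- unfold t. lra.
- intros s Hs. apply is_derive_Reals, Hp, B. unfold t in Hs. apply Rabs_def1; lra.
- assert (Hft : f x <= f t). { apply Hm, B. unfold t. apply Rabs_def1; lra. }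
  unfold t in Hc. specialize (Hd (c - x) ltac:(lra)).
  replace (x + (c - x)) with c in Hd by ring. rewrite E0, Rminus_0_r in Hd.
  assert (Hs' : Rabs (c - x) < d) by (apply Rabs_def1; lra).
  specialize (Hd Hs'). apply Rabs_def2 in Hd. destruct Hd as [Hd _].
  assert (H : p c / (c - x) < 0) by lra.
  apply Rmult_lt_compat_r with (r := c - x) in H; [|lra].
  unfold Rdiv in H. rewrite Rmult_assoc, Rinv_l in H by lra.
  assert (Htx : t - x = e / 2) by (unfold t; lra). rewrite Htx in Ec. nra.
Qed.

Lemma lip_min f g : lip 1 f -> lip 1 g -> lip 1 (fun x y => Rmin (f x y) (g x y)).
Proof.
intros Hf Hg x y x' y'. specialize (Hf x y x' y'). specialize (Hg x y x' y').
apply Rabs_le_between in Hf. apply Rabs_le_between in Hg. apply Rabs_le.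
unfold Rmin. destruct (Rle_dec (f x y) (g x y)), (Rle_dec (f x' y') (g x' y')); lra.
Qed.

(** Weierstrass theorem.  Writing the compact set as [0 <= phi] with phi Lipschitz makes
    it closed, and shows an explicit neighbourhood of each point with [0 < phi].  If the
    infimum [m] of exp o W were not attained, each point would have a neighbourhood on
    whose trace on the set the function exceeds [m] by the radius; compactness makes
    this gain uniform.  The exponential provides a lower bound in advance. *)
Lemma compact_min (phi W : R -> R -> R) Rr x0 y0 : 0 <= phi x0 y0 -> lip 1 phi ->
  (forall x y, 0 <= phi x y -> -Rr <= x <= Rr /\ -Rr <= y <= Rr) ->
  (forall x y, continuity_2d_pt W x y) ->
  exists x y, 0 <= phi x y /\ forall u v, 0 <= phi u v -> W x y <= W u v.
Proof.
set (K := fun x y => 0 <= phi x y). change (0 <= phi x0 y0) with (K x0 y0).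
intros HK0 Hphi Hbox HW.
assert (HE : forall x y, continuity_2d_pt (fun u v => exp (W u v)) x y).
{ intros x y. apply (continuity_1d_2d_pt_comp exp W); [|apply HW].
  apply derivable_continuous_pt, derivable_pt_exp. }
set (P := fun z => exists x y, K x y /\ z = - exp (W x y)).
destruct (completeness P) as [s [Hub Hlub]].
- exists 0. intros z [x [y [_ ->]]]. pose proof (exp_pos (W x y)). lra.
- exists (- exp (W x0 y0)), x0, y0. split; [exact HK0|reflexivity].
- set (m := - s).
  assert (Hm : forall x y, K x y -> m <= exp (W x y)).
  { intros x y H. assert (- exp (W x y) <= s) by (apply Hub; exists x, y; split; [exact H|reflexivity]).
    unfold m. lra. }
  apply NNPP. intros Hno.
  assert (Hst : forall x y, K x y -> m < exp (W x y)).
  { intros x y H. destruct (Hm x y H) as [|E]; [assumption|exfalso]. apply Hno. exists x, y. split; [exact H|].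
    intros u v Huv. specialize (Hm u v Huv). rewrite E in Hm.
    destruct Hm as [Hlt|Heq]; [left; apply exp_lt_inv, Hlt|right; apply exp_inv, Heq]. }
  assert (Hd : forall x y, exists d : posreal, forall u v, Rabs (u - x) < d -> Rabs (v - y) < d -> K u v ->
     m + d <= exp (W u v)).
  { intros x y. destruct (classic (K x y)) as [H|H].
    - pose proof (Hst x y H) as H1.
      assert (He : 0 < (exp (W x y) - m) / 2) by lra.
      destruct (HE x y (mkposreal _ He)) as [d Hd]. simpl in Hd.
      assert (Hp : 0 < Rmin d ((exp (W x y) - m) / 2)) by (apply Rmin_glb_lt; [apply cond_pos|lra]).
      exists (mkposreal _ Hp). simpl. intros u v Hu Hv _.
      pose proof (Rmin_l d ((exp (W x y) - m) / 2)). pose proof (Rmin_r d ((exp (W x y) - m) / 2)).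
      specialize (Hd u v ltac:(lra) ltac:(lra)). apply Rabs_def2 in Hd. lra.
    - apply Rnot_le_lt in H. assert (He : 0 < - phi x y / 2) by lra. exists (mkposreal _ He).
      intros u v Hu Hv Huv. unfold K in Huv. pose proof (Rle_abs (phi u v - phi x y)).
      pose proof (Hphi u v x y). simpl in Hu, Hv. lra. }
  set (delta := fun x y => proj1_sig (constructive_indefinite_description _ (Hd x y))).
  assert (Hdelta : forall x y u v, Rabs (u - x) < delta x y -> Rabs (v - y) < delta x y -> K u v ->
     m + delta x y <= exp (W u v)).
  { intros x y. exact (proj2_sig (constructive_indefinite_description _ (Hd x y))). }
  destruct (compactness_value_2d (-Rr) Rr (-Rr) Rr delta) as [d Hdd].
  assert (Hfin : forall x y, K x y -> m + d <= exp (W x y)).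
  { intros x y H. destruct (Hbox x y H) as [Hx Hy]. apply NNPP. intros Hc.
    apply (Hdd x y Hx Hy). intros [u [v [_ [_ [Hu [Hv Hle]]]]]].
    pose proof (Hdelta u v x y Hu Hv H). lra. }
  assert (s <= - (m + d)).
  { apply Hlub. intros z [x [y [H ->]]]. specialize (Hfin x y H). lra. }
  pose proof (cond_pos d). unfold m in *. lra.
Qed.

(** At a negative minimum, which is interior by hypothesis, the Laplacian cannot be
    negative. *)
Lemma max_principle_compact (phi W : R -> R -> R) Rr : lip 1 phi ->
  (forall x y, 0 <= phi x y -> -Rr <= x <= Rr /\ -Rr <= y <= Rr) ->
  (forall x y, continuity_2d_pt W x y) ->
  (forall x y, 0 <= phi x y -> W x y < 0 -> 0 < phi x y /\ exists l, lap_at W x y l /\ l < 0) ->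
  forall x y, 0 <= phi x y -> 0 <= W x y.
Proof.
intros Hphi Hbox HW Hin x0 y0 H0.
destruct (compact_min phi W Rr x0 y0 H0 Hphi Hbox HW) as [x [y [HK Hmin]]].
destruct (Rle_dec 0 (W x y)) as [H|H]; [apply Rle_trans with (1 := H), Hmin, H0|exfalso].
apply Rnot_le_lt in H. destruct (Hin x y HK H) as [He [l [[a [b [Ha [Hb ->]]]] Hl]]].
assert (0 <= a).
{ apply (min_second _ _ _ Ha). exists (mkposreal _ He). intros t Ht. apply Hmin.
  pose proof (lip_x _ _ y Hphi t x) as E. apply Rabs_le_between in E.
  change (Rabs (t - x) < phi x y) in Ht. lra. }
assert (0 <= b).
{ apply (min_second _ _ _ Hb). exists (mkposreal _ He). intros t Ht. apply Hmin.
  pose proof (lip_y _ _ x Hphi t y) as E. apply Rabs_le_between in E.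
  change (Rabs (t - y) < phi x y) in Ht. lra. }
lra.
Qed.

(** A Lipschitz function whose superlevel sets are squares about [(x, y)], the form of
    domain used in the maximum principle above. *)
Definition box_dist (x y L u v : R) := Rmin (L - Rabs (u - x)) (L - Rabs (v - y)).

Lemma box_dist_lip x y L : lip 1 (box_dist x y L).
Proof.
apply (lip_min (fun u _ => L - Rabs (u - x)) (fun _ v => L - Rabs (v - y))).
- intros u v u' v'. pose proof (Rabs_triang_inv2 (u' - x) (u - x)) as H.
  replace (u' - x - (u - x)) with (- (u - u')) in H by ring. rewrite Rabs_Ropp in H.
  replace (L - Rabs (u - x) - (L - Rabs (u' - x))) with (Rabs (u' - x) - Rabs (u - x)) by ring.
  pose proof (Rabs_pos (v - v')). lra.
- intros u v u' v'. pose proof (Rabs_triang_inv2 (v' - y) (v - y)) as H.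
  replace (v' - y - (v - y)) with (- (v - v')) in H by ring. rewrite Rabs_Ropp in H.
  replace (L - Rabs (v - y) - (L - Rabs (v' - y))) with (Rabs (v' - y) - Rabs (v - y)) by ring.
  pose proof (Rabs_pos (u - u')). lra.
Qed.

Lemma box_dist_ge c x y L u v : c <= box_dist x y L u v <-> Rabs (u - x) <= L - c /\ Rabs (v - y) <= L - c.
Proof. unfold box_dist, Rmin. destruct (Rle_dec _ _); split; lra. Qed.

Lemma box_dist_pos x y L u v : 0 <= box_dist x y L u v ->
  0 < box_dist x y L u v \/ Rabs (u - x) = L \/ Rabs (v - y) = L.
Proof. unfold box_dist, Rmin. destruct (Rle_dec _ _); lra. Qed.

Lemma second_derive_const c x : second_derive (fun _ => c) x 0.
Proof.
exists (fun _ => 0). split; [|apply (is_derive_const (V := R_NormedModule) 0)].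
exists (mkposreal 1 Rlt_0_1). intros t _. apply (is_derive_const (V := R_NormedModule) c).
Qed.

Lemma second_derive_ext f g x a : (forall t, f t = g t) -> second_derive f x a -> second_derive g x a.
Proof.
intros E [p [[e H] D]]. exists p. split; [|exact D]. exists e. intros t Ht.
apply is_derive_ext with f; [exact E|apply H, Ht].
Qed.

Lemma cosh_affine_second A B k c x :
  second_derive (fun t => A + B * cosh (k * (t - c))) x (B * k ^ 2 * cosh (k * (x - c))).
Proof.
assert (D : forall t, is_derive (fun t => k * (t - c)) t k) by (intros t; auto_derive; [exact I|ring]).
assert (C : forall t, is_derive (fun t => cosh (k * (t - c))) t (k * sinh (k * (t - c)))).
{ intros t. apply (is_derive_comp cosh (fun t => k * (t - c)) t); [|apply D].
  apply is_derive_Reals, derivable_pt_lim_cosh. }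
assert (S : forall t, is_derive (fun t => sinh (k * (t - c))) t (k * cosh (k * (t - c)))).
{ intros t. apply (is_derive_comp sinh (fun t => k * (t - c)) t); [|apply D].
  apply is_derive_Reals, derivable_pt_lim_sinh. }
exists (fun t => B * (k * sinh (k * (t - c)))). split.
- exists (mkposreal 1 Rlt_0_1). intros t _.
  replace (B * (k * sinh (k * (t - c)))) with (0 + B * (k * sinh (k * (t - c)))) by ring.
  apply (is_derive_plus (fun _ => A) (fun t => B * cosh (k * (t - c)))).
  + apply (is_derive_const (V := R_NormedModule) A).
  + apply (is_derive_scal (fun t => cosh (k * (t - c)))), C.
- replace (B * k ^ 2 * cosh (k * (x - c))) with (B * (k * (k * cosh (k * (x - c))))) by ring.
  apply (is_derive_scal (fun t => k * sinh (k * (t - c)))).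
  apply (is_derive_scal (fun t => sinh (k * (t - c)))), S.
Qed.

(** An elementary barrier with [Delta b = k^2 b] that grows in every direction. *)
Definition coshbar (k c1 c2 x y : R) := cosh (k * (x - c1)) + cosh (k * (y - c2)).

Lemma coshbar_lap k c1 c2 x y : lap_at (coshbar k c1 c2) x y (k ^ 2 * coshbar k c1 c2 x y).
Proof.
exists (1 * k ^ 2 * cosh (k * (x - c1))), (1 * k ^ 2 * cosh (k * (y - c2))). split; [|split].
- apply second_derive_ext with (fun t => cosh (k * (y - c2)) + 1 * cosh (k * (t - c1))); [intros t; unfold coshbar; ring|].
  apply cosh_affine_second.
- apply second_derive_ext with (fun t => cosh (k * (x - c1)) + 1 * cosh (k * (t - c2))); [intros t; unfold coshbar; ring|].
  apply cosh_affine_second.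
- unfold coshbar. ring.
Qed.

Lemma coshbar_cont k c1 c2 x y : continuity_2d_pt (coshbar k c1 c2) x y.
Proof.
assert (C : forall c z, continuity_pt (fun t => cosh (k * (t - c))) z).
{ intros c z. apply continuity_pt_filterlim.
  apply (ex_derive_continuous (fun t => cosh (k * (t - c)))).
  exists (k * sinh (k * (z - c))). apply (is_derive_comp cosh (fun t => k * (t - c)) z).
  - apply is_derive_Reals, derivable_pt_lim_cosh.
  - auto_derive; [exact I|ring]. }
apply (continuity_2d_pt_plus (fun u v => cosh (k * (u - c1))) (fun u v => cosh (k * (v - c2)))).
- apply (continuity_1d_2d_pt_comp (fun t => cosh (k * (t - c1))) (fun u _ => u)); [apply C|apply continuity_2d_pt_id1].
- apply (continuity_1d_2d_pt_comp (fun t => cosh (k * (t - c2))) (fun _ v => v)); [apply C|apply continuity_2d_pt_id2].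
Qed.

Lemma cosh_lower t : exp (Rabs t) / 2 <= cosh t.
Proof.
unfold cosh. unfold Rabs. destruct (Rcase_abs t).
- pose proof (exp_pos t). lra.
- pose proof (exp_pos (- t)). lra.
Qed.

Lemma cosh_pos t : 0 < cosh t.
Proof. pose proof (cosh_lower t). pose proof (exp_pos (Rabs t)). lra. Qed.

Lemma continuity_2d_lin f g c x y : continuity_2d_pt f x y -> continuity_2d_pt g x y ->
  continuity_2d_pt (fun u v => f u v + c * g u v) x y.
Proof.
intros Hf Hg. apply (continuity_2d_pt_plus f (fun u v => c * g u v)); [exact Hf|].
apply (continuity_2d_pt_mult (fun _ _ => c) g); [apply continuity_2d_pt_const|exact Hg].
Qed.

(** The signed distance to the side [theta = a] of the sector, positive towards the
    inside; the distance to the other side is [y]. *)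
Definition side_dist (a x y : R) := sin a * x - cos a * y.

Lemma side_dist_lip a x y u v : Rabs (side_dist a u v - side_dist a x y) <= Rabs (u - x) + Rabs (v - y).
Proof.
unfold side_dist.
replace (sin a * u - cos a * v - (sin a * x - cos a * y)) with (sin a * (u - x) + - (cos a * (v - y))) by ring.
eapply Rle_trans; [apply Rabs_triang|]. rewrite Rabs_Ropp, !Rabs_mult.
pose proof (proj2 weight_cos a). pose proof (proj2 weight_sin a).
pose proof (Rabs_pos (u - x)). pose proof (Rabs_pos (v - y)). nra.
Qed.

(** Adding [d (cosh x + cosh y)] to [w] forces the minimum to be attained, and keeps
    the differential inequality since [Delta cosh = cosh <= 4 cosh]; then [d -> 0]. *)
Lemma max_principle_sector a w M :
  (forall x y, continuity_2d_pt w x y) -> bdd M w ->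
  (forall x y, 0 <= y -> 0 <= side_dist a x y -> y = 0 \/ side_dist a x y = 0 -> 0 <= w x y) ->
  (forall x y, 0 < y -> 0 < side_dist a x y -> exists l, lap_at w x y l /\ (w x y < 0 -> l <= 4 * w x y)) ->
  forall x y, 0 <= y -> 0 <= side_dist a x y -> 0 <= w x y.
Proof.
intros Hc Hb Hbd Hin x0 y0 Hy0 Hd0.
pose proof (bdd_pos _ _ Hb) as HM.
set (psi := coshbar 1 0 0).
assert (Hpsi : forall x y, 0 < psi x y).
{ intros x y. unfold psi, coshbar. pose proof (cosh_pos (1 * (x - 0))). pose proof (cosh_pos (1 * (y - 0))). lra. }
assert (Hmain : forall d, 0 < d -> 0 <= w x0 y0 + d * psi x0 y0).
{ intros d Hd.
  (* large enough for the barrier to exceed M outside the square, which contains (x0, y0) *)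
  set (Rr := 2 * M / d + Rabs x0 + Rabs y0 + 1).
  pose proof (Rabs_pos x0). pose proof (Rabs_pos y0).
  assert (HMd : 0 <= 2 * M / d) by (apply Rle_div_r; lra).
  assert (HR0 : 0 < Rr) by (unfold Rr; lra).
  assert (HdR : 2 * M < d * Rr).
  { assert (E : d * (2 * M / d) = 2 * M) by (field; lra).
    assert (d * (2 * M / d) < d * Rr) by (apply Rmult_lt_compat_l; unfold Rr; lra). lra. }
  assert (Hfar : forall x y, Rabs x = Rr \/ Rabs y = Rr -> 0 < w x y + d * psi x y).
  { intros x y Hxy. specialize (Hb x y). apply Rabs_def2 in Hb || apply Rabs_le_between in Hb.
    assert (Rr / 2 <= psi x y).
    { unfold psi, coshbar. rewrite !Rminus_0_r, !Rmult_1_l.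
      pose proof (cosh_pos x). pose proof (cosh_pos y).
      pose proof (cosh_lower x). pose proof (cosh_lower y).
      pose proof (exp_ineq1_le (Rabs x)). pose proof (exp_ineq1_le (Rabs y)). destruct Hxy; lra. }
    assert (d * (Rr / 2) <= d * psi x y) by (apply Rmult_le_compat_l; lra). lra. }
  set (phi := fun x y => Rmin (Rmin y (side_dist a x y)) (box_dist 0 0 Rr x y)).
  assert (Hphi : forall x y, 0 <= phi x y <-> 0 <= y /\ 0 <= side_dist a x y /\ 0 <= box_dist 0 0 Rr x y).
  { intros x y. unfold phi, Rmin. repeat destruct (Rle_dec _ _); lra. }
  assert (Hphi' : forall x y, 0 < y -> 0 < side_dist a x y -> 0 < box_dist 0 0 Rr x y -> 0 < phi x y).
  { intros. unfold phi. apply Rmin_glb_lt; [apply Rmin_glb_lt|]; assumption. }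
  apply (max_principle_compact phi (fun x y => w x y + d * psi x y) Rr).
  - apply (lip_min (fun x y => Rmin y (side_dist a x y))); [|apply box_dist_lip].
    apply (lip_min (fun _ y => y)); intros x y x' y'; rewrite Rmult_1_l; [|apply side_dist_lip].
    pose proof (Rabs_pos (x - x')). lra.
  - intros x y H'. apply Hphi in H'. destruct H' as [_ [_ H']]. apply box_dist_ge in H'.
    rewrite !Rminus_0_r in H'. destruct H' as [H1 H2]. apply Rabs_le_between in H1. apply Rabs_le_between in H2. lra.
  - intros x y. apply continuity_2d_lin; [apply Hc|apply coshbar_cont].
  - intros x y HK Hneg. apply Hphi in HK. destruct HK as [K1 [K2 K3]].
    assert (Hdp : 0 < d * psi x y) by (apply Rmult_lt_0_compat; [exact Hd|apply Hpsi]).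
    assert (Hw : w x y < 0) by lra.
    assert (Hy : 0 < y).
    { destruct K1 as [|E]; [assumption|exfalso]. specialize (Hbd x y). lra. }
    assert (Hdd : 0 < side_dist a x y).
    { destruct K2 as [|E]; [assumption|exfalso]. specialize (Hbd x y). lra. }
    split.
    + apply Hphi'; [exact Hy|exact Hdd|]. destruct (box_dist_pos _ _ _ _ _ K3) as [K|K]; [exact K|exfalso].
      rewrite !Rminus_0_r in K. pose proof (Hfar x y K). lra.
    + destruct (Hin x y Hy Hdd) as [l [Hl Hle]]. specialize (Hle Hw).
      exists (l + d * (1 ^ 2 * psi x y)). split; [apply lap_lin; [exact Hl|apply coshbar_lap]|]. lra.
  - apply Hphi. split; [exact Hy0|split; [exact Hd0|]]. apply box_dist_ge. rewrite !Rminus_0_r.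
    unfold Rr. lra. }
apply Rnot_lt_le. intros Hneg. pose proof (Hpsi x0 y0) as Hp.
specialize (Hmain (- w x0 y0 / (2 * psi x0 y0)) ltac:(apply Rdiv_lt_0_compat; lra)).
replace (- w x0 y0 / (2 * psi x0 y0) * psi x0 y0) with (- w x0 y0 / 2) in Hmain by (field; lra). lra.
Qed.

(** * An explicit subsolution *)

Lemma C11_ext M f g f1 f2 : (forall x y, f x y = g x y) -> C11 M f f1 f2 -> C11 M g f1 f2.
Proof.
intros E [A0 A1 A2 L1 L2 D1 D2]. constructor; try assumption.
- intros x y. rewrite <- E. apply A0.
- intros x y. apply is_derive_ext with (2 := D1 x y). intros t. apply E.
- intros x y. apply is_derive_ext with (2 := D2 x y). intros t. apply E.
Qed.

Lemma C11_lin M M' f f1 f2 g g1 g2 c : C11 M f f1 f2 -> C11 M' g g1 g2 ->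
  C11 (M + Rabs c * M') (fun x y => f x y + c * g x y) (fun x y => f1 x y + c * g1 x y) (fun x y => f2 x y + c * g2 x y).
Proof.
intros [A0 A1 A2 L1 L2 D1 D2] [B0 B1 B2 K1 K2 E1 E2]. constructor.
- apply bdd_lin; assumption.
- apply bdd_lin; assumption.
- apply bdd_lin; assumption.
- apply lip_lin; assumption.
- apply lip_lin; assumption.
- intros x y. apply (is_derive_plus (fun t => f t y) (fun t => c * g t y)); [apply D1|].
  apply (is_derive_scal (fun t => g t y)), E1.
- intros x y. apply (is_derive_plus (fun t => f x t) (fun t => c * g x t)); [apply D2|].
  apply (is_derive_scal (fun t => g x t)), E2.
Qed.

Lemma bdd_mult m m' f g : bdd m f -> bdd m' g -> bdd (m * m') (fun x y => f x y * g x y).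
Proof. intros Hf Hg x y. rewrite Rabs_mult. apply Rmult_le_compat; auto using Rabs_pos. Qed.

Lemma lip_mult m m' L L' f g : bdd m f -> bdd m' g -> lip L f -> lip L' g ->
  lip (L * m' + m * L') (fun x y => f x y * g x y).
Proof.
intros Bf Bg Lf Lg x y x' y'.
replace (f x y * g x y - f x' y' * g x' y') with ((f x y - f x' y') * g x y + f x' y' * (g x y - g x' y')) by ring.
eapply Rle_trans; [apply Rabs_triang|]. rewrite !Rabs_mult, Rmult_plus_distr_r.
apply Rplus_le_compat.
- replace (L * m' * (Rabs (x - x') + Rabs (y - y'))) with (L * (Rabs (x - x') + Rabs (y - y')) * m') by ring.
  apply Rmult_le_compat; auto using Rabs_pos.
- rewrite Rmult_assoc. apply Rmult_le_compat; auto using Rabs_pos.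
Qed.

Lemma C11_mult M M' f f1 f2 g g1 g2 : C11 M f f1 f2 -> C11 M' g g1 g2 ->
  C11 (4 * M * M') (fun x y => f x y * g x y)
    (fun x y => f1 x y * g x y + f x y * g1 x y) (fun x y => f2 x y * g x y + f x y * g2 x y).
Proof.
intros H H'. pose proof (C11_lip H) as L0. pose proof (C11_lip H') as K0.
destruct H as [A0 A1 A2 L1 L2 D1 D2], H' as [B0 B1 B2 K1 K2 E1 E2].
pose proof (bdd_pos _ _ A0). pose proof (bdd_pos _ _ B0).
assert (HMM : 0 <= M * M') by (apply Rmult_le_pos; assumption).
constructor.
- apply bdd_weaken with (M * M'); [apply bdd_mult; assumption|lra].
- apply bdd_weaken with (M * M' + Rabs 1 * (M * M')); [|rewrite Rabs_R1; lra].
  intros x y. pose proof (bdd_lin _ _ _ _ 1 (bdd_mult _ _ _ _ A1 B0) (bdd_mult _ _ _ _ A0 B1) x y) as X.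
  cbv beta in X. rewrite Rmult_1_l in X. exact X.
- apply bdd_weaken with (M * M' + Rabs 1 * (M * M')); [|rewrite Rabs_R1; lra].
  intros x y. pose proof (bdd_lin _ _ _ _ 1 (bdd_mult _ _ _ _ A2 B0) (bdd_mult _ _ _ _ A0 B2) x y) as X.
  cbv beta in X. rewrite Rmult_1_l in X. exact X.
- apply lip_weaken with (M * M' + M * M' + Rabs 1 * (M * M' + M * M')); [|rewrite Rabs_R1; lra].
  intros x y x' y'. pose proof (lip_lin _ _ _ _ 1 (lip_mult _ _ _ _ _ _ A1 B0 L1 K0) (lip_mult _ _ _ _ _ _ A0 B1 L0 K1) x y x' y') as X.
  cbv beta in X. rewrite !(Rmult_1_l (f _ _ * _)) in X. exact X.
- apply lip_weaken with (M * M' + M * M' + Rabs 1 * (M * M' + M * M')); [|rewrite Rabs_R1; lra].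
  intros x y x' y'. pose proof (lip_lin _ _ _ _ 1 (lip_mult _ _ _ _ _ _ A2 B0 L2 K0) (lip_mult _ _ _ _ _ _ A0 B2 L0 K2) x y x' y') as X.
  cbv beta in X. rewrite !(Rmult_1_l (f _ _ * _)) in X. exact X.
- intros x y. apply (is_derive_mult (fun t => f t y) (fun t => g t y) x _ _ (D1 x y) (E1 x y) Rmult_comm).
- intros x y. apply (is_derive_mult (fun t => f x t) (fun t => g x t) y _ _ (D2 x y) (E2 x y) Rmult_comm).
Qed.

Definition rotate (b : R) (f : R -> R -> R) (x y : R) := f (cos b * x - sin b * y) (sin b * x + cos b * y).

Definition pos_part (s : R) : R := Rmax s 0.
Lemma pos_part_pos s : 0 <= s -> pos_part s = s. Proof. intros; apply Rmax_left; assumption. Qed.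

Lemma pos_part_neg s : s <= 0 -> pos_part s = 0. Proof. intros; apply Rmax_right; assumption. Qed.

Lemma glue_neg_der (g : R -> R) r : r < 0 -> is_derive (fun s => if Rle_dec s 0 then 0 else g s) r 0.
Proof.
intros Hr. apply is_derive_ext_loc with (fun _ => 0); [|apply (is_derive_const (V := R_NormedModule) 0)].
assert (Hr' : 0 < - r) by lra. exists (mkposreal _ Hr'). intros y Hy.
change (Rabs (y - r) < - r) in Hy. apply Rabs_def2 in Hy. destruct (Rle_dec y 0); [reflexivity|lra].
Qed.

Lemma pos_part_pow_glue n s : pos_part s ^ S n = if Rle_dec s 0 then 0 else s ^ S n.
Proof. destruct (Rle_dec s 0); [rewrite pos_part_neg by assumption; simpl; ring|rewrite pos_part_pos by lra; reflexivity]. Qed.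

Lemma pos_part_pow_der n s : is_derive (fun t => pos_part t ^ S (S n)) s (INR (S (S n)) * pos_part s ^ S n).
Proof.
apply is_derive_ext with (fun t => if Rle_dec t 0 then 0 else t ^ S (S n)).
{ intros t. symmetry. apply pos_part_pow_glue. }
rewrite pos_part_pow_glue.
destruct (Rtotal_order s 0) as [H|[->|H]].
- destruct (Rle_dec s 0); [|lra]. rewrite Rmult_0_r. apply glue_neg_der, H.
- destruct (Rle_dec 0 0); [|lra]. rewrite Rmult_0_r. apply (glue_0_der 0 (fun t => t ^ S (S n))).
  intros eps He. exists (Rmin 1 eps). split; [apply Rmin_glb_lt; lra|]. intros v Hv.
  pose proof (Rmin_l 1 eps). pose proof (Rmin_r 1 eps).
  rewrite Rminus_0_r, Rabs_right by (apply Rle_ge, pow_le; lra).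
  assert (v ^ n <= 1) by (rewrite <- (pow1 n); apply pow_incr; lra).
  assert (0 <= v ^ n) by (apply pow_le; lra). simpl.
  assert (v * v ^ n <= eps) by nra. nra.
- destruct (Rle_dec s 0); [lra|]. apply (glue_pos 0 (fun t => t ^ S (S n))); [exact H|].
  auto_derive; [exact I|]. change (1 * (INR (S (S n)) * s ^ S n) = INR (S (S n)) * s ^ S n). ring.
Qed.

(** A primitive of the quadratic B-spline with nodes 0, 1, 2, 3: of class C^2, equal to 0
    before 0 and to 1 after 3. *)
Definition step (s : R) := (pos_part s ^ 3 - 3 * pos_part (s - 1) ^ 3 + 3 * pos_part (s - 2) ^ 3 - pos_part (s - 3) ^ 3) / 6.
Definition step_d1 (s : R) := (pos_part s ^ 2 - 3 * pos_part (s - 1) ^ 2 + 3 * pos_part (s - 2) ^ 2 - pos_part (s - 3) ^ 2) / 2.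
Definition step_d2 (s : R) := pos_part s - 3 * pos_part (s - 1) + 3 * pos_part (s - 2) - pos_part (s - 3).

Lemma pos_part_shift_der n c s : is_derive (fun t => pos_part (t - c) ^ S (S n)) s (INR (S (S n)) * pos_part (s - c) ^ S n).
Proof.
pose proof (is_derive_comp (fun t => pos_part t ^ S (S n)) (fun t => t - c) s _ 1 (pos_part_pow_der n (s - c))) as H.
assert (D : is_derive (fun t => t - c) s 1) by (auto_derive; [exact I|ring]).
specialize (H D). apply (is_derive_eq H).
apply Rmult_1_l.
Qed.

Lemma comb_der f0 f1 f2 f3 a0 a1 a2 a3 c s : is_derive f0 s a0 -> is_derive f1 s a1 -> is_derive f2 s a2 -> is_derive f3 s a3 ->
  is_derive (fun t => (f0 t - 3 * f1 t + 3 * f2 t - f3 t) / c) s ((a0 - 3 * a1 + 3 * a2 - a3) / c).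
Proof.
intros H0 H1 H2 H3.
apply is_derive_ext with (fun t => / c * (f0 t - 3 * f1 t + 3 * f2 t - f3 t)).
{ intros t. apply Rmult_comm. }
unfold Rdiv. rewrite Rmult_comm.
apply (is_derive_scal (fun t => f0 t - 3 * f1 t + 3 * f2 t - f3 t)).
apply (is_derive_minus (fun t => f0 t - 3 * f1 t + 3 * f2 t) f3); [|exact H3].
apply (is_derive_plus (fun t => f0 t - 3 * f1 t) (fun t => 3 * f2 t)); [|apply (is_derive_scal f2); exact H2].
apply (is_derive_minus f0 (fun t => 3 * f1 t)); [exact H0|apply (is_derive_scal f1); exact H1].
Qed.

Lemma step_der s : is_derive step s (step_d1 s).
Proof.
pose proof (comb_der _ _ _ _ _ _ _ _ 6 s (pos_part_pow_der 1 s) (pos_part_shift_der 1 1 s) (pos_part_shift_der 1 2 s) (pos_part_shift_der 1 3 s)) as H.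
apply (is_derive_eq H). unfold step_d1. simpl INR. field.
Qed.

Lemma step_d1_der s : is_derive step_d1 s (step_d2 s).
Proof.
pose proof (comb_der _ _ _ _ _ _ _ _ 2 s (pos_part_pow_der 0 s) (pos_part_shift_der 0 1 s) (pos_part_shift_der 0 2 s) (pos_part_shift_der 0 3 s)) as H.
apply (is_derive_eq H). unfold step_d2. simpl INR. field.
Qed.

(** The pieces are expressed in the variable that makes the bounds below evident:
    [1 + t] on [[1, 2]] and [3 - r] on [[2, 3]]. *)
Lemma step_cases (P : R -> R -> R -> R -> Prop) :
  (forall s, s <= 0 -> P s 0 0 0) ->
  (forall s, 0 <= s <= 1 -> P s (s ^ 3 / 6) (s ^ 2 / 2) s) ->
  (forall t, 0 <= t <= 1 -> P (1 + t) ((1 + 3 * t + 3 * t ^ 2 - 2 * t ^ 3) / 6) ((1 + 2 * t - 2 * t ^ 2) / 2) (1 - 2 * t)) ->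
  (forall r, 0 <= r <= 1 -> P (3 - r) (1 - r ^ 3 / 6) (r ^ 2 / 2) (- r)) ->
  (forall s, 3 <= s -> P s 1 0 0) -> forall s, P s (step s) (step_d1 s) (step_d2 s).
Proof.
intros H0 H1 H2 H3 H4 s.
destruct (Rle_dec s 0) as [C0|C0].
{ assert (E : step s = 0 /\ step_d1 s = 0 /\ step_d2 s = 0).
  { unfold step, step_d1, step_d2. rewrite !pos_part_neg by lra. repeat split; field. }
  destruct E as [-> [-> ->]]. apply H0, C0. }
destruct (Rle_dec s 1) as [C1|C1].
{ assert (E : step s = s ^ 3 / 6 /\ step_d1 s = s ^ 2 / 2 /\ step_d2 s = s).
  { unfold step, step_d1, step_d2. rewrite (pos_part_pos s), !pos_part_neg by lra. repeat split; field. }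
  destruct E as [-> [-> ->]]. apply H1. lra. }
destruct (Rle_dec s 2) as [C2|C2].
{ specialize (H2 (s - 1) ltac:(lra)). replace (1 + (s - 1)) with s in H2 by ring.
  assert (E : step s = (1 + 3 * (s - 1) + 3 * (s - 1) ^ 2 - 2 * (s - 1) ^ 3) / 6 /\
     step_d1 s = (1 + 2 * (s - 1) - 2 * (s - 1) ^ 2) / 2 /\ step_d2 s = 1 - 2 * (s - 1)).
  { unfold step, step_d1, step_d2. rewrite (pos_part_pos s), (pos_part_pos (s - 1)), !pos_part_neg by lra. repeat split; field. }
  destruct E as [-> [-> ->]]. exact H2. }
destruct (Rle_dec s 3) as [C3|C3].
{ specialize (H3 (3 - s) ltac:(lra)). replace (3 - (3 - s)) with s in H3 by ring.
  assert (E : step s = 1 - (3 - s) ^ 3 / 6 /\ step_d1 s = (3 - s) ^ 2 / 2 /\ step_d2 s = - (3 - s)).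
  { unfold step, step_d1, step_d2. rewrite (pos_part_pos s), (pos_part_pos (s - 1)), (pos_part_pos (s - 2)), !pos_part_neg by lra. repeat split; field. }
  destruct E as [-> [-> ->]]. exact H3. }
assert (E : step s = 1 /\ step_d1 s = 0 /\ step_d2 s = 0).
{ unfold step, step_d1, step_d2. rewrite !pos_part_pos by lra. repeat split; field. }
destruct E as [-> [-> ->]]. apply H4. lra.
Qed.

(** The decisive bound is [- 2 p <= p''] for [p = step]: where p is concave it is already
    at least 1/2, whereas [p''] is at least -1. *)
Lemma step_bounds s : 0 <= step s <= 1 /\ 0 <= step_d1 s <= 1 /\ -1 <= step_d2 s <= 1 /\ - 2 * step s <= step_d2 s.
Proof.
apply (step_cases (fun _ a b c => 0 <= a <= 1 /\ 0 <= b <= 1 /\ -1 <= c <= 1 /\ - 2 * a <= c)).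
- intros; lra.
- intros t Ht. assert (0 <= t ^ 2 <= 1) by nra. assert (0 <= t ^ 3 <= 1) by (simpl; nra). lra.
- intros t Ht. assert (0 <= t ^ 2 <= t) by nra. assert (0 <= t ^ 3 <= t ^ 2) by (simpl; nra). nra.
- intros t Ht. assert (0 <= t ^ 2 <= t) by nra. assert (0 <= t ^ 3 <= t ^ 2) by (simpl; nra). lra.
- intros; lra.
Qed.

Lemma step_zero s : s <= 0 -> step s = 0.
Proof. intros H. unfold step. rewrite !pos_part_neg by lra. field. Qed.

Lemma step_one s : 3 <= s -> step s = 1 /\ step_d1 s = 0.
Proof. intros H. unfold step, step_d1. rewrite !pos_part_pos by lra. split; field. Qed.

Lemma step_d1_lip s t : Rabs (step_d1 s - step_d1 t) <= 1 * Rabs (s - t).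
Proof. apply (lip_1d_deriv step_d1 step_d2); [apply step_d1_der|]. intros u. pose proof (step_bounds u). apply Rabs_le. lra. Qed.

Lemma C11_ridge a b c : Rabs a <= 1 -> Rabs b <= 1 ->
  C11 1 (fun x y => step (a * x + b * y + c)) (fun x y => a * step_d1 (a * x + b * y + c)) (fun x y => b * step_d1 (a * x + b * y + c)).
Proof.
intros Ha Hb.
assert (GB : forall e, Rabs e <= 1 -> bdd 1 (fun x y => e * step_d1 (a * x + b * y + c))).
{ intros e He x y. rewrite Rabs_mult. pose proof (step_bounds (a * x + b * y + c)) as [_ [Q _]].
  rewrite (Rabs_right (step_d1 _)) by lra. pose proof (Rabs_pos e). nra. }
assert (GL : forall e, Rabs e <= 1 -> lip 1 (fun x y => e * step_d1 (a * x + b * y + c))).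
{ intros e He x y x' y'. rewrite <- Rmult_minus_distr_l, Rabs_mult.
  pose proof (step_d1_lip (a * x + b * y + c) (a * x' + b * y' + c)) as Q.
  replace (a * x + b * y + c - (a * x' + b * y' + c)) with (a * (x - x') + b * (y - y')) in Q by ring.
  pose proof (Rabs_triang (a * (x - x')) (b * (y - y'))) as T. rewrite !Rabs_mult in T.
  pose proof (Rmult_le_compat_r _ _ _ (Rabs_pos (x - x')) Ha).
  pose proof (Rmult_le_compat_r _ _ _ (Rabs_pos (y - y')) Hb).
  pose proof (Rmult_le_compat_r _ _ _ (Rabs_pos (step_d1 (a * x + b * y + c) - step_d1 (a * x' + b * y' + c))) He). lra. }
constructor; auto.
- intros x y. pose proof (step_bounds (a * x + b * y + c)). apply Rabs_le. lra.
- intros x y.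
  assert (D : is_derive (fun t => a * t + b * y + c) x a) by (auto_derive; [exact I|ring]).
  apply (is_derive_comp step (fun t => a * t + b * y + c) x _ _ (step_der _) D).
- intros x y.
  assert (D : is_derive (fun t => a * x + b * t + c) y b) by (auto_derive; [exact I|ring]).
  apply (is_derive_comp step (fun t => a * x + b * t + c) y _ _ (step_der _) D).
Qed.

(** The product of three cut-offs, written with affine arguments so that both partial
    second derivatives have the same shape; [bump_eq] is the readable form.  The
    scale 1/3 makes the second derivatives small compared with the value.  The
    first two factors vanish on the sides.  The third one vanishes where the sum of
    the distances to the sides is at most 18: it removes the corner, where the first
    two would not give a subsolution if the angle is acute. *)
Definition bump (a x y : R) : R :=
  1 / 2 * (step (0 * x + / 3 * y + 0) * step (sin a / 3 * x + - cos a / 3 * y + 0) *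
           step (sin a / 6 * x + (1 - cos a) / 6 * y + -3)).

Lemma bump_args a x y : 0 * x + / 3 * y + 0 = y / 3 /\ sin a / 3 * x + - cos a / 3 * y + 0 = side_dist a x y / 3 /\
  sin a / 6 * x + (1 - cos a) / 6 * y + -3 = (y + side_dist a x y) / 6 - 3.
Proof. unfold side_dist. repeat split; field. Qed.

Lemma bump_eq a x y : bump a x y = 1 / 2 * (step (y / 3) * step (side_dist a x y / 3) * step ((y + side_dist a x y) / 6 - 3)).
Proof. unfold bump. destruct (bump_args a x y) as [-> [-> ->]]. reflexivity. Qed.

Lemma bump_bounds a x y : 0 <= bump a x y <= 1 / 2.
Proof.
rewrite bump_eq. set (A := y / 3). set (B := side_dist a x y / 3). set (C := (y + side_dist a x y) / 6 - 3).
pose proof (step_bounds A) as [HA _]. pose proof (step_bounds B) as [HB _]. pose proof (step_bounds C) as [HC _].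
assert (0 <= step A * step B <= 1) by nra. assert (0 <= step A * step B * step C <= 1) by nra. lra.
Qed.

Lemma bump_zero a x y : y <= 0 \/ side_dist a x y <= 0 -> bump a x y = 0.
Proof.
rewrite bump_eq. intros [H|H].
- rewrite (step_zero (y / 3)) by lra. ring.
- rewrite (step_zero (side_dist a x y / 3)) by lra. ring.
Qed.

Lemma bump_far a x y : 18 <= y -> 18 <= side_dist a x y -> bump a x y = 1 / 2.
Proof.
intros H1 H2. rewrite bump_eq. rewrite !(fun s H => proj1 (step_one s H)) by lra. ring.
Qed.

Lemma C11_ridge3 a1 b1 c1 a2 b2 c2 a3 b3 c3 : Rabs a1 <= 1 -> Rabs b1 <= 1 -> Rabs a2 <= 1 -> Rabs b2 <= 1 ->
  Rabs a3 <= 1 -> Rabs b3 <= 1 -> exists M f1 f2,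
  C11 M (fun x y => 1 / 2 * (step (a1 * x + b1 * y + c1) * step (a2 * x + b2 * y + c2) * step (a3 * x + b3 * y + c3))) f1 f2.
Proof.
intros A1 B1 A2 B2 A3 B3.
pose proof (C11_mult _ _ _ _ _ _ _ _ (C11_mult _ _ _ _ _ _ _ _ (C11_ridge a1 b1 c1 A1 B1) (C11_ridge a2 b2 c2 A2 B2))
  (C11_ridge a3 b3 c3 A3 B3)) as R.
pose proof (C11_lin _ _ _ _ _ _ _ _ (-1 / 2) R R) as H. eexists _, _, _.
eapply C11_ext; [|exact H]. intros x y. cbv beta. field.
Qed.

(** A rotation only changes the coefficients of the three affine arguments. *)
Lemma rotate_bump_C11 b a : exists M f1 f2, C11 M (rotate b (bump a)) f1 f2.
Proof.
pose proof (COS_bound a) as HC. pose proof (SIN_bound a) as HS.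
pose proof (COS_bound b) as HCb. pose proof (SIN_bound b) as HSb.
destruct (C11_ridge3 (sin b / 3) (cos b / 3) 0
  ((sin a * cos b - cos a * sin b) / 3) (- (sin a * sin b + cos a * cos b) / 3) 0
  ((sin a * cos b + (1 - cos a) * sin b) / 6) (((1 - cos a) * cos b - sin a * sin b) / 6) (-3)) as [M [f1 [f2 H]]];
  try (apply Rabs_le; nra).
exists M, f1, f2. eapply C11_ext; [|exact H]. intros x y. unfold rotate, bump.
f_equal. f_equal; [f_equal|]; f_equal; field.
Qed.

Lemma bump_C11 a : exists M f1 f2, C11 M (bump a) f1 f2.
Proof.
destruct (rotate_bump_C11 0 a) as [M [f1 [f2 H]]]. exists M, f1, f2.
eapply C11_ext; [|exact H]. intros x y. unfold rotate. rewrite cos_0, sin_0. f_equal; ring.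
Qed.

Lemma prod3_der (f g h : R -> R) f' g' h' c x : is_derive f x f' -> is_derive g x g' -> is_derive h x h' ->
  is_derive (fun t => c * (f t * g t * h t)) x (c * (f' * g x * h x + f x * g' * h x + f x * g x * h')).
Proof.
intros Hf Hg Hh. apply (is_derive_scal (fun t => f t * g t * h t)).
pose proof (is_derive_mult _ _ x _ _ (is_derive_mult f g x _ _ Hf Hg Rmult_comm) Hh Rmult_comm) as H.
apply (is_derive_eq H). unfold_alg. ring.
Qed.

Lemma prod3_second (a1 b1 a2 b2 a3 b3 c x : R) :
  let A := step (a1 * x + b1) in let B := step (a2 * x + b2) in let C := step (a3 * x + b3) in
  let A1 := step_d1 (a1 * x + b1) in let B1 := step_d1 (a2 * x + b2) in let C1 := step_d1 (a3 * x + b3) in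
  let A2 := step_d2 (a1 * x + b1) in let B2 := step_d2 (a2 * x + b2) in let C2 := step_d2 (a3 * x + b3) in
  second_derive (fun t => c * (step (a1 * t + b1) * step (a2 * t + b2) * step (a3 * t + b3))) x
   (c * (a1 ^ 2 * (A2 * B * C) + a2 ^ 2 * (A * B2 * C) + a3 ^ 2 * (A * B * C2)
     + 2 * (a1 * a2 * (A1 * B1 * C) + a1 * a3 * (A1 * B * C1) + a2 * a3 * (A * B1 * C1)))).
Proof.
intros A B C A1 B1 C1 A2 B2 C2.
assert (Dq : forall a b t, is_derive (fun t => step (a * t + b)) t (a * step_d1 (a * t + b))).
{ intros a b t. assert (D : is_derive (fun t => a * t + b) t a) by (auto_derive; [exact I|ring]).
  apply (is_derive_comp step (fun t => a * t + b) t _ _ (step_der _) D). }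
assert (Dq1 : forall a b t, is_derive (fun t => a * step_d1 (a * t + b)) t (a * (a * step_d2 (a * t + b)))).
{ intros a b t. apply (is_derive_scal (fun t => step_d1 (a * t + b))).
  assert (D : is_derive (fun t => a * t + b) t a) by (auto_derive; [exact I|ring]).
  apply (is_derive_comp step_d1 (fun t => a * t + b) t _ _ (step_d1_der _) D). }
exists (fun t => c * (a1 * step_d1 (a1 * t + b1) * step (a2 * t + b2) * step (a3 * t + b3)) +
   (c * (step (a1 * t + b1) * (a2 * step_d1 (a2 * t + b2)) * step (a3 * t + b3)) +
    c * (step (a1 * t + b1) * step (a2 * t + b2) * (a3 * step_d1 (a3 * t + b3))))). split.
- exists (mkposreal 1 Rlt_0_1). intros t _.
  pose proof (prod3_der _ _ _ _ _ _ c t (Dq a1 b1 t) (Dq a2 b2 t) (Dq a3 b3 t)) as H.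
  apply (is_derive_eq H). ring.
- pose proof (prod3_der _ _ _ _ _ _ c x (Dq1 a1 b1 x) (Dq a2 b2 x) (Dq a3 b3 x)) as H1.
  pose proof (prod3_der _ _ _ _ _ _ c x (Dq a1 b1 x) (Dq1 a2 b2 x) (Dq a3 b3 x)) as H2.
  pose proof (prod3_der _ _ _ _ _ _ c x (Dq a1 b1 x) (Dq a2 b2 x) (Dq1 a3 b3 x)) as H3.
  pose proof (is_derive_plus _ _ x _ _ H1 (is_derive_plus _ _ x _ _ H2 H3)) as H.
  apply (is_derive_eq H). unfold plus; simpl.
  unfold A, B, C, A1, B1, C1, A2, B2, C2. ring.
Qed.

(** The mixed terms have the sign of the scalar products of the gradients of the
    three arguments.  Those with the third one are nonnegative.  The one between the
    two sides may be negative, but where the third factor is positive one of the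
    distances exceeds 9, hence the derivative of its cut-off is zero.  The pure terms
    are at least [- (2/9) v] each, so [Delta v >= - (2/3) v], and [v <= 1/2] absorbs
    the cubic term. *)
Lemma bump_sub a x y : exists l, lap_at (bump a) x y l /\ bump a x y ^ 3 - bump a x y <= l.
Proof.
set (A := y / 3). set (B := side_dist a x y / 3). set (C := (y + side_dist a x y) / 6 - 3).
pose proof (bump_args a x y) as [EA [EB EC]]. fold A in EA. fold B in EB. fold C in EC.
pose proof (prod3_second 0 (/ 3 * y + 0) (sin a / 3) (- cos a / 3 * y + 0) (sin a / 6) ((1 - cos a) / 6 * y + -3) (1 / 2) x) as H1.
pose proof (prod3_second (/ 3) (0 * x + 0) (- cos a / 3) (sin a / 3 * x + 0) ((1 - cos a) / 6) (sin a / 6 * x + -3) (1 / 2) y) as H2.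
cbv zeta in H1, H2.
replace (0 * x + (/ 3 * y + 0)) with A in H1 by (rewrite <- EA; ring).
replace (sin a / 3 * x + (- cos a / 3 * y + 0)) with B in H1 by (rewrite <- EB; ring).
replace (sin a / 6 * x + ((1 - cos a) / 6 * y + -3)) with C in H1 by (rewrite <- EC; ring).
replace (/ 3 * y + (0 * x + 0)) with A in H2 by (rewrite <- EA; ring).
replace (- cos a / 3 * y + (sin a / 3 * x + 0)) with B in H2 by (rewrite <- EB; ring).
replace ((1 - cos a) / 6 * y + (sin a / 6 * x + -3)) with C in H2 by (rewrite <- EC; ring).
eexists. split.
- eexists _, _. split; [|split; [|reflexivity]].
  + eapply second_derive_ext; [|exact H1]. intros t. unfold bump. f_equal. f_equal; [f_equal|]; f_equal; ring.
  + eapply second_derive_ext; [|exact H2]. intros t. unfold bump. f_equal. f_equal; [f_equal|]; f_equal; ring.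
- rewrite bump_eq. fold A B C.
  pose proof (step_bounds A) as [QA [QA1 [_ QA2]]]. pose proof (step_bounds B) as [QB [QB1 [_ QB2]]].
  pose proof (step_bounds C) as [QC [QC1 [_ QC2]]].
  assert (HZ : step_d1 A * step_d1 B * step C = 0).
  { destruct (Rle_dec C 0) as [HC|HC]; [rewrite (step_zero C HC); ring|].
    destruct (Rle_dec 3 A) as [HA|HA]; [rewrite (proj2 (step_one A HA)); ring|].
    destruct (Rle_dec 3 B) as [HB|HB]; [rewrite (proj2 (step_one B HB)); ring|].
    exfalso. unfold A, B, C in *. lra. }
  pose proof (sin2_cos2 a) as HS. unfold Rsqr in HS. pose proof (COS_bound a) as HCb.
  set (P := step A * step B * step C).
  assert (HP : 0 <= P <= 1).
  { unfold P. assert (0 <= step A * step B <= 1) by nra. nra. }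
  assert (T1 : - 2 * P <= step_d2 A * step B * step C).
  { unfold P. assert (0 <= step B * step C) by nra. nra. }
  assert (T2 : - 2 * P <= step A * step_d2 B * step C).
  { unfold P. assert (0 <= step A * step C) by nra. nra. }
  assert (T3 : - 2 * P <= step A * step B * step_d2 C).
  { unfold P. assert (0 <= step A * step B) by nra. nra. }
  assert (T4 : 0 <= step_d1 A * step B * step_d1 C) by (apply Rmult_le_pos; [apply Rmult_le_pos|]; lra).
  assert (T5 : 0 <= step A * step_d1 B * step_d1 C) by (apply Rmult_le_pos; [apply Rmult_le_pos|]; lra).
  match goal with |- _ <= ?X => replace X with (1 / 2 * (1 / 9 * (step_d2 A * step B * step C) +
     (sin a * sin a + cos a * cos a) / 9 * (step A * step_d2 B * step C) +
     ((sin a * sin a + cos a * cos a) + 1 - 2 * cos a) / 36 * (step A * step B * step_d2 C) +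
     2 * (- cos a / 9 * (step_d1 A * step_d1 B * step C) + (1 - cos a) / 18 * (step_d1 A * step B * step_d1 C) +
       ((sin a * sin a + cos a * cos a) - cos a) / 18 * (step A * step_d1 B * step_d1 C)))) by field end.
  rewrite HS, HZ. fold P.
  assert (T6 : 0 <= (1 - cos a) / 18 * (step_d1 A * step B * step_d1 C)) by (apply Rmult_le_pos; lra).
  assert (T7 : 0 <= (1 - cos a) / 18 * (step A * step_d1 B * step_d1 C)) by (apply Rmult_le_pos; lra).
  assert (T8 : - (2 / 9) * P <= (1 + 1 - 2 * cos a) / 36 * (step A * step B * step_d2 C)).
  { assert (E : 0 <= (1 + 1 - 2 * cos a) / 36 <= 1 / 9) by lra.
    set (cc := (1 + 1 - 2 * cos a) / 36) in *. nra. }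
  assert (T9 : (1 / 2 * P) ^ 3 <= 1 / 4 * (1 / 2 * P)).
  { assert (P * P <= 1) by nra. simpl. nra. }
  lra.
Qed.

(** * Monotone iteration in the sector *)

Definition sector (a x y : R) := 0 <= y /\ 0 <= side_dist a x y.

Lemma polar_upper x y : 0 <= y -> exists r t, 0 <= r /\ 0 <= t <= PI /\ x = r * cos t /\ y = r * sin t.
Proof.
intros Hy. set (r := sqrt (x ^ 2 + y ^ 2)).
assert (Hs : 0 <= x ^ 2 + y ^ 2) by nra.
assert (Hr2 : r * r = x ^ 2 + y ^ 2) by (apply sqrt_sqrt, Hs).
assert (Hr0 : 0 <= r) by apply sqrt_pos.
pose proof PI_RGT_0 as HP.
destruct Hr0 as [Hr|Hr].
- assert (Hc : -1 <= x / r <= 1).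
  { split; [apply Rle_div_r|apply Rle_div_l]; nra. }
  exists r, (acos (x / r)). pose proof (acos_bound (x / r)) as HA.
  split; [lra|]. split; [exact HA|]. split.
  + rewrite cos_acos by exact Hc. field. lra.
  + rewrite sin_acos by exact Hc.
    replace (1 - Rsqr (x / r)) with (Rsqr (y / r)).
    * rewrite sqrt_Rsqr; [field; lra|]. apply Rle_div_r; lra.
    * unfold Rsqr. replace (1 - x / r * (x / r)) with ((r * r - x ^ 2) / (r * r)) by (field; lra).
      rewrite Hr2. replace (x ^ 2 + y ^ 2 - x ^ 2) with (y * y) by ring. rewrite <- Hr2. field. lra.
- exists 0, 0. rewrite <- Hr in Hr2. split; [lra|]. split; [lra|]. split; nra.
Qed.

Lemma polar_all x y : exists r t, 0 <= r /\ 0 <= t <= 2 * PI /\ x = r * cos t /\ y = r * sin t.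
Proof.
destruct (Rle_dec 0 y) as [H|H].
- destruct (polar_upper x y H) as [r [t [H1 [H2 H3]]]]. exists r, t. split; [exact H1|]. split; [lra|exact H3].
- destruct (polar_upper x (- y) ltac:(lra)) as [r [t [H1 [H2 [H3 H4]]]]].
  exists r, (2 * PI - t). split; [exact H1|]. split; [lra|].
  rewrite cos_minus, sin_minus, cos_2PI, sin_2PI. split; lra.
Qed.

Lemma side_dist_polar a r t : side_dist a (r * cos t) (r * sin t) = r * sin (a - t).
Proof. unfold side_dist. rewrite sin_minus. ring. Qed.

Lemma sector_polar a x y : 0 < a <= PI -> sector a x y ->
  exists r t, 0 <= r /\ 0 <= t <= a /\ x = r * cos t /\ y = r * sin t.
Proof.
intros Ha [Hy Hd]. destruct (polar_upper x y Hy) as [r [t [Hr [Ht [-> ->]]]]].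
rewrite side_dist_polar in Hd.
destruct Hr as [Hr|<-].
- exists r, t. split; [lra|]. split; [|split; reflexivity]. split; [lra|].
  apply Rnot_lt_le. intros Hlt.
  assert (0 < sin (t - a)) by (apply sin_gt_0; lra).
  replace (a - t) with (- (t - a)) in Hd by ring. rewrite sin_neg in Hd. nra.
- exists 0, 0. rewrite !Rmult_0_l. split; [lra|]. split; [lra|]. split; reflexivity.
Qed.

Section angle.
Variable h : nat.
Hypothesis Hh : (1 <= h)%nat.
Let a := PI / INR h.

Lemma angle_bounds : 0 < a <= PI.
Proof.
assert (H1 : 1 <= INR h) by (apply (le_INR 1); exact Hh). pose proof PI_RGT_0 as HP. unfold a. split.
- apply Rdiv_lt_0_compat; lra.
- apply Rle_div_l; nra.
Qed.

Lemma angle_mult : INR h * a = PI.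
Proof. assert (H1 : 1 <= INR h) by (apply (le_INR 1); exact Hh). unfold a. field. lra. Qed.

(** The successive rotations of the sector cover the plane, so an equivariant
    property has to be checked in the sector only. *)
Lemma cover (P : R -> R -> Prop) : (forall x y, sector a x y -> P x y) ->
  (forall x y, P x y -> P (cos a * x - sin a * y) (sin a * x + cos a * y)) -> forall x y, P x y.
Proof.
intros HS HR. pose proof angle_bounds as Ha. pose proof angle_mult as Hm.
assert (H : forall j r t, 0 <= r -> 0 <= t <= INR (S j) * a -> P (r * cos t) (r * sin t)).
{ induction j as [|j IH]; intros r t Hr Ht.
  - simpl in Ht. apply HS. split.
    + apply Rmult_le_pos; [exact Hr|]. apply sin_ge_0; lra.
    + rewrite side_dist_polar. apply Rmult_le_pos; [exact Hr|]. apply sin_ge_0; lra.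
  - destruct (Rle_dec t (INR (S j) * a)) as [C|C]; [apply IH; lra|].
    assert (E1 : r * cos t = cos a * (r * cos (t - a)) - sin a * (r * sin (t - a))).
    { replace t with (a + (t - a)) at 1 by ring. rewrite cos_plus. ring. }
    assert (E2 : r * sin t = sin a * (r * cos (t - a)) + cos a * (r * sin (t - a))).
    { replace t with (a + (t - a)) at 1 by ring. rewrite sin_plus. ring. }
    rewrite E1, E2. apply HR, IH; [exact Hr|]. rewrite (S_INR (S j)) in Ht.
    assert (a <= INR (S j) * a). { rewrite S_INR. pose proof (pos_INR j). nra. } lra. }
intros x y. destruct (polar_all x y) as [r [t [Hr [Ht [-> ->]]]]].
apply (H (2 * h - 1)%nat); [exact Hr|].
replace (S (2 * h - 1)) with (2 * h)%nat by lia. rewrite mult_INR. simpl (INR 2). lra.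
Qed.

(** The bump moved to the [j]-th sector; [seed] is the alternating sum over all
    [2 h] sectors. *)
Definition rotated_bump (j : nat) : R -> R -> R := rotate (- (INR j * a)) (bump a).
Fixpoint alt_sum (n : nat) (x y : R) : R :=
  match n with O => 0 | S k => alt_sum k x y + (-1) ^ k * rotated_bump k x y end.
Lemma alt_sum_S k x y : alt_sum (S k) x y = alt_sum k x y + (-1) ^ k * rotated_bump k x y.
Proof. reflexivity. Qed.

Definition seed : R -> R -> R := alt_sum (2 * h).

Lemma rotate_rotf b c f x y : rotate b f (cos c * x - sin c * y) (sin c * x + cos c * y) = rotate (b + c) f x y.
Proof. unfold rotate. rewrite cos_plus, sin_plus. f_equal; ring. Qed.

Lemma rotated_bump_S j x y : rotated_bump (S j) (cos a * x - sin a * y) (sin a * x + cos a * y) = rotated_bump j x y.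
Proof. unfold rotated_bump. rewrite rotate_rotf. f_equal. rewrite S_INR. ring. Qed.

Lemma rotated_bump_0 x y : rotated_bump 0 (cos a * x - sin a * y) (sin a * x + cos a * y) = rotated_bump (2 * h - 1) x y.
Proof.
unfold rotated_bump. rewrite rotate_rotf. unfold rotate.
assert (E : - (INR (2 * h - 1) * a) = - (INR 0 * a) + a - 2 * PI).
{ rewrite minus_INR by lia. rewrite mult_INR. simpl. rewrite <- angle_mult. ring. }
rewrite E. unfold Rminus at 3 4 5 6.
assert (P1 : forall t, cos (t + - (2 * PI)) = cos t).
{ intros t. rewrite cos_plus, cos_neg, sin_neg, cos_2PI, sin_2PI. ring. }
assert (P2 : forall t, sin (t + - (2 * PI)) = sin t).
{ intros t. rewrite sin_plus, cos_neg, sin_neg, cos_2PI, sin_2PI. ring. }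
unfold Rminus. rewrite !P1, !P2. reflexivity.
Qed.

(** A rotation shifts the index of the sum by one; the term that leaves at one end
    re-enters at the other, and the number of terms is even. *)
Lemma seed_rot : rot_odd a seed.
Proof.
intros x y.
assert (H : forall n, alt_sum (S n) (cos a * x - sin a * y) (sin a * x + cos a * y) =
  rotated_bump (2 * h - 1) x y - alt_sum n x y).
{ induction n as [|n IH].
  - simpl alt_sum. rewrite rotated_bump_0. ring.
  - change (alt_sum (S (S n)) (cos a * x - sin a * y) (sin a * x + cos a * y)) with
      (alt_sum (S n) (cos a * x - sin a * y) (sin a * x + cos a * y) +
       (-1) ^ (S n) * rotated_bump (S n) (cos a * x - sin a * y) (sin a * x + cos a * y)).
    rewrite IH, rotated_bump_S. simpl. ring. }
unfold seed. replace (2 * h)%nat with (S (2 * h - 1)) by lia. rewrite H.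
replace (S (2 * h - 1) - 1)%nat with (2 * h - 1)%nat by lia. rewrite alt_sum_S.
assert (E : (-1) ^ (2 * h - 1) = -1).
{ replace (2 * h - 1)%nat with (S (2 * (h - 1))) by lia. apply pow_1_odd. }
rewrite E. ring.
Qed.

(** The other bumps vanish in the sector: for [j <= h] the rotated point lies below
    the side [theta = 0], for larger [j] beyond the side [theta = a]. *)
Lemma seed_sector x y : sector a x y -> seed x y = bump a x y.
Proof.
intros HS. pose proof angle_bounds as Ha. pose proof angle_mult as Hm.
destruct (sector_polar a x y Ha HS) as [r [t [Hr [Ht [-> ->]]]]].
assert (HV : forall j, rotated_bump j (r * cos t) (r * sin t) = bump a (r * cos (t - INR j * a)) (r * sin (t - INR j * a))).
{ intros j. unfold rotated_bump, rotate. unfold Rminus. rewrite cos_plus, sin_plus. f_equal; ring. }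
assert (H : forall n, (n <= 2 * h - 1)%nat -> alt_sum (S n) (r * cos t) (r * sin t) = bump a (r * cos t) (r * sin t)).
{ induction n as [|n IH]; intros Hn.
  - simpl alt_sum. rewrite HV. simpl INR. rewrite Rmult_0_l, Rminus_0_r. ring.
  - change (alt_sum (S (S n)) (r * cos t) (r * sin t)) with
      (alt_sum (S n) (r * cos t) (r * sin t) + (-1) ^ (S n) * rotated_bump (S n) (r * cos t) (r * sin t)).
    rewrite IH by lia. rewrite HV, (bump_zero a (r * cos (t - INR (S n) * a))); [rewrite Rmult_0_r; apply Rplus_0_r|].
    rewrite side_dist_polar.
    assert (Hn1 : 1 <= INR (S n)) by (apply (le_INR 1); lia).
    destruct (Nat.le_gt_cases (S n) h) as [C|C].
    + left. apply le_INR in C.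
      assert (INR (S n) * a <= PI) by (rewrite <- Hm; apply Rmult_le_compat_r; lra).
      assert (a <= INR (S n) * a) by nra.
      assert (0 <= sin (INR (S n) * a - t)) by (apply sin_ge_0; lra).
      replace (t - INR (S n) * a) with (- (INR (S n) * a - t)) by ring. rewrite sin_neg. nra.
    + right. assert (C' : INR h <= INR (S n)) by (apply le_INR; lia).
      assert (C2 : INR (S n) + 1 <= 2 * INR h).
      { rewrite <- S_INR. replace (2 * INR h) with (INR (2 * h)) by (rewrite mult_INR; reflexivity). apply le_INR. lia. }
      assert (PI <= INR (S n) * a) by (rewrite <- Hm; apply Rmult_le_compat_r; lra).
      assert ((INR (S n) + 1) * a <= 2 * PI) by (rewrite <- Hm; replace (2 * (INR h * a)) with (2 * INR h * a) by ring; apply Rmult_le_compat_r; lra).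
      assert (sin (a - (t - INR (S n) * a)) <= 0) by (apply sin_le_0; lra). nra. }
unfold seed. replace (2 * h)%nat with (S (2 * h - 1)) by lia. apply H. lia.
Qed.

(** In the sector this is the symmetry of the bump in the distances to the two
    sides; it propagates because the reflection conjugates the rotation to its
    inverse. *)
Lemma seed_odd : odd_y seed.
Proof.
intros x0 y0. apply (cover (fun x y => seed x (- y) = - seed x y)).
- intros x y HS.
  assert (E : seed x (- y) = - seed (cos a * x - sin a * (- y)) (sin a * x + cos a * (- y))).
  { rewrite seed_rot. ring. }
  rewrite E, !seed_sector; [|exact HS|].
  + f_equal. rewrite !bump_eq.
    assert (E1 : sin a * x + cos a * - y = side_dist a x y) by (unfold side_dist; ring).
    assert (E2 : side_dist a (cos a * x - sin a * - y) (sin a * x + cos a * - y) = y).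
    { unfold side_dist. pose proof (sin2_cos2 a) as S. unfold Rsqr in S.
      transitivity ((sin a * sin a + cos a * cos a) * y); [ring|rewrite S; ring]. }
    rewrite E2, E1, (Rplus_comm (side_dist a x y) y). ring.
  + destruct HS as [H1 H2]. split.
    * unfold side_dist in H2. lra.
    * unfold side_dist. pose proof (sin2_cos2 a) as S. unfold Rsqr in S.
      replace (sin a * (cos a * x - sin a * - y) - cos a * (sin a * x + cos a * - y)) with ((sin a * sin a + cos a * cos a) * y) by ring.
      rewrite S. lra.
- intros x y H.
  (* reflecting a rotated point is rotating backwards the reflected point *)
  set (X := cos a * x - sin a * y). set (Y := sin a * x + cos a * y).
  assert (E1 : seed X Y = - seed x y) by apply seed_rot.
  assert (E2 : seed x (- y) = - seed X (- Y)).
  { rewrite <- (seed_rot X (- Y)).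
    pose proof (sin2_cos2 a) as S. unfold Rsqr in S.
    f_equal; unfold X, Y.
    - transitivity ((sin a * sin a + cos a * cos a) * x); [rewrite S; ring|ring].
    - transitivity ((sin a * sin a + cos a * cos a) * - y); [rewrite S; ring|ring]. }
  lra.
Qed.

Lemma seed_C11 : exists M f1 f2, C11 M seed f1 f2.
Proof.
assert (H : forall n, exists M f1 f2, C11 M (alt_sum n) f1 f2).
{ induction n as [|n [M [f1 [f2 IH]]]].
  - exists 0, (fun _ _ => 0), (fun _ _ => 0). simpl.
    assert (B0 : bdd 0 (fun _ _ => 0)) by (intros x y; rewrite Rabs_R0; lra).
    assert (L0 : lip 0 (fun _ _ => 0)) by (intros x y x' y'; rewrite Rminus_0_r, Rabs_R0; lra).
    constructor; try assumption; intros; apply (is_derive_const (V := R_NormedModule) 0).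
  - destruct (rotate_bump_C11 (- (INR n * a)) a) as [M' [g1 [g2 HR]]].
    pose proof (C11_lin _ _ _ _ _ _ _ _ ((-1) ^ n) IH HR) as HL.
    eexists _, _, _. exact HL. }
apply H.
Qed.

(** The side [theta = a] is fixed by the reflection in it, which is the composition
    of [y -> - y] with two rotations. *)
Lemma odd_boundary f x y : odd_y f -> rot_odd a f -> y = 0 \/ side_dist a x y = 0 -> f x y = 0.
Proof.
intros Ho Hr [->|Hd].
- specialize (Ho x 0). rewrite Ropp_0 in Ho. lra.
- unfold side_dist in Hd.
  pose proof (Hr x (- y)) as E1. rewrite Ho in E1.
  pose proof (Hr (cos a * x - sin a * - y) (sin a * x + cos a * - y)) as E2. rewrite E1 in E2.
  pose proof (sin2_cos2 a) as S. unfold Rsqr in S.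
  replace (sin a * x + cos a * - y) with 0 in E2 by lra.
  assert (EX : cos a * (cos a * x - sin a * - y) - sin a * 0 = x).
  { transitivity (cos a * cos a * x + cos a * (sin a * y)); [ring|].
    transitivity ((sin a * sin a + cos a * cos a) * x - sin a * (sin a * x - cos a * y)); [ring|]. rewrite S, Hd. ring. }
  assert (EY : sin a * (cos a * x - sin a * - y) + cos a * 0 = y).
  { transitivity ((sin a * sin a + cos a * cos a) * y + cos a * (sin a * x - cos a * y)); [ring|]. rewrite S, Hd. ring. }
  rewrite EX, EY in E2. lra.
Qed.

(** The term [5 s] makes this increasing on [-1, 1]; it corresponds to the constant 4
    of the resolvent. *)
Definition cubic (s : R) : R := 5 * s - s ^ 3.
Definition rhs (f : R -> R -> R) (x y : R) : R := cubic (f x y).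
Fixpoint iterate (n : nat) : R -> R -> R := match n with O => seed | S k => resolvent (rhs (iterate k)) end.

Lemma cubic_mono s t : -1 <= s -> s <= t -> t <= 1 -> cubic s <= cubic t.
Proof. intros H1 H2 H3. unfold cubic. assert (s * s + s * t + t * t <= 3) by nra.
 assert (0 <= (t - s) * (5 - (s * s + s * t + t * t))) by (apply Rmult_le_pos; lra). simpl. lra. Qed.

Lemma cubic_odd s : cubic (- s) = - cubic s. Proof. unfold cubic. ring. Qed.

Lemma rhs_bdd f : bdd 1 f -> bdd 4 (rhs f).
Proof.
intros H x y. specialize (H x y). apply Rabs_le_between in H. unfold rhs. apply Rabs_le.
pose proof (cubic_mono (-1) (f x y) ltac:(lra) ltac:(lra) ltac:(lra)).
pose proof (cubic_mono (f x y) 1 ltac:(lra) ltac:(lra) ltac:(lra)).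
unfold cubic in *. lra.
Qed.

Lemma cubic_lip s t : Rabs s <= 1 -> Rabs t <= 1 -> Rabs (cubic s - cubic t) <= 8 * Rabs (s - t).
Proof.
intros Hs Ht. apply Rabs_le_between in Hs. apply Rabs_le_between in Ht.
unfold cubic. replace (5 * s - s ^ 3 - (5 * t - t ^ 3)) with ((5 - (s * s + s * t + t * t)) * (s - t)) by ring.
rewrite Rabs_mult. apply Rmult_le_compat_r; [apply Rabs_pos|]. apply Rabs_le. nra.
Qed.

Lemma rhs_lip f L : bdd 1 f -> lip L f -> lip (8 * L) (rhs f).
Proof.
intros HB HL x y x' y'. unfold rhs. eapply Rle_trans; [apply cubic_lip; apply HB|].
rewrite Rmult_assoc. apply Rmult_le_compat_l; [lra|apply HL].
Qed.

Lemma rhs_C11 {M f f1 f2} : C11 M f f1 f2 -> exists M',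
  C11 M' (rhs f) (fun x y => (5 - 3 * f x y ^ 2) * f1 x y) (fun x y => (5 - 3 * f x y ^ 2) * f2 x y).
Proof.
intros H. pose proof (C11_mult _ _ _ _ _ _ _ _ (C11_mult _ _ _ _ _ _ _ _ H H) H) as H3.
pose proof (C11_lin _ _ _ _ _ _ _ _ 4 H H) as H5.
pose proof (C11_lin _ _ _ _ _ _ _ _ (-1) H5 H3) as [A0 A1 A2 L1 L2 D1 D2].
assert (E0 : forall x y, f x y + 4 * f x y + -1 * (f x y * f x y * f x y) = rhs f x y) by (intros; unfold rhs, cubic; ring).
assert (E1 : forall x y, f1 x y + 4 * f1 x y + -1 * ((f1 x y * f x y + f x y * f1 x y) * f x y + f x y * f x y * f1 x y)
  = (5 - 3 * f x y ^ 2) * f1 x y) by (intros; ring).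
assert (E2 : forall x y, f2 x y + 4 * f2 x y + -1 * ((f2 x y * f x y + f x y * f2 x y) * f x y + f x y * f x y * f2 x y)
  = (5 - 3 * f x y ^ 2) * f2 x y) by (intros; ring).
eexists. constructor.
- intros x y. rewrite <- E0. apply A0.
- intros x y. rewrite <- E1. apply A1.
- intros x y. rewrite <- E2. apply A2.
- intros x y x' y'. rewrite <- !E1. apply L1.
- intros x y x' y'. rewrite <- !E2. apply L2.
- intros x y. rewrite <- E1. eapply is_derive_ext; [|apply D1]. intros t. apply E0.
- intros x y. rewrite <- E2. eapply is_derive_ext; [|apply D2]. intros t. apply E0.
Qed.

Lemma C11_resolvent {M f f1 f2} : C11 M f f1 f2 -> C11 (kbound * M) (resolvent f) (resolvent_d1 f) (resolvent_d2 f).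
Proof.
intros H. pose proof (C11_lip H) as Lf. pose proof (C11_bdd H) as Bf.
constructor.
- apply resolvent_bdd with M; assumption.
- apply resolvent_d1_bdd with M; assumption.
- apply resolvent_d2_bdd with M; assumption.
- apply resolvent_d1_lip with M; assumption.
- apply resolvent_d2_lip with M; assumption.
- intros x y. apply (resolvent_der1 M f f1 f2), H.
- intros x y. apply (resolvent_der2 M f f1 f2), H.
Qed.

Lemma resolvent_lap M f f1 f2 x y : C11 M f f1 f2 -> lap_at (resolvent f) x y (4 * resolvent f x y - f x y).
Proof.
intros H. exists (resolvent_d1 f1 x y), (resolvent_d2 f2 x y). split; [|split].
- exists (fun t => resolvent_d1 f t y). split; [|apply (resolvent_d1_der1 M f f1 f2), H].
  exists (mkposreal 1 Rlt_0_1). intros t _. apply (resolvent_der1 M f f1 f2), H.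
- exists (fun t => resolvent_d2 f x t). split; [|apply (resolvent_d2_der2 M f f1 f2), H].
  exists (mkposreal 1 Rlt_0_1). intros t _. apply (resolvent_der2 M f f1 f2), H.
- symmetry. apply (resolvent_eqn M f f1 f2), H.
Qed.

Lemma abs_le_cover f m : rot_odd a f -> (forall x y, sector a x y -> Rabs (f x y) <= m) -> bdd m f.
Proof.
intros Hr H. intros x y. revert x y. apply (cover (fun x y => Rabs (f x y) <= m)); [exact H|].
intros x y Hx. rewrite Hr, Rabs_Ropp. exact Hx.
Qed.

Lemma rhs_odd f : odd_y f -> odd_y (rhs f).
Proof. intros H x y. unfold rhs. rewrite H. apply cubic_odd. Qed.

Lemma rhs_rot f : rot_odd a f -> rot_odd a (rhs f).
Proof. intros H x y. unfold rhs. rewrite H. apply cubic_odd. Qed.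

Lemma lap_opp_plus c w x y l : lap_at w x y l -> lap_at (fun s t => c + (-1) * w s t) x y (- l).
Proof.
intros H. assert (H0 : lap_at (fun _ _ => c) x y 0).
{ exists 0, 0. split; [|split]; [apply second_derive_const|apply second_derive_const|ring]. }
pose proof (lap_lin _ _ _ _ _ _ (-1) H0 H) as H1.
replace (- l) with (0 + -1 * l) by ring. exact H1.
Qed.

(** Subsolutions [w] of [4 w - Delta w <= g] lie below the resolvent of any [f >= g];
    the symmetries of [f] enter only to make its resolvent vanish on the sides. *)
Lemma resolvent_compare f g Mf f1 f2 m w : C11 Mf f f1 f2 -> odd_y f -> rot_odd a f ->
  (forall x y, continuity_2d_pt w x y) -> bdd m w ->
  (forall x y, sector a x y -> (y = 0 \/ side_dist a x y = 0) -> w x y <= 0) ->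
  (forall x y, 0 < y -> 0 < side_dist a x y -> exists l, lap_at w x y l /\ 4 * w x y - l <= g x y) ->
  (forall x y, sector a x y -> g x y <= f x y) ->
  forall x y, sector a x y -> w x y <= resolvent f x y.
Proof.
intros H Ho Hr Hc Hb Hbd Hw Hgf x y [Hy Hd].
pose proof (C11_lip H) as Lf. pose proof (C11_bdd H) as Bf.
pose proof (C11_resolvent H) as HL.
enough (0 <= resolvent f x y + (-1) * w x y) by lra.
apply (max_principle_sector a (fun x y => resolvent f x y + (-1) * w x y) (kbound * Mf + Rabs (-1) * m)); [| | | |exact Hy|exact Hd].
- intros u v. apply continuity_2d_lin; [|apply Hc]. apply lip_continuity_2d with (kbound * Mf). apply (C11_lip HL).
- apply bdd_lin; [apply HL|exact Hb].
- intros u v Hu Hv Hbb. specialize (Hbd u v (conj Hu Hv) Hbb).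
  rewrite (odd_boundary (resolvent f) u v).
  + lra.
  + apply (resolvent_odd f Mf Mf); assumption.
  + apply (resolvent_rot a f Mf Mf); assumption.
  + exact Hbb.
- intros u v Hu Hv. destruct (Hw u v Hu Hv) as [l [Hl Hle]].
  exists (4 * resolvent f u v - f u v + (-1) * l). split.
  + apply lap_lin; [apply (resolvent_lap Mf f f1 f2), H|exact Hl].
  + intros _. specialize (Hgf u v (conj (Rlt_le _ _ Hu) (Rlt_le _ _ Hv))). lra.
Qed.

(** The properties that the iteration preserves.  A constant M that is uniform in
    [n] comes later, from the boundedness of the operator. *)
Definition admissible (f : R -> R -> R) := odd_y f /\ rot_odd a f /\ bdd 1 f /\
  (exists M f1 f2, C11 M f f1 f2) /\ (forall x y, sector a x y -> 0 <= f x y).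

Lemma admissible_seed : admissible seed.
Proof.
split; [apply seed_odd|]. split; [apply seed_rot|]. split; [|split].
- apply abs_le_cover; [apply seed_rot|]. intros x y H. rewrite (seed_sector x y H).
  pose proof (bump_bounds a x y). apply Rabs_le. lra.
- apply seed_C11.
- intros x y H. rewrite (seed_sector x y H). apply bump_bounds.
Qed.

Lemma lap_const c x y : lap_at (fun _ _ => c) x y 0.
Proof. exists 0, 0. split; [|split]; [apply second_derive_const|apply second_derive_const|ring]. Qed.

Lemma admissible_step f : admissible f -> admissible (resolvent (rhs f)).
Proof.
intros [Ho [Hr [Hb [[M [f1 [f2 H]]] Hp]]]].
destruct (rhs_C11 H) as [M' HG].
pose proof (C11_lip HG) as LG. pose proof (C11_bdd HG) as BG.
pose proof (C11_resolvent HG) as HS.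
assert (So : odd_y (resolvent (rhs f))) by (apply (resolvent_odd _ M' M'); [exact LG|exact BG|apply rhs_odd, Ho]).
assert (Sr : rot_odd a (resolvent (rhs f))) by (apply (resolvent_rot a _ M' M'); [exact LG|exact BG|apply rhs_rot, Hr]).
assert (Hpos : forall x y, sector a x y -> 0 <= resolvent (rhs f) x y).
{ apply (resolvent_compare (rhs f) (fun _ _ => 0) M' _ _ 0 (fun _ _ => 0) HG (rhs_odd f Ho) (rhs_rot f Hr)).
  - intros x y. apply continuity_2d_pt_const.
  - intros x y. rewrite Rabs_R0. lra.
  - intros. lra.
  - intros x y _ _. exists 0. split; [apply lap_const|lra].
  - intros x y HS'. specialize (Hp x y HS'). specialize (Hb x y). apply Rabs_le_between in Hb.
    unfold rhs. pose proof (cubic_mono 0 (f x y) ltac:(lra) Hp ltac:(lra)) as X. unfold cubic at 1 in X. lra. }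
split; [exact So|]. split; [exact Sr|]. split; [|split].
- apply abs_le_cover; [exact Sr|]. intros x y HS'. rewrite Rabs_right by (apply Rle_ge, Hpos, HS').
  destruct HS' as [Hy Hd].
  enough (0 <= 1 + (-1) * resolvent (rhs f) x y) by lra.
  apply (max_principle_sector a (fun x y => 1 + (-1) * resolvent (rhs f) x y) (1 + Rabs (-1) * (kbound * M'))); [| | | |exact Hy|exact Hd].
  + intros u v. apply (continuity_2d_lin (fun _ _ => 1)); [apply continuity_2d_pt_const|].
    apply lip_continuity_2d with (kbound * M'). apply (C11_lip HS).
  + apply (bdd_lin 1 _ (fun _ _ => 1)); [intros u v; rewrite Rabs_R1; lra|apply HS].
  + intros u v _ _ Hbb. rewrite (odd_boundary _ u v So Sr Hbb). lra.
  + intros u v _ _. exists (- (4 * resolvent (rhs f) u v - rhs f u v)). split.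
    * apply lap_opp_plus. apply (resolvent_lap M' _ _ _ _ _ HG).
    * intros _. pose proof (rhs_bdd f Hb u v) as X. apply Rabs_le_between in X. lra.
- eexists _, _, _. exact HS.
- exact Hpos.
Qed.

Lemma admissible_iterate n : admissible (iterate n).
Proof. induction n as [|n IH]; [apply admissible_seed|apply admissible_step, IH]. Qed.

Lemma admissible_continuous f x y : admissible f -> continuity_2d_pt f x y.
Proof. intros [_ [_ [_ [[M [f1 [f2 H]]] _]]]]. apply lip_continuity_2d with M. apply (C11_lip H). Qed.

Lemma iterate_step0 x y : sector a x y -> iterate 0 x y <= iterate 1 x y.
Proof.
intros HS. simpl. destruct admissible_seed as [Ho [Hr [Hb [[M [f1 [f2 H]]] Hp]]]].
destruct (rhs_C11 H) as [M' HG]. rewrite (seed_sector x y HS).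
apply (resolvent_compare (rhs seed) (rhs (bump a)) M' _ _ (1 / 2) (bump a) HG (rhs_odd seed Ho) (rhs_rot seed Hr)); [| | | | |exact HS].
- intros u v. destruct (bump_C11 a) as [MB [b1 [b2 HB]]]. apply lip_continuity_2d with MB. apply (C11_lip HB).
- intros u v. pose proof (bump_bounds a u v). apply Rabs_le. lra.
- intros u v _ Hbb. rewrite bump_zero; [lra|]. destruct Hbb; [left|right]; lra.
- intros u v _ _. destruct (bump_sub a u v) as [l [Hl Hle]]. exists l. split; [exact Hl|].
  unfold rhs, cubic. lra.
- intros u v HS'. unfold rhs. rewrite (seed_sector u v HS'). lra.
Qed.

Lemma iterate_mono n x y : sector a x y -> iterate n x y <= iterate (S n) x y.
Proof.
revert x y. induction n as [|n IH]; intros x y HS; [apply iterate_step0, HS|].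
change (iterate (S (S n))) with (resolvent (rhs (iterate (S n)))).
destruct (admissible_iterate (S n)) as [Ho [Hr [Hb [[M [f1 [f2 H]]] Hp]]]].
destruct (admissible_iterate n) as [Ho' [Hr' [Hb' [[N [h1 [h2 H']]] Hp']]]].
destruct (rhs_C11 H) as [M' HG]. destruct (rhs_C11 H') as [N' HG'].
apply (resolvent_compare (rhs (iterate (S n))) (rhs (iterate n)) M' _ _ 1 (iterate (S n)) HG (rhs_odd _ Ho) (rhs_rot _ Hr)); [| | | | |exact HS].
- intros u v. apply admissible_continuous, admissible_iterate.
- exact Hb.
- intros u v _ Hbb. rewrite (odd_boundary _ u v Ho Hr Hbb). lra.
- intros u v _ _. exists (4 * iterate (S n) u v - rhs (iterate n) u v). split; [|lra].
  simpl. apply (resolvent_lap N' _ _ _ _ _ HG').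
- intros u v HS'. unfold rhs. specialize (Hb u v). specialize (Hb' u v).
  apply Rabs_le_between in Hb. apply Rabs_le_between in Hb'.
  apply cubic_mono; [lra|apply IH, HS'|lra].
Qed.

(** Monotone and bounded in the sector, and equivariant. *)
Lemma iterate_cv x y : ex_finite_lim_seq (fun n => iterate n x y).
Proof.
revert x y. apply (cover (fun x y => ex_finite_lim_seq (fun n => iterate n x y))).
- intros x y HS. apply ex_finite_lim_seq_incr with 1.
  + intros n. apply iterate_mono, HS.
  + intros n. destruct (admissible_iterate n) as [_ [_ [Hb _]]]. specialize (Hb x y). apply Rabs_le_between in Hb. lra.
- intros x y [l Hl]. exists (- l).
  apply is_lim_seq_ext with (fun n => - iterate n x y).
  + intros n. destruct (admissible_iterate n) as [_ [Hr _]]. symmetry. apply Hr.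
  + apply (proj1 (is_lim_seq_opp _ l)). exact Hl.
Qed.

Definition sol (x y : R) : R := real (Lim_seq (fun n => iterate n x y)).
Lemma sol_lim x y : is_lim_seq (fun n => iterate n x y) (sol x y).
Proof. apply Lim_seq_correct', iterate_cv. Qed.

Lemma sol_ge x y : sector a x y -> bump a x y <= sol x y.
Proof.
intros HS. rewrite <- (seed_sector x y HS).
apply (is_lim_seq_le (fun _ => seed x y) _ (Finite (seed x y)) (Finite (sol x y))) with (2 := is_lim_seq_const _) (3 := sol_lim x y).
induction n as [|n IH]; [apply Rle_refl|]. apply Rle_trans with (1 := IH), iterate_mono, HS.
Qed.

Lemma sol_bdd : bdd 1 sol.
Proof.
intros x y. apply (lim_abs_le (sol_lim x y)).
intros n. apply admissible_iterate.
Qed.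

Lemma sol_rot : rot_odd a sol.
Proof.
intros x y. pose proof (sol_lim (cos a * x - sin a * y) (sin a * x + cos a * y)) as H1.
pose proof (proj1 (is_lim_seq_opp _ _) (sol_lim x y)) as H2.
apply (is_lim_seq_ext _ (fun n => iterate n (cos a * x - sin a * y) (sin a * x + cos a * y))) in H2.
- apply is_lim_seq_unique in H1. apply is_lim_seq_unique in H2. rewrite H2 in H1. simpl in H1. inversion H1. reflexivity.
- intros n. destruct (admissible_iterate n) as [_ [Hr _]]. symmetry. apply Hr.
Qed.

(** Bounds the gradients of the iterates and the Lipschitz constants of these gradients,
    from index 2 on: each of the two properties takes one application of the resolvent. *)
Let grad_bound := kbound * (8 * (kbound * 4)) + kbound * 4.

Lemma kbound4 : 0 <= kbound * 4.
Proof. pose proof kbound_pos. lra. Qed.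

(** Only the supremum of [5 u - u ^ 3], at most 4, enters: one application of the
    resolvent gives a Lipschitz constant that does not depend on [n]. *)
Lemma iterate_lip n : lip (kbound * 4) (iterate (S n)).
Proof.
destruct (admissible_iterate n) as [_ [_ [Hb [[M [f1 [f2 H]]] _]]]]. destruct (rhs_C11 H) as [M' HG].
pose proof (C11_resolvent HG) as HS. pose proof (C11_lip HG) as LG.
pose proof (rhs_bdd _ Hb) as B4.
apply (lip_of_partials _ (resolvent_d1 (rhs (iterate n))) (resolvent_d2 (rhs (iterate n)))); [| |apply HS|apply HS].
- apply resolvent_d1_bdd with M'; assumption.
- apply resolvent_d2_bdd with M'; assumption.
Qed.

Lemma sol_lip : lip (kbound * 4) sol.
Proof.
intros x y x' y'.
assert (H := is_lim_seq_abs _ _ (is_lim_seq_minus' _ _ _ _ (sol_lim x y) (sol_lim x' y'))).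
apply (is_lim_seq_incr_1 (fun n => Rabs (iterate n x y - iterate n x' y'))) in H.
apply (is_lim_seq_le _ (fun _ => kbound * 4 * (Rabs (x - x') + Rabs (y - y'))) _ _) with (2 := H) (3 := is_lim_seq_const _).
intros n. apply iterate_lip.
Qed.

Lemma rhs_iterate_lip n : lip (8 * (kbound * 4)) (rhs (iterate (S n))).
Proof. apply rhs_lip; [apply admissible_iterate|apply iterate_lip]. Qed.

Lemma rhs_iterate_bdd n : bdd 4 (rhs (iterate n)).
Proof. apply rhs_bdd, admissible_iterate. Qed.

Lemma rhs_iterate_lim x y : is_lim_seq (fun n => rhs (iterate n) x y) (rhs sol x y).
Proof.
unfold rhs. apply (is_lim_seq_continuous cubic (fun n => iterate n x y) (sol x y)); [|apply sol_lim].
apply continuity_pt_filterlim, (ex_derive_continuous cubic). unfold cubic. auto_derive. exact I.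
Qed.

Lemma nconv_rhs_iterate_lim k w x y : decay kbound k -> weight w ->
  is_lim_seq (fun n => nconv k w (rhs (iterate (S n))) x y) (nconv k w (rhs sol) x y).
Proof.
intros Hk Hw. apply (is_lim_seq_scal_l _ _ (Finite (conv k w (rhs sol) x y))).
apply (conv_lim kbound k w (fun n => rhs (iterate (S n))) (rhs sol) (8 * (kbound * 4)) 4 x y Hk Hw).
- intros n. apply rhs_iterate_lip.
- intros n. apply rhs_iterate_bdd.
- intros u v. apply (is_lim_seq_incr_1 (fun n => rhs (iterate n) u v)). apply rhs_iterate_lim.
Qed.

Lemma resolvent_d1_rhs_iterate_lim x y : is_lim_seq (fun n => resolvent_d1 (rhs (iterate (S n))) x y) (resolvent_d1 (rhs sol) x y).
Proof. apply nconv_rhs_iterate_lim; [apply kbound_spec|apply weight_cos]. Qed.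

Lemma resolvent_d2_rhs_iterate_lim x y : is_lim_seq (fun n => resolvent_d2 (rhs (iterate (S n))) x y) (resolvent_d2 (rhs sol) x y).
Proof. apply nconv_rhs_iterate_lim; [apply kbound_spec|apply weight_sin]. Qed.

Lemma sol_fix x y : sol x y = resolvent (rhs sol) x y.
Proof.
assert (H : is_lim_seq (fun n => resolvent (rhs (iterate (S n))) x y) (resolvent (rhs sol) x y)).
{ apply nconv_rhs_iterate_lim; [apply kbound_spec|apply weight_1]. }
pose proof (sol_lim x y) as H0. apply (is_lim_seq_incr_1 (fun n => iterate n x y)) in H0.
apply (is_lim_seq_incr_1 (fun n => iterate (S n) x y)) in H0.
apply is_lim_seq_unique in H0. apply is_lim_seq_unique in H. simpl in H0, H. rewrite H in H0. inversion H0. reflexivity.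
Qed.

Lemma rhs_sol_lip : lip (8 * (kbound * 4)) (rhs sol).
Proof. apply rhs_lip; [apply sol_bdd|apply sol_lip]. Qed.

Lemma rhs_sol_bdd : bdd 4 (rhs sol).
Proof. apply rhs_bdd, sol_bdd. Qed.

(** The second order Taylor bounds of the iterates have a common constant and pass
    to the limit. *)
Lemma sol_C11 : C11 (1 + grad_bound) sol (resolvent_d1 (rhs sol)) (resolvent_d2 (rhs sol)).
Proof.
pose proof kbound4 as H4. pose proof kbound_pos as HK.
assert (HKK : 0 <= kbound * (8 * (kbound * 4))) by (apply Rmult_le_pos; lra).
assert (HU : forall n, C11 (1 + grad_bound) (iterate (S (S n))) (resolvent_d1 (rhs (iterate (S n)))) (resolvent_d2 (rhs (iterate (S n))))).
{ intros n. destruct (admissible_iterate (S n)) as [_ [_ [_ [[M [f1 [f2 H]]] _]]]]. destruct (rhs_C11 H) as [M' HG].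
  pose proof (C11_resolvent HG) as HS. constructor.
  - apply bdd_weaken with 1; [apply admissible_iterate|unfold grad_bound; lra].
  - apply bdd_weaken with (kbound * 4); [|unfold grad_bound; lra]. apply resolvent_d1_bdd with (8 * (kbound * 4)); [apply rhs_iterate_lip|apply rhs_iterate_bdd].
  - apply bdd_weaken with (kbound * 4); [|unfold grad_bound; lra]. apply resolvent_d2_bdd with (8 * (kbound * 4)); [apply rhs_iterate_lip|apply rhs_iterate_bdd].
  - apply lip_weaken with (kbound * (8 * (kbound * 4))); [|unfold grad_bound; lra]. apply resolvent_d1_lip with 4; [apply rhs_iterate_lip|apply rhs_iterate_bdd].
  - apply lip_weaken with (kbound * (8 * (kbound * 4))); [|unfold grad_bound; lra]. apply resolvent_d2_lip with 4; [apply rhs_iterate_lip|apply rhs_iterate_bdd].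
  - apply HS.
  - apply HS. }
assert (Hl2 : forall x y, is_lim_seq (fun n => iterate (S (S n)) x y) (sol x y)).
{ intros x y. apply (is_lim_seq_incr_1 (fun n => iterate (S n) x y)). apply (is_lim_seq_incr_1 (fun n => iterate n x y)). apply sol_lim. }
constructor.
- apply bdd_weaken with 1; [apply sol_bdd|unfold grad_bound; lra].
- apply bdd_weaken with (kbound * 4); [|unfold grad_bound; lra]. apply resolvent_d1_bdd with (8 * (kbound * 4)); [apply rhs_sol_lip|apply rhs_sol_bdd].
- apply bdd_weaken with (kbound * 4); [|unfold grad_bound; lra]. apply resolvent_d2_bdd with (8 * (kbound * 4)); [apply rhs_sol_lip|apply rhs_sol_bdd].
- apply lip_weaken with (kbound * (8 * (kbound * 4))); [|unfold grad_bound; lra]. apply resolvent_d1_lip with 4; [apply rhs_sol_lip|apply rhs_sol_bdd].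
- apply lip_weaken with (kbound * (8 * (kbound * 4))); [|unfold grad_bound; lra]. apply resolvent_d2_lip with 4; [apply rhs_sol_lip|apply rhs_sol_bdd].
- intros x y. apply (is_derive_quad (fun t => sol t y) _ _ (1 + grad_bound)). intros s.
  apply (lim_abs_le (is_lim_seq_minus' _ _ _ _ (is_lim_seq_minus' _ _ _ _ (Hl2 (x + s) y) (Hl2 x y))
     (is_lim_seq_scal_l _ s _ (resolvent_d1_rhs_iterate_lim x y)))).
  intros n. apply (C11_taylor_x (HU n)).
- intros x y. apply (is_derive_quad (fun t => sol x t) _ _ (1 + grad_bound)). intros s.
  apply (lim_abs_le (is_lim_seq_minus' _ _ _ _ (is_lim_seq_minus' _ _ _ _ (Hl2 x (y + s)) (Hl2 x y))
     (is_lim_seq_scal_l _ s _ (resolvent_d2_rhs_iterate_lim x y)))).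
  intros n. apply (C11_taylor_y (HU n)).
Qed.
End angle.

(** * Exponential decay, distance to the boundary and conclusion *)

Lemma sol_lap h (Hh : (1 <= h)%nat) x y : lap_at (sol h) x y (sol h x y ^ 3 - sol h x y).
Proof.
pose proof (sol_C11 h Hh) as HU. destruct (rhs_C11 HU) as [M' HG].
replace (sol h x y ^ 3 - sol h x y) with (4 * sol h x y - rhs (sol h) x y) by (unfold rhs, cubic; ring).
rewrite (sol_fix h Hh x y) at 1. rewrite <- (resolvent_eqn _ _ _ _ x y HG).
eexists _, _. split; [|split; [|reflexivity]].
- exists (fun t => resolvent_d1 (rhs (sol h)) t y). split; [|apply (resolvent_d1_der1 _ _ _ _ _ _ HG)].
  exists (mkposreal 1 Rlt_0_1). intros t _. apply (C11_der1 HU).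
- exists (fun t => resolvent_d2 (rhs (sol h)) x t). split; [|apply (resolvent_d2_der2 _ _ _ _ _ _ HG)].
  exists (mkposreal 1 Rlt_0_1). intros t _. apply (C11_der2 HU).
Qed.

Lemma cosh_even t : cosh (- t) = cosh t.
Proof. unfold cosh. rewrite Ropp_involutive. rewrite Rplus_comm. reflexivity. Qed.

Lemma cosh_abs t : cosh (Rabs t) = cosh t.
Proof. unfold Rabs. destruct (Rcase_abs t); [apply cosh_even|reflexivity]. Qed.

(** For [m > 18] the square of half side [L = (m - 18) / 2] about the point stays at
    distance at least 18 from both sides, so that there [u >= 1/2].  On its boundary the
    barrier [coshbar / cosh (L / 2)] is at least 1, hence at least [1 - u], and at the centre it is at most
    [4 exp (- L / 2)].  For [m <= 18] the claim follows from [1 - u <= 1], since the factor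
    [exp (9 / 2)] is [exp (18 / 4)]. *)
Lemma sol_decay h (Hh : (1 <= h)%nat) x y m : sector (PI / INR h) x y -> m <= y -> m <= side_dist (PI / INR h) x y ->
  1 - sol h x y <= 4 * exp (9 / 2) * exp (- (1 / 4) * m).
Proof.
intros HS Hmy Hmd. set (a := PI / INR h) in *.
assert (Hpos : 0 <= sol h x y).
{ pose proof (sol_ge h Hh x y HS). pose proof (bump_bounds (PI / INR h) x y). lra. }
rewrite Rmult_assoc, <- exp_plus.
destruct (Rle_dec m 18) as [Hm|Hm].
- pose proof (exp_ineq1_le (9 / 2 + - (1 / 4) * m)). lra.
- apply Rnot_le_lt in Hm. set (L := (m - 18) / 2). assert (HL : 0 < L) by (unfold L; lra).
  set (c := / cosh (L / 2)).
  assert (Hch : 0 < cosh (L / 2)) by apply cosh_pos.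
  assert (Hc : 0 < c) by (apply Rinv_0_lt_compat, Hch).
  set (bb := coshbar (1 / 2) x y).
  assert (Hbb : forall u v, 0 < bb u v).
  { intros u v. unfold bb, coshbar. pose proof (cosh_pos (1 / 2 * (u - x))). pose proof (cosh_pos (1 / 2 * (v - y))). lra. }
  assert (HK : forall u v, Rabs (u - x) <= L -> Rabs (v - y) <= L -> 1 / 2 <= sol h u v <= 1).
  { intros u v Hu Hv. pose proof (side_dist_lip a x y u v) as Hd'. apply Rabs_le_between in Hd'.
    pose proof Hv as Hv'. apply Rabs_le_between in Hv'.
    assert (2 * L = m - 18) by (unfold L; field).
    pose proof (sol_bdd h Hh u v) as Hb. apply Rabs_le_between in Hb.
    split; [|lra]. rewrite <- (bump_far a u v) by lra. apply (sol_ge h Hh). split; fold a; lra. }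
  assert (Hmain : 0 <= (-1 + 1 * sol h x y) + c * bb x y).
  { apply (max_principle_compact (box_dist x y L)
      (fun u v => (-1 + 1 * sol h u v) + c * bb u v) (Rabs x + Rabs y + L)).
    - apply box_dist_lip.
    - intros u v H. apply box_dist_ge in H. rewrite Rminus_0_r in H. destruct H as [Hu Hv].
      apply Rabs_le_between in Hu. apply Rabs_le_between in Hv.
      pose proof (Rle_abs x). pose proof (Rle_abs y). pose proof (Rle_abs (- x)). pose proof (Rle_abs (- y)).
      rewrite Rabs_Ropp in *. pose proof (Rabs_pos x). pose proof (Rabs_pos y). lra.
    - intros u v. apply continuity_2d_lin; [|apply coshbar_cont].
      apply (continuity_2d_lin (fun _ _ => -1)); [apply continuity_2d_pt_const|].
      apply lip_continuity_2d with (kbound * 4). apply (sol_lip h Hh).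
    - intros u v Hbox Hneg. pose proof Hbox as [Hu Hv]%box_dist_ge. rewrite Rminus_0_r in Hu, Hv.
      specialize (HK u v Hu Hv). pose proof (Hbb u v) as Hb.
      assert (Hcb : 0 < c * bb u v) by (apply Rmult_lt_0_compat; assumption).
      assert (Hedge : forall s t, Rabs s = L -> 1 <= c * (cosh (1 / 2 * s) + cosh (1 / 2 * t))).
      { intros s t Hs. rewrite <- (cosh_abs (1 / 2 * s)), Rabs_mult, Hs, (Rabs_right (1 / 2)) by lra.
        replace (1 / 2 * L) with (L / 2) by field. pose proof (cosh_pos (1 / 2 * t)).
        assert (E : c * cosh (L / 2) = 1) by (unfold c; field; lra).
        assert (0 < c * cosh (1 / 2 * t)) by (apply Rmult_lt_0_compat; assumption). lra. }
      split.
      + destruct (box_dist_pos _ _ _ _ _ Hbox) as [K|[E|E]]; [exact K| |]; exfalso.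
        * pose proof (Hedge _ (v - y) E). unfold bb, coshbar in Hneg. lra.
        * pose proof (Hedge _ (u - x) E). unfold bb, coshbar in Hneg. lra.
      + exists ((0 + 1 * (sol h u v ^ 3 - sol h u v)) + c * ((1 / 2) ^ 2 * bb u v)). split.
        * apply lap_lin; [|apply coshbar_lap].
          apply (lap_lin (fun _ _ => -1)); [apply lap_const|apply (sol_lap h Hh)].
        * assert (X : 3 / 4 * (1 - sol h u v) <= sol h u v - sol h u v ^ 3).
          { replace (sol h u v - sol h u v ^ 3) with ((sol h u v * (1 + sol h u v)) * (1 - sol h u v)) by ring.
            apply Rmult_le_compat_r; [lra|nra]. }
          lra.
    - apply box_dist_ge. rewrite !Rminus_diag, Rabs_R0. lra. }
  assert (E : bb x y = 2).
  { unfold bb, coshbar. rewrite !Rminus_diag, !Rmult_0_r. rewrite cosh_0. ring. }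
  rewrite E in Hmain.
  assert (Hcl : c <= 2 * exp (- (L / 2))).
  { unfold c. rewrite exp_Ropp. pose proof (exp_pos (L / 2)) as HE.
    replace (2 * / exp (L / 2)) with (/ (exp (L / 2) / 2)) by (field; lra).
    apply Rinv_le_contravar; [lra|]. pose proof (cosh_lower (L / 2)) as X. rewrite Rabs_right in X by lra. exact X. }
  replace (9 / 2 + - (1 / 4) * m) with (- (L / 2)) by (unfold L; field). lra.
Qed.

Lemma dist_segment x y dx dy s t :
  dist_euc (x + s * dx) (y + s * dy) (x + t * dx) (y + t * dy) = Rabs (s - t) * sqrt (dx ^ 2 + dy ^ 2).
Proof.
unfold dist_euc. rewrite <- sqrt_Rsqr_abs, <- sqrt_mult_alt by apply Rle_0_sqr.
f_equal. unfold Rsqr. ring.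
Qed.

(** The supremum of the parameters at which the segment from [(x, y)] to [(p, q0)]
    meets A gives a boundary point.  An infinite greatest lower bound is read as 0,
    which satisfies the estimate too. *)
Lemma dist_boundary_le (A : R -> R -> Prop) x y p q0 : A x y -> ~ A p q0 ->
  dist_to_set x y (boundary2 A) <= dist_euc x y p q0.
Proof.
intros HA HnA. set (dx := p - x). set (dy := q0 - y). set (N := sqrt (dx ^ 2 + dy ^ 2)).
assert (HN : 0 <= N) by apply sqrt_pos.
set (E := fun t => 0 <= t <= 1 /\ A (x + t * dx) (y + t * dy)).
assert (E0 : E 0). { split; [lra|]. rewrite !Rmult_0_l, !Rplus_0_r. exact HA. }
destruct (completeness E) as [s [Hub Hlub]].
- exists 1. intros t [Ht _]. lra.
- exists 0. exact E0.
- assert (Hs0 : 0 <= s) by (apply Hub, E0).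
  assert (Hs1 : s <= 1) by (apply Hlub; intros t [Ht _]; lra).
  assert (Hp : x + 1 * dx = p /\ y + 1 * dy = q0) by (unfold dx, dy; lra).
  assert (Hb : boundary2 A (x + s * dx) (y + s * dy)).
  { intros eps He.
    assert (Hd : 0 < eps / (N + 1)) by (apply Rdiv_lt_0_compat; lra).
    assert (Hsmall : forall t, Rabs (s - t) < eps / (N + 1) ->
      dist_euc (x + s * dx) (y + s * dy) (x + t * dx) (y + t * dy) < eps).
    { intros t Ht. rewrite dist_segment. fold N.
      assert (Ee : eps / (N + 1) * (N + 1) = eps) by (field; lra).
      pose proof (Rabs_pos (s - t)). nra. }
    split.
    - assert (Ht : exists t, E t /\ s - eps / (N + 1) < t).
      { apply NNPP. intros Hn. assert (s <= s - eps / (N + 1)); [|lra].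
        apply Hlub. intros t Ht. apply Rnot_lt_le. intros Hlt. apply Hn. exists t. split; assumption. }
      destruct Ht as [t [Ht Hlt]]. exists (x + t * dx), (y + t * dy). split; [apply Ht|].
      apply Hsmall. specialize (Hub t Ht). rewrite Rabs_right by lra. lra.
    - destruct (Rle_dec 1 s) as [H1|H1].
      + assert (s = 1) by lra. subst s. exists p, q0. split; [exact HnA|].
        destruct Hp as [Hp1 Hp2]. specialize (Hsmall 1).
        rewrite Rminus_diag, Rabs_R0, Hp1, Hp2 in Hsmall. rewrite Hp1, Hp2. apply Hsmall, Hd.
      + apply Rnot_le_lt in H1.
        set (t := Rmin 1 (s + eps / (N + 1) / 2)).
        assert (Ht : s < t <= 1). { split; [apply Rmin_glb_lt; lra|apply Rmin_l]. }
        assert (Ht2 : t <= s + eps / (N + 1) / 2) by apply Rmin_r.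
        exists (x + t * dx), (y + t * dy). split.
        * intros HAt. assert (Et : E t) by (split; [lra|exact HAt]). specialize (Hub t Et). lra.
        * apply Hsmall. rewrite Rabs_minus_sym, Rabs_right by lra. lra. }
  assert (Ed : dist_euc x y (x + s * dx) (y + s * dy) = s * N).
  { pose proof (dist_segment x y dx dy 0 s) as H. rewrite !Rmult_0_l, !Rplus_0_r in H. rewrite H. fold N.
    rewrite Rabs_minus_sym, Rminus_0_r, Rabs_right by lra. reflexivity. }
  assert (EN : dist_euc x y p q0 = N).
  { pose proof (dist_segment x y dx dy 0 1) as H. destruct Hp as [Hp1 Hp2]. rewrite Hp1, Hp2 in H.
    rewrite !Rmult_0_l, !Rplus_0_r in H. rewrite H. fold N.
    rewrite Rabs_minus_sym, Rminus_0_r, Rabs_R1. ring. }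
  rewrite EN. unfold dist_to_set.
  destruct (Glb_Rbar_correct (fun d => exists b c : R, boundary2 A b c /\ d = dist_euc x y b c)) as [Hlb _].
  specialize (Hlb (s * N)).
  destruct (Glb_Rbar (fun d => exists b c : R, boundary2 A b c /\ d = dist_euc x y b c)) as [g| |]; simpl in *.
  + assert (g <= s * N).
    { apply Hlb. exists (x + s * dx), (y + s * dy). split; [exact Hb|symmetry; exact Ed]. }
    nra.
  + exact HN.
  + exact HN.
Qed.

Lemma Derive_fst_ext (f f1 : R -> R -> R) : (forall x y, is_derive (fun t => f t y) x (f1 x y)) ->
  forall u v, Derive (fun z => f z v) u = f1 u v.
Proof. intros H u v. apply is_derive_unique, H. Qed.

Lemma Derive_snd_ext (f f2 : R -> R -> R) : (forall x y, is_derive (fun t => f x t) y (f2 x y)) ->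
  forall u v, Derive (fun z => f u z) v = f2 u v.
Proof. intros H u v. apply is_derive_unique, H. Qed.

Lemma locally_2d_all (P : R -> R -> Prop) x y : (forall u v, P u v) -> locally_2d P x y.
Proof. intros H. exists (mkposreal 1 Rlt_0_1). intros u v _ _. apply H. Qed.

Lemma ex_diff_1 (f f1 f2 : R -> R -> R) x y :
  (forall x y, is_derive (fun t => f t y) x (f1 x y)) -> (forall x y, is_derive (fun t => f x t) y (f2 x y)) ->
  (forall x y, continuity_2d_pt f x y) -> (forall x y, continuity_2d_pt f1 x y) -> (forall x y, continuity_2d_pt f2 x y) ->
  ex_diff_n f 1 x y.
Proof.
intros D1 D2 C C1 C2. simpl. split; [apply C|]. split; [eexists; apply D1|]. split; [eexists; apply D2|].
split; (split; [|exact I]).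
- apply continuity_2d_pt_ext_loc with f1; [|apply C1]. apply locally_2d_all. intros u v.
  symmetry. apply (Derive_fst_ext f f1 D1).
- apply continuity_2d_pt_ext_loc with f2; [|apply C2]. apply locally_2d_all. intros u v.
  symmetry. apply (Derive_snd_ext f f2 D2).
Qed.

(** The definition of [ex_diff_n] refers to [Derive]; here it is checked on given
    functions that are its values. *)
Lemma ex_diff_2 (f f1 f2 : R -> R -> R) x y :
  (forall x y, is_derive (fun t => f t y) x (f1 x y)) -> (forall x y, is_derive (fun t => f x t) y (f2 x y)) ->
  (forall x y, continuity_2d_pt f x y) -> ex_diff_n f1 1 x y -> ex_diff_n f2 1 x y -> ex_diff_n f 2 x y.
Proof.
intros D1 D2 C C1 C2. split; [apply C|]. split; [eexists; apply D1|]. split; [eexists; apply D2|]. split.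
- apply ex_diff_n_ext_loc with f1; [|exact C1]. apply locally_2d_all. intros u v.
  symmetry. apply (Derive_fst_ext f f1 D1).
- apply ex_diff_n_ext_loc with f2; [|exact C2]. apply locally_2d_all. intros u v.
  symmetry. apply (Derive_snd_ext f f2 D2).
Qed.

Lemma opp_der1 (f f1 : R -> R -> R) : (forall x y, is_derive (fun t => f t y) x (f1 x y)) ->
  forall x y, is_derive (fun t => - f t y) x (- f1 x y).
Proof. intros H x y. apply (is_derive_opp (fun t => f t y)), H. Qed.

Lemma opp_der2 (f f1 : R -> R -> R) : (forall x y, is_derive (fun t => f x t) y (f1 x y)) ->
  forall x y, is_derive (fun t => - f x t) y (- f1 x y).
Proof. intros H x y. apply (is_derive_opp (fun t => f x t)), H. Qed.

Lemma lip_opp_cont L f x y : lip L f -> continuity_2d_pt (fun u v => - f u v) x y.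
Proof. intros H. apply (continuity_2d_pt_opp f), lip_continuity_2d with L, H. Qed.

Lemma sol_classical h (Hh : (1 <= h)%nat) : classical_allen_cahn (fun x y => - sol h x y).
Proof.
pose proof (sol_C11 h Hh) as HU. destruct (rhs_C11 HU) as [M' HG].
set (G := rhs (sol h)) in *.
set (G1 := fun x y => (5 - 3 * sol h x y ^ 2) * resolvent_d1 G x y) in *.
set (G2 := fun x y => (5 - 3 * sol h x y ^ 2) * resolvent_d2 G x y) in *.
pose proof HG as [B0 B1 B2 L1 L2 _ _].
pose proof (fun x y => resolvent_d1_der1 _ _ _ _ x y HG) as D11. pose proof (fun x y => resolvent_d1_der2 _ _ _ _ x y HG) as D12.
pose proof (fun x y => resolvent_d2_der1 _ _ _ _ x y HG) as D21. pose proof (fun x y => resolvent_d2_der2 _ _ _ _ x y HG) as D22.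
pose proof (C11_der1 HU) as D1. pose proof (C11_der2 HU) as D2.
pose proof (C11_lip HU) as LU.
split.
- intros x y.
  apply (ex_diff_2 _ (fun u v => - resolvent_d1 G u v) (fun u v => - resolvent_d2 G u v)).
  + apply (opp_der1 _ _ D1).
  + apply (opp_der2 _ _ D2).
  + intros u v. apply lip_opp_cont with (1 := LU).
  + apply (ex_diff_1 _ (fun u v => - resolvent_d1 G1 u v) (fun u v => - resolvent_d1 G2 u v)).
    * apply (opp_der1 _ _ D11).
    * apply (opp_der2 _ _ D12).
    * intros u v. apply lip_opp_cont with (1 := C11_lip1 HU).
    * intros u v. apply lip_opp_cont with (1 := resolvent_d1_lip _ _ _ L1 B1).
    * intros u v. apply lip_opp_cont with (1 := resolvent_d1_lip _ _ _ L2 B2).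
  + apply (ex_diff_1 _ (fun u v => - resolvent_d2 G1 u v) (fun u v => - resolvent_d2 G2 u v)).
    * apply (opp_der1 _ _ D21).
    * apply (opp_der2 _ _ D22).
    * intros u v. apply lip_opp_cont with (1 := C11_lip2 HU).
    * intros u v. apply lip_opp_cont with (1 := resolvent_d2_lip _ _ _ L1 B1).
    * intros u v. apply lip_opp_cont with (1 := resolvent_d2_lip _ _ _ L2 B2).
- intros x y. unfold laplacian.
  assert (E1 : partial_derive 2 0 (fun u v => - sol h u v) x y = - resolvent_d1 G1 x y).
  { unfold partial_derive. simpl Derive_n.
    transitivity (Derive (fun t => - resolvent_d1 G t y) x).
    - apply Derive_ext. intros t. apply (Derive_fst_ext _ _ (opp_der1 _ _ D1)).
    - apply (Derive_fst_ext _ _ (opp_der1 _ _ D11)). }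
  assert (E2 : partial_derive 0 2 (fun u v => - sol h u v) x y = - resolvent_d2 G2 x y).
  { unfold partial_derive. simpl Derive_n.
    transitivity (Derive (fun t => - resolvent_d2 G x t) y).
    - apply Derive_ext. intros t. apply (Derive_snd_ext _ _ (opp_der2 _ _ D2)).
    - apply (Derive_snd_ext _ _ (opp_der2 _ _ D22)). }
  rewrite E1, E2. pose proof (resolvent_eqn _ _ _ _ x y HG) as E.
  pose proof (sol_fix h Hh x y) as F. fold G in F. rewrite <- F in E.
  change (G x y) with (5 * sol h x y - sol h x y ^ 3) in E. fold G1 G2 in E. lra.
Qed.

Theorem theorem1p3 :
  forall h : nat, (1 <= h)%nat ->
  exists U : R -> R -> R,
    classical_allen_cahn U /\
    rotation_equivariant h U /\
    exists C k K r0 : R,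
      0 < C /\ 0 < k /\ 0 < K /\ 0 < r0 /\
      (2 * C * INR h) ^ 2 / PI ^ 2 <= r0 /\
      forall x y : R, sectorQ h C r0 x y ->
        Rabs (U x y + 1) <=
          K * exp (- k * dist_to_set x y (boundary2 (sectorQ h C r0))).
Proof.
intros h Hh. exists (fun x y => - sol h x y).
split; [apply sol_classical, Hh|]. split.
{ unfold rotation_equivariant. intros x y. apply f_equal, (sol_rot h Hh). }
pose proof PI_RGT_0 as HP.
assert (Hr0 : 0 <= (2 * 1 * INR h) ^ 2 / PI ^ 2) by (apply Rle_div_r; [apply pow_lt; lra|]; rewrite Rmult_0_l; apply pow2_ge_0).
exists 1, (1 / 4), (4 * exp (9 / 2)), ((2 * 1 * INR h) ^ 2 / PI ^ 2 + 1).
set (r0 := (2 * 1 * INR h) ^ 2 / PI ^ 2 + 1) in *.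
pose proof (exp_pos (9 / 2)) as HE.
assert (Hr0' : 0 < r0 /\ (2 * 1 * INR h) ^ 2 / PI ^ 2 <= r0) by (unfold r0; lra).
split; [lra|]. split; [lra|]. split; [lra|]. split; [apply Hr0'|]. split; [apply Hr0'|].
pose proof (angle_bounds h Hh) as Ha.
assert (HQ : forall x y, sectorQ h 1 r0 x y -> 0 < y /\ 0 < side_dist (PI / INR h) x y).
{ intros x y [r [t [-> [-> [Hr [Ht1 Ht2]]]]]].
  assert (Hsr : 0 < 1 / sqrt r) by (apply Rdiv_lt_0_compat; [lra|apply sqrt_lt_R0; lra]).
  rewrite side_dist_polar. split; (apply Rmult_lt_0_compat; [lra|apply sin_gt_0; lra]). }
intros x y Hxy. destruct (HQ x y Hxy) as [Hy Hd].
set (D := dist_to_set x y (boundary2 (sectorQ h 1 r0))).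
set (a := PI / INR h) in *.
assert (D1 : D <= y).
{ apply Rle_trans with (dist_euc x y x 0).
  - apply dist_boundary_le; [exact Hxy|]. intros H. destruct (HQ _ _ H) as [H1 _]. lra.
  - right. unfold dist_euc. rewrite Rminus_diag, Rminus_0_r. unfold Rsqr at 1. rewrite Rmult_0_l, Rplus_0_l.
    apply sqrt_Rsqr. lra. }
assert (D2 : D <= side_dist a x y).
{ pose proof (sin2_cos2 a) as S. unfold Rsqr in S.
  apply Rle_trans with (dist_euc x y (x - sin a * side_dist a x y) (y + cos a * side_dist a x y)).
  - apply dist_boundary_le; [exact Hxy|]. intros H. destruct (HQ _ _ H) as [_ H1].
    assert (E : side_dist a (x - sin a * side_dist a x y) (y + cos a * side_dist a x y) = side_dist a x y - (sin a * sin a + cos a * cos a) * side_dist a x y)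
      by (unfold side_dist; ring).
    rewrite S in E. lra.
  - right. unfold dist_euc. transitivity (sqrt (Rsqr (side_dist a x y))); [|apply sqrt_Rsqr; lra].
    f_equal. transitivity ((sin a * sin a + cos a * cos a) * Rsqr (side_dist a x y)); [unfold Rsqr; ring|rewrite S; ring]. }
pose proof (sol_bdd h Hh x y) as Hb. apply Rabs_le_between in Hb.
rewrite Rabs_right by lra.
pose proof (sol_decay h Hh x y D (conj (Rlt_le _ _ Hy) (Rlt_le _ _ Hd)) D1 D2). lra.
Qed.
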